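(* Let $n\ge2$, and let $q\in\Bbbk$ be a root of unity whose order $m\ge3$ is odd. Let $T$ and $I$ be as below and $R=T/I$. Then (1) $R$ has Krull dimension $n^2$; (2) $R$ is an integral domain; (3) the $\Bbbk$-algebra map $T\to Z(\mathcal{O}_q(M_n(\Bbbk)))$ given by $Z_{ij}\mapsto x_{ij}^m$, $Y_{tr}\mapsto D(t)^r\tau(D(n-t))^{m-r}$, $D\mapsto D_q$ induces an isomorphism $R\cong Z(\mathcal{O}_q(M_n(\Bbbk)))$.
   Context: $\Bbbk$ is an algebraically closed field of characteristic zero. $\mathcal{O}_q(M_n(\Bbbk))$ is generated by $x_{ij}$, $1\le i,j\le n$, with relations: for $i<k$, $j<l$: $x_{ij}x_{kl}=x_{kl}x_{ij}+(q-q^{-1})x_{il}x_{kj}$; for $i<k$: $x_{ij}x_{kj}=qx_{kj}x_{ij}$; for $j<l$: $x_{ij}x_{il}=qx_{il}x_{ij}$; for $i<k$, $l<j$: $x_{ij}x_{kl}=x_{kl}x_{ij}$. Quantum minors $D(I,J)=\sum_{\pi\in S_r}(-q)^{\ell(\pi)}x_{i_1j_{\pi(1)}}\cdots x_{i_rj_{\pi(r)}}$ for $I=\{i_1<\dots<i_r\}$, $J=\{j_1<\dots<j_r\}$, $\ell(\pi)$ the number of inversions; $D_q=D([n],[n])$; $D(t)=D(\{1,\dots,t\},\{n-t+1,\dots,n\})$; $\tau$ is the transpose automorphism $x_{ij}\mapsto x_{ji}$. $T=\Bbbk[Z_{ij},Y_{tr},D\mid 1\le i,j\le n,1\le t\le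 n-1,1\le r\le m-1]$ is a commutative polynomial ring and $I\subseteq T$ is the ideal generated by $D^m-\det(Z_{ij})$ and, for $1\le t\le n-1$, $1\le i,j\le m-1$: $Y_{ti}Y_{tj}-Y_{t,i+j}\det(B_{n-t})$ if $i+j<m$; $Y_{ti}Y_{tj}-\det(A_t)\det(B_{n-t})$ if $i+j=m$; $Y_{ti}Y_{tj}-Y_{t,i+j-m}\det(A_t)$ if $i+j>m$. Here $A_t=(Z_{ij})_{1\le i\le t,\ n-t+1\le j\le n}$, $B_t=(Z_{ij})_{n-t+1\le i\le n,\ 1\le j\le t}$, and $\det$ is the ordinary determinant. *)

(* Defs.v *)
From HB Require Import structures.
From mathcomp Require Import all_boot all_order all_algebra all_fingroup.
From mathcomp Require Import mpoly.
Set Implicit Arguments. Unset Strict Implicit. Unset Printing Implicit Defensive.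
Import Order.TTheory GRing.Theory.
Local Open Scope ring_scope.

Section Ideals.
Variable R : comRingType.

Definition is_ideal (P : R -> Prop) : Prop :=
  [/\ P 0, (forall a b, P a -> P b -> P (a + b)) & (forall a b, P b -> P (a * b))].

Definition is_prime_ideal (P : R -> Prop) : Prop :=
  [/\ is_ideal P, ~ P 1 & (forall a b, P (a * b) -> P a \/ P b)].

Definition ideal_gen (S : R -> Prop) : R -> Prop :=
  fun p => exists s : seq (R * R), (forall u, u \in s -> S u.2) /\
                                   p = \sum_(u <- s) u.1 * u.2.

(* A chain P_0 < P_1 < ... < P_l of prime ideals of R containing I,
   i.e. a chain of primes of length l in the quotient R/I. *)
Definition prime_chain_over (I : R -> Prop) (l : nat) (c : nat -> R -> Prop) : Prop :=
  (forall i, (i <= l)%N -> is_prime_ideal (c i) /\ (forall p, I p -> c i p)) /\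
  (forall i, (i < l)%N -> (forall p, c i p -> c i.+1 p) /\ exists p, c i.+1 p /\ ~ c i p).

Definition krull_dim_quot_eq (I : R -> Prop) (d : nat) : Prop :=
  (exists c, prime_chain_over I d c) /\ ~ (exists c, prime_chain_over I d.+1 c).

Definition quot_is_domain (I : R -> Prop) : Prop := is_prime_ideal I.
End Ideals.

(* Variables: Z_ij (1<=i,j<=n), Y_tr (1<=t<=n-1, 1<=r<=m-1), D.        *)
Definition Tvar (n m : nat) : finType :=
  (('I_n * 'I_n) + ('I_n.-1 * 'I_m.-1) + unit)%type.

Definition Tring (k : fieldType) (n m : nat) := {mpoly k[#|{: Tvar n m}|]}.

Section TDefs.
Variables (k : fieldType) (n m : nat).
Local Notation T := (Tring k n m).

Definition Tx (v : Tvar n m) : T := 'X_(enum_rank v).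

(* 1-based indices; out-of-range indices give 0 (never used) *)
Definition Zv (i j : nat) : T :=
  match insub i.-1 : option 'I_n, insub j.-1 : option 'I_n with
  | Some a, Some b => Tx (inl (inl (a, b)))
  | _, _ => 0 end.

Definition Yv (t r : nat) : T :=
  match insub t.-1 : option 'I_n.-1, insub r.-1 : option 'I_m.-1 with
  | Some a, Some b => Tx (inl (inr (a, b)))
  | _, _ => 0 end.

Definition Dv : T := Tx (inr tt).

Definition detZ : T := \det (\matrix_(a < n, b < n) Zv a.+1 b.+1).
Definition detA (t : nat) : T := \det (\matrix_(a < t, b < t) Zv a.+1 (n - t + b.+1)).
Definition detB (t : nat) : T := \det (\matrix_(a < t, b < t) Zv (n - t + a.+1) b.+1).

Definition Igens (p : T) : Prop :=
  p = Dv ^+ m - detZ \/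
  exists t i j, [/\ (1 <= t <= n.-1)%N, (1 <= i <= m.-1)%N, (1 <= j <= m.-1)%N &
    p = Yv t i * Yv t j -
        (if (i + j < m)%N then Yv t (i + j) * detB (n - t)
         else if (i + j == m)%N then detA t * detB (n - t)
         else Yv t (i + j - m) * detA t)].

Definition Iideal : T -> Prop := ideal_gen Igens.
End TDefs.

(* The quantum matrix algebra O_q(M_n(k)), given by generators and      *)
(* relations: a k-algebra A with a family x_ij satisfying the relations  *)
(* and universal among such.                                           *)
Section Quantum.
Variables (k : fieldType) (n : nat) (q : k).

Definition qrel (B : algType k) (y : 'I_n -> 'I_n -> B) : Prop :=
  forall i j k' l : 'I_n,
  [/\ ((i < k')%N -> (j < l)%N -> y i j * y k' l = y k' l * y i j + (q - q^-1) *: (y i l * y k' j)),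
      ((i < k')%N -> y i j * y k' j = q *: (y k' j * y i j)),
      ((j < l)%N -> y i j * y i l = q *: (y i l * y i j)) &
      ((i < k')%N -> (l < j)%N -> y i j * y k' l = y k' l * y i j)].

Definition alg_hom (A B : algType k) (f : A -> B) : Prop :=
  [/\ (forall a b, f (a + b) = f a + f b), (forall a b, f (a * b) = f a * f b),
      f 1 = 1 & (forall (c : k) a, f (c *: a) = c *: f a)].

Definition is_Oq (A : algType k) (x : 'I_n -> 'I_n -> A) : Prop :=
  qrel x /\
  forall (B : algType k) (y : 'I_n -> 'I_n -> B), qrel y ->
    (exists f : A -> B, alg_hom f /\ forall i j, f (x i j) = y i j) /\
    (forall f g : A -> B, alg_hom f -> alg_hom g ->
       (forall i j, f (x i j) = y i j) -> (forall i j, g (x i j) = y i j) ->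
       forall a, f a = g a).

Variables (A : algType k) (x : 'I_n -> 'I_n -> A).

(* 1-based access, 0 out of range *)
Definition xx (i j : nat) : A :=
  match insub i.-1 : option 'I_n, insub j.-1 : option 'I_n with
  | Some a, Some b => x a b
  | _, _ => 0 end.

Definition perm_length (r : nat) (s : 'S_r) : nat :=
  #|[set p : 'I_r * 'I_r | (p.1 < p.2)%N && (s p.2 < s p.1)%N]|.

(* quantum minor D(I,J), I = [:: i_1 < ... < i_r], J likewise *)
Definition qminor (I J : seq nat) : A :=
  \sum_(s : 'S_(size I)) (- q) ^+ perm_length s *:
     \prod_(a < size I) xx (nth 0%N I a) (nth 0%N J (s a)).

(* tau(D(I,J)) for the transpose automorphism tau : x_ij |-> x_ji,
   i.e. the image of the defining expression of D(I,J) under tau *)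
Definition tau_qminor (I J : seq nat) : A :=
  \sum_(s : 'S_(size I)) (- q) ^+ perm_length s *:
     \prod_(a < size I) xx (nth 0%N J (s a)) (nth 0%N I a).

Definition Dq : A := qminor (iota 1 n) (iota 1 n).
Definition Dt (t : nat) : A := qminor (iota 1 t) (iota (n - t).+1 t).
Definition tau_Dt (t : nat) : A := tau_qminor (iota 1 t) (iota (n - t).+1 t).

Definition center : A -> Prop := fun a => forall b, a * b = b * a.
End Quantum.

Definition phi_gen (k : fieldType) (n m : nat) (q : k) (A : algType k)
  (x : 'I_n -> 'I_n -> A) (v : Tvar n m) : A :=
  match v with
  | inl (inl (i, j)) => x i j ^+ m
  | inl (inr (t, r)) => Dt q x t.+1 ^+ r.+1 * tau_Dt q x (n - t.+1) ^+ (m - r.+1)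
  | inr _ => Dq q x
  end.

Definition phi (k : fieldType) (n m : nat) (q : k) (A : algType k)
  (x : 'I_n -> 'I_n -> A) : Tring k n m -> A :=
  mmap (fun c : k => c%:A) (fun i => phi_gen q x (enum_val i)).

(* Main.v *)
(* Inverting Cauchon's deleting derivations one column at a time embeds O_q(M_n) in a
   quantum torus with generators u_ij: adding a column u replaces row i by row i plus
   u_i u_{i+1}^{-1} times the new row i+1. Row operations show that D_q and the corner
   minors D(t), tau(D(t)) become monomials in the u_ij, which makes their commutation with
   the x_ij explicit. Since the summands q^2-commute, x^m satisfies the same recursion with
   q = 1, whence D^m = det(x_ij^m) for each of these minors.

   The leading term of x_ij is u_ij, so ordered monomials are independent and O_q(M_n) is a
   domain. The leading exponent of a central element is, modulo m, a matrix commuting with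
   the sign matrix sgn(j - i). As m is odd, such matrices are the skew-circulant ones, and
   they are exactly the leading exponents of the products
   Z^z D^a \prod_t Y_{t,r_t} with a, r_t < m. These products span T modulo I and have
   pairwise different leading exponents: this gives the center, the kernel and primality.

   For the dimension, any n^2 + 1 elements of T/I are algebraically dependent by a dimension
   count in O_q(M_n), and the lexicographically smallest monomial of a dependence refutes
   the existence of a longer chain. A chain of length n^2 is given by the points obtained
   from the commutative (q = 1) model by specialising the u_ij to 1 one after the other. *)
Require Import Defs.
From HB Require Import structures.
From mathcomp Require Import all_boot all_order all_algebra all_fingroup.
From mathcomp Require Import mpoly.
From mathcomp Require Import zify ring.
From Stdlib Require Import ClassicalEpsilon FunctionalExtensionality.
Import GRing.Theory.
Local Open Scope ring_scope.
Set Implicit Arguments. Unset Strict Implicit. Unset Printing Implicit Defensive.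

(** * q-commutation and the Gaussian binomial theorem *)

(** The algebra [A] is known only through its universal property, so identities in it are tested on
    homomorphisms to a concrete algebra. At a root of unity, polynomials over a matrix algebra
    suffice as target: a projective representation of the exponents modulo m produces the
    commutation factors, and one variable 'X records the true exponents as digits in base M. Only
    exponents below M are separated, so M is chosen after the elements under study, above their
    filtration degree; no single faithful embedding is used.

    The recursion needs quotients of vertically adjacent torus generators. The weights grow with the
    row, so these quotients have nonnegative degree and 'X is never inverted.

    The determinant lemmas carry a parameter [Q] and an arbitrary algebra because they serve three
    times: for the quantum minors, for the m-th powers with Q = 1, and for points over [k].

    Oddness of m gives that q^2 is again a primitive m-th root, that m divides the binomial
    coefficient m over 2, and that 2 can be cancelled modulo m. *)

Section QCommutation.
Variables (k : fieldType) (B : algType k) (Q : k).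
Hypothesis Q0 : Q != 0.
Implicit Types (a b c : B) (z y : int).

Definition qcomm z a b := a * b = Q ^ z *: (b * a).

Lemma qcomm0P a b : qcomm 0 a b <-> a * b = b * a.
Proof. by rewrite /qcomm expr0z scale1r. Qed.

Lemma qcomm_sym z a b : qcomm z a b -> qcomm (- z) b a.
Proof.
by rewrite /qcomm => ->; rewrite scalerA -expfzDr // addNr expr0z scale1r.
Qed.

Lemma qcommMl z y a b c : qcomm z a c -> qcomm y b c -> qcomm (z + y) (a * b) c.
Proof.
rewrite /qcomm => h1 h2.
rewrite -mulrA h2 -scalerAr (mulrA a) h1 -scalerAl scalerA mulrA.
by rewrite expfzDr // [Q ^ y * _]mulrC.
Qed.

Lemma qcommMr z y a b c : qcomm z c a -> qcomm y c b -> qcomm (z + y) c (a * b).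
Proof.
move=> /qcomm_sym h1 /qcomm_sym h2.
by have /qcomm_sym := qcommMl h1 h2; rewrite opprD !opprK.
Qed.

Lemma qcommDl z a b c : qcomm z a c -> qcomm z b c -> qcomm z (a + b) c.
Proof. by rewrite /qcomm => h1 h2; rewrite mulrDl mulrDr scalerDr h1 h2. Qed.

Lemma qcommDr z a b c : qcomm z c a -> qcomm z c b -> qcomm z c (a + b).
Proof. by rewrite /qcomm => h1 h2; rewrite mulrDl mulrDr scalerDr h1 h2. Qed.

Lemma qcomm0l z a : qcomm z 0 a.
Proof. by rewrite /qcomm mul0r mulr0 scaler0. Qed.

Lemma qcomm0r z a : qcomm z a 0.
Proof. by rewrite /qcomm mul0r mulr0 scaler0. Qed.

Lemma qcomm1l a : qcomm 0 1 a.
Proof. by rewrite /qcomm mul1r mulr1 expr0z scale1r. Qed.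

Lemma qcomm1r a : qcomm 0 a 1.
Proof. by rewrite /qcomm mul1r mulr1 expr0z scale1r. Qed.

Lemma qcommXl z a b (r : nat) : qcomm z a b -> qcomm (z * r%:Z) (a ^+ r) b.
Proof.
move=> h; elim: r => [|r IH]; first by rewrite mulr0 expr0; exact: qcomm1l.
by rewrite exprS intS mulrDr mulr1; exact: qcommMl.
Qed.

Lemma qcommXr z a b (r : nat) : qcomm z a b -> qcomm (z * r%:Z) a (b ^+ r).
Proof.
move=> h; elim: r => [|r IH]; first by rewrite mulr0 expr0; exact: qcomm1r.
by rewrite exprS intS mulrDr mulr1; exact: qcommMr.
Qed.

Lemma qcomm_eq z y a b : qcomm z a b -> z = y -> qcomm y a b.
Proof. by move=> + <-. Qed.

Lemma qcomm_prodr (I : Type) (s : seq I) (F : I -> B) (e : I -> int) a :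
  (forall i, qcomm (e i) a (F i)) ->
  qcomm (\sum_(i <- s) e i) a (\prod_(i <- s) F i).
Proof.
move=> h; elim: s => [|i s IH]; first by rewrite !big_nil; exact: qcomm1r.
by rewrite !big_cons; exact: qcommMr.
Qed.

Lemma qcomm_exprMn z a b (r : nat) : qcomm z a b ->
  (a * b) ^+ r = Q ^ (- z * 'C(r, 2)%:Z) *: (a ^+ r * b ^+ r).
Proof.
move=> h; elim: r => [|r IH].
  by rewrite !expr0 mulr1 bin0n mulr0 expr0z scale1r.
rewrite exprSr IH -scalerAl.
have hb := qcommXr r h.
have -> : a ^+ r * b ^+ r * (a * b) = Q ^ (- (z * r%:Z)) *: (a ^+ r.+1 * b ^+ r.+1).
  rewrite !mulrA -(mulrA (a ^+ r)).
  move/qcomm_sym: hb => ->; rewrite -scalerAr -scalerAl.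
  by rewrite !mulrA -exprSr -mulrA -exprSr.
rewrite scalerA -expfzDr //; congr (_ ^ _ *: _).
by rewrite binS bin1 PoszD mulrDr -!mulNr.
Qed.

Section RootOfUnity.
Variable m : nat.
Hypothesis Qm : Q ^+ m = 1.

Lemma exprz_root_mull z : Q ^ (m%:Z * z) = 1.
Proof. by rewrite -exprz_exp -exprnP Qm exp1rz. Qed.

Lemma exprz_root_mulr z : Q ^ (z * m%:Z) = 1.
Proof. by rewrite mulrC exprz_root_mull. Qed.

Lemma qcomm_root_central z a b : qcomm z a b -> a ^+ m * b = b * a ^+ m.
Proof. by move=> /(qcommXl m); rewrite /qcomm exprz_root_mulr scale1r. Qed.

Lemma qcomm_root_exprMn z a b : odd m -> qcomm z a b ->
  (a * b) ^+ m = a ^+ m * b ^+ m.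
Proof.
move=> om h; rewrite (qcomm_exprMn _ h) bin2odd // PoszM mulrCA.
by rewrite exprz_root_mull scale1r.
Qed.

End RootOfUnity.
End QCommutation.

Section GaussBinomial.
Variables (k : fieldType) (w : k).

(* Gaussian binomial coefficients, normalised so that
   (a + b)^n = \sum_j gbin n j *: b^j a^(n-j) whenever a b = w b a. *)
Fixpoint gbin (n j : nat) : k :=
  match n, j with
  | _, 0 => 1
  | 0, _.+1 => 0
  | n'.+1, j'.+1 => w ^+ j'.+1 * gbin n' j'.+1 + gbin n' j'
  end.

Lemma gbin_small n j : (n < j)%N -> gbin n j = 0.
Proof.
elim: n j => [|n IH] [|j] //= h.
by rewrite !IH ?mulr0 ?add0r // ltnW.
Qed.

Lemma gbinn n : gbin n n = 1.
Proof. by elim: n => //= n ->; rewrite gbin_small // mulr0 add0r. Qed.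

Lemma gbin0 n : gbin n 0 = 1. Proof. by case: n. Qed.

(** The Gaussian form of (j+1) C(n+1, j+1) = (n+1) C(n, j). It avoids quotients of q-factorials,
    which vanish at a root of unity; when w has order n+1 the right side is 0 while the factor on
    the left is not for j < n. *)
Lemma gbin_absorb n j :
  (1 - w ^+ j.+1) * gbin n.+1 j.+1 = (1 - w ^+ n.+1) * gbin n j.
Proof.
elim: n j => [|n IH] [|j] /=; rewrite ?gbin0 ?(mulr0, addr0, mulr1, add0r) //.
  have := IH 0; rewrite gbin0 /= gbin0 => E.
  have {}E : (1 - w ^+ 1) * (w ^+ 1 * gbin n 1 + 1) = 1 - w ^+ n.+1.
    by rewrite E mulr1.
  rewrite [w ^+ n.+2]exprS [w ^+ 1]expr1 in E *.
  rewrite mulrDr mulrCA E; set y := w ^+ n.+1; ring.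
have E1 := IH j.+1; have E2 := IH j; rewrite /= in E1 E2.
set g1 := gbin n j.+2 in E1 E2 *; set g2 := gbin n j.+1 in E1 E2 *.
set g3 := gbin n j in E1 E2 *.
rewrite [w ^+ n.+2]exprS [w ^+ j.+2]exprS in E1 *.
set x := w ^+ j.+1 in E1 E2 *; set y := w ^+ n.+1 in E1 E2 *.
transitivity (w * x * ((1 - w * x) * (w * x * g1 + g2)) +
    w * ((1 - x) * (x * g2 + g3)) + (1 - w) * (x * g2 + g3)); first by ring.
rewrite E1 E2; ring.
Qed.

Lemma gbin_prim n j : n.-primitive_root w -> (0 < j < n)%N -> gbin n j = 0.
Proof.
move=> pw; case: n pw => [|n] pw; first by rewrite ltn0 andbF.
case: j => // j /andP[_ jn].
have := gbin_absorb n j; rewrite (prim_expr_order pw) subrr mul0r.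
move/eqP; rewrite mulf_eq0 => /orP[|/eqP //].
rewrite subr_eq0 eq_sym -(prim_order_dvd pw) => /dvdn_leq.
by move=> /(_ isT); rewrite leqNgt jn.
Qed.

Variable B : algType k.

Lemma gauss_binomial (a b : B) n : a * b = w *: (b * a) ->
  (a + b) ^+ n = \sum_(j < n.+1) gbin n j *: (b ^+ j * a ^+ (n - j)).
Proof.
move=> ab; have abX j : a * b ^+ j = w ^+ j *: (b ^+ j * a).
  elim: j => [|j IH]; first by rewrite !expr0 mulr1 mul1r scale1r.
  rewrite exprSr (mulrA a) IH -scalerAl -(mulrA _ a b) ab -scalerAr scalerA.
  by rewrite -!exprSr mulrA -exprSr.
elim: n => [|n IH]; first by rewrite big_ord1 !expr0 mulr1 scale1r.
have ha : a * \sum_(j < n.+1) gbin n j *: (b ^+ j * a ^+ (n - j)) = a ^+ n.+1 +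
    \sum_(i < n.+1) (w ^+ i.+1 * gbin n i.+1) *: (b ^+ i.+1 * a ^+ (n - i)).
  rewrite big_ord_recl [in RHS]big_ord_recr /= (gbin_small (ltnSn n)) mulr0 scale0r addr0.
  rewrite mulrDr gbin0 expr0 mul1r scale1r subn0 -exprS mulr_sumr; congr (_ + _).
  apply: eq_bigr => i _; rewrite /bump /= add1n.
  rewrite -scalerAr mulrA abX -scalerAl -mulrA -exprS scalerA mulrC.
  by have -> : (n - i = (n - i.+1).+1)%N by have := ltn_ord i; lia.
have hb : b * \sum_(j < n.+1) gbin n j *: (b ^+ j * a ^+ (n - j)) =
    \sum_(i < n.+1) gbin n i *: (b ^+ i.+1 * a ^+ (n - i)).
  by rewrite mulr_sumr; apply: eq_bigr => i _; rewrite -scalerAr mulrA -exprS.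
rewrite exprS IH mulrDl ha hb -addrA -big_split /= [RHS]big_ord_recl.
rewrite /= ?gbin0 expr0 mul1r scale1r subn0; congr (_ + _).
by apply: eq_bigr => i _; rewrite /bump /= add1n subSS -scalerDl.
Qed.

Lemma frobenius_qcomm (a b : B) n : n.-primitive_root w ->
  a * b = w *: (b * a) -> (a + b) ^+ n = a ^+ n + b ^+ n.
Proof.
move=> pw ab; have n0 := prim_order_gt0 pw; rewrite (gauss_binomial _ ab).
case: n n0 pw => // n _ pw.
rewrite big_ord_recl big_ord_recr /= /bump /= gbinn scale1r subn0.
rewrite (gbin_small (leqnn _)) mulr0 add0r scale1r.
rewrite subnn expr0 mulr1 mul1r big1 ?add0r // => i _.
have := gbin_prim pw (j := i.+1); rewrite /= ltnS ltn_ord => -> //.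
by rewrite scale0r.
Qed.

End GaussBinomial.

(** * Quantum determinants *)

Section AlternatingSums.
Variable V : zmodType.

(* The two halves j <= i and i < j of the index square cancel under (j, i) <-> (i + 1, j). *)
Lemma sum_antisym_bump n (f : nat -> nat -> V) :
  (forall i j, (j <= i < n)%N -> f j i = - f i.+1 j) ->
  \sum_(j < n.+1) \sum_(i < n) f j i = 0.
Proof.
move=> hf.
rewrite (eq_bigr (fun j : 'I_n.+1 => \sum_(i < n | (j <= i)%N) f j i +
   \sum_(i < n | (i < j)%N) f j i)); last first.
  move=> j _; rewrite (bigID (fun i : 'I_n => (j <= i)%N)) /=; congr (_ + _).
  by apply: eq_bigl => i; rewrite ltnNge.
rewrite big_split /=.
rewrite [X in X + _]big_ord_recr [X in _ + X + _]big_pred0; last first.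
  by move=> i; rewrite /= leqNgt ltn_ord.
rewrite [X in _ + X]big_ord_recl [X in _ + (X + _)]big_pred0 // addr0 add0r /=.
rewrite (exchange_big_dep predT) //= -big_split /= big1 // => i _.
apply/eqP; rewrite addr_eq0 -sumrN; apply/eqP.
apply: eq_big => [j|j ji]; first by rewrite /bump /= add1n ltnS.
by rewrite hf ?ji ?ltn_ord.
Qed.
End AlternatingSums.

Section QuantumDeterminant.
Variables (k : fieldType) (B : algType k) (Q : k).
Implicit Types Y : nat -> nat -> B.

(** Laplace expansion along the first row, where [bump j] skips column j. The factors stay in row
    order, as in the quantum minors; entries are functions on [nat], so that submatrices need no
    casts. *)
Fixpoint qdet (t : nat) Y : B :=
  if t is t'.+1 then
    \sum_(j < t) (- Q) ^+ j *: (Y 0 j * qdet t' (fun a b => Y a.+1 (bump j b)))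
  else 1.

Arguments qdet : simpl never.

Lemma qdetS t Y : qdet t.+1 Y =
  \sum_(j < t.+1) (- Q) ^+ j *: (Y 0 j * qdet t (fun a b => Y a.+1 (bump j b))).
Proof. by []. Qed.

Lemma bump_lt t j b : (b < t)%N -> (bump j b < t.+1)%N.
Proof. rewrite /bump; case: leqP; lia. Qed.

Lemma eq_qdet t Y Y' :
  (forall a b, (a < t)%N -> (b < t)%N -> Y a b = Y' a b) -> qdet t Y = qdet t Y'.
Proof.
elim: t Y Y' => // t IH Y Y' h; rewrite !qdetS; apply: eq_bigr => j _.
rewrite h ?ltn_ord //; congr (_ *: (_ * _)); apply: IH => a b ha hb.
by rewrite h // bump_lt.
Qed.

Lemma qdet_add_row t a Y Y1 Y2 : (a < t)%N ->
  (forall b, (b < t)%N -> Y a b = Y1 a b + Y2 a b) ->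
  (forall a' b, (a' < t)%N -> (b < t)%N -> a' != a -> Y a' b = Y1 a' b) ->
  (forall a' b, (a' < t)%N -> (b < t)%N -> a' != a -> Y a' b = Y2 a' b) ->
  qdet t Y = qdet t Y1 + qdet t Y2.
Proof.
elim: t a Y Y1 Y2 => // t IH [|a] Y Y1 Y2 hat h0 h1 h2; rewrite !qdetS;
  rewrite -big_split /=; apply: eq_bigr => j _; rewrite -scalerDr; congr (_ *: _).
  rewrite h0 // mulrDl; congr (_ * _ + _ * _); apply: eq_qdet => a' b ha' hb.
    by rewrite h1 // bump_lt.
  by rewrite h2 // bump_lt.
rewrite -h1 // -h2 // -mulrDr; congr (_ * _).
apply: (IH a) => // [b hb|a' b ha' hb na|a' b ha' hb na].
- by rewrite h0 // bump_lt.
- by rewrite h1 // bump_lt.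
- by rewrite h2 // bump_lt.
Qed.

(** In the expansion along the two adjacent rows, a pair of columns and its exchange have
    coefficients that differ by the factor -Q, and the q-commutation of the entries of [v] cancels
    them. The multiplier [c] may be noncentral because it stands to the left of both entries. *)
Lemma qdet_alternate t a (c : B) (v : nat -> B) Y : (a.+1 < t)%N ->
  (forall b, (b < t)%N -> Y a b = c * v b) ->
  (forall b, (b < t)%N -> Y a.+1 b = v b) ->
  (forall i j, (i < j < t)%N -> v i * v j = Q *: (v j * v i)) ->
  qdet t Y = 0.
Proof.
elim: t a v Y => // t IH [|a] v Y hat h0 h1 hv.
  case: t IH hat h0 h1 hv => // t _ _ h0 h1 hv.
  rewrite qdetS; pose f j i := (- Q) ^+ (j + i) *: (c * v j * v (bump j i) *
     qdet t (fun a b => Y a.+2 (bump j (bump i b)))).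
  rewrite (eq_bigr (fun j : 'I_t.+2 => \sum_(i < t.+1) f j i)); last first.
    move=> j _; rewrite qdetS mulr_sumr scaler_sumr; apply: eq_bigr => i _.
    by rewrite /f h0 // h1 ?bump_lt // -scalerAr scalerA -exprD !mulrA.
  apply: sum_antisym_bump => i j /andP[ji it]; rewrite /f.
  have -> : bump j i = i.+1 by rewrite /bump ji.
  have -> : bump i.+1 j = j by rewrite /bump ltnNge ji.
  rewrite (@eq_qdet _ _ (fun a b => Y a.+2 (bump i.+1 (bump j b)))); last first.
    move=> a b _ _; congr (Y _ _); rewrite /bump.
    by case: (leqP j b); case: (leqP i b); case: leqP; case: leqP; lia.
  rewrite -(mulrA c) hv ?ltnS ?ji //.
  rewrite -scalerAr mulrA -scalerAl scalerA -scaleNr; congr (_ *: _).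
  by rewrite addSn exprS mulNr opprK mulrC addnC.
rewrite qdetS big1 // => j _; rewrite (IH a (fun b => v (bump j b))) ?mulr0 ?scaler0 //.
- by move=> b hb; rewrite h0 // bump_lt.
- by move=> b hb; rewrite h1 // bump_lt.
- move=> i i' /andP[ii' i't]; apply: hv; rewrite bump_lt // andbT.
  by rewrite /bump; case: leqP; case: leqP; lia.
Qed.

Lemma qdet_last_col t Y : (forall a, (a < t)%N -> Y a t = 0) ->
  qdet t.+1 Y = qdet t Y * Y t t.
Proof.
elim: t Y => [|t IH] Y h; first by rewrite qdetS big_ord1 expr0 scale1r mulr1 mul1r.
rewrite qdetS [in RHS]qdetS big_ord_recr /= h // mul0r scaler0 addr0 mulr_suml.
apply: eq_bigr => j _; rewrite -scalerAl -mulrA; congr (_ *: (_ * _)).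
rewrite IH; first by rewrite /bump -ltnS ltn_ord.
by move=> a hat; rewrite /bump -ltnS ltn_ord /= add1n h.
Qed.

(** The hypothesis is the relation of quantum matrices that contains no q. Beyond the corner term,
    both sides are expanded twice, removing row 0 and column 0 in opposite orders; only the entries
    at (i+1, 0) and (0, j+1), which commute, have to be exchanged. *)
Lemma qdet_tr t Y :
  (forall a a' b b', (a < a' < t)%N -> (b' < b < t)%N ->
     Y a b * Y a' b' = Y a' b' * Y a b) ->
  qdet t (fun a b => Y b a) = qdet t Y.
Proof.
elim/ltn_ind: t Y => -[|t] // IH Y h.
rewrite !qdetS big_ord_recl [RHS]big_ord_recl /=; congr (_ + _).
  congr (_ *: (_ * _)); transitivity (qdet t (fun a b => Y b.+1 a.+1)).
    by apply: eq_qdet.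
  rewrite (IH t _ (fun a b => Y a.+1 b.+1)) //.
  by move=> a a' b b' ha hb; apply: h.
case: t IH h => [|t] IH h; first by rewrite !big_ord0.
have E (i : 'I_t.+1) : qdet t.+1 (fun a b => Y (bump (bump 0 i) b) a.+1) =
    qdet t.+1 (fun a b => Y (bump (bump 0 i) a) b.+1).
  rewrite (IH t.+1 _ (fun a b => Y (bump (bump 0 i) a) b.+1)) // => a a' b b' ha hb.
  apply: h; last by lia.
  by rewrite /bump /=; case: leqP; case: leqP; have := ltn_ord i; lia.
have E' (j : 'I_t.+1) : qdet t.+1 (fun a b => Y a.+1 (bump (bump 0 j) b)) =
    qdet t.+1 (fun a b => Y b.+1 (bump (bump 0 j) a)).
  rewrite -(IH t.+1 _ (fun a b => Y a.+1 (bump (bump 0 j) b))) // => a a' b b' ha hb.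
  apply: h; first by lia.
  by rewrite /bump /=; case: leqP; case: leqP; have := ltn_ord j; lia.
under eq_bigr => i _ do rewrite E.
under [RHS]eq_bigr => j _ do rewrite E'.
under eq_bigr => i _ do rewrite qdetS mulr_sumr scaler_sumr.
under [RHS]eq_bigr => j _ do rewrite qdetS mulr_sumr scaler_sumr.
rewrite exchange_big /=; apply: eq_bigr => j _; apply: eq_bigr => i _.
rewrite -!scalerAr !scalerA -!exprD !mulrA.
have -> : (bump 0 i + j = bump 0 j + i)%N by rewrite /bump /=; lia.
congr (_ *: (_ * _)).
  have := ltn_ord i; have := ltn_ord j => hj hi.
  rewrite /bump /= !add1n; apply/esym.
  by apply: h; lia.
have bumpSS x y : bump x.+1 y.+1 = (bump x y).+1 by rewrite /bump ltnS addnS.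
transitivity (qdet t (fun a b => Y (bump i a).+1 (bump j b).+1)).
  by apply: eq_qdet => a b _ _; rewrite -!bumpSS.
rewrite -(IH t _ (fun a b => Y (bump i a).+1 (bump j b).+1)) //; last first.
  move=> a a' b b' ha hb; apply: h.
    by rewrite /bump; case: leqP; case: leqP; lia.
  by rewrite /bump; case: leqP; case: leqP; lia.
by apply: eq_qdet => a b _ _; rewrite -!bumpSS.
Qed.
End QuantumDeterminant.
Arguments qdet : simpl never.

Section PermutationSums.

(** A permutation is its value at 0 together with a permutation of the remaining positions. With
    [perm_length_lift] this turns the permutation sum of a quantum minor into the recursion of
    [qdet]. *)
Lemma sum_lift_perm (V : nmodType) t (F : 'S_t.+1 -> V) :
  \sum_(s : 'S_t.+1) F s = \sum_(j < t.+1) \sum_(s : 'S_t) F (lift_perm ord0 j s).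
Proof.
rewrite (partition_big (fun s : 'S_t.+1 => s ord0) predT) //=.
apply: eq_bigr => j _; rewrite (reindex (lift_perm ord0 j)) /=.
  by apply: eq_bigl => s; rewrite lift_perm_id eqxx.
pose ulsf (s : 'S_t.+1) i := odflt i (unlift (s ord0) (s (lift ord0 i))).
have ulsfK (s : 'S_t.+1) i : lift (s ord0) (ulsf s i) = s (lift ord0 i).
  rewrite /ulsf; have := neq_lift ord0 i.
  by rewrite -(can_eq (permK s)) => /unlift_some[] ? ? ->.
have inj_ulsf s : injective (ulsf s).
  move=> i i' /(congr1 (lift (s ord0))); rewrite !ulsfK.
  by move/perm_inj/lift_inj.
exists (fun s => perm (inj_ulsf s)) => [s _ | s].
  by apply/permP => i; rewrite permE /ulsf lift_perm_lift lift_perm_id liftK.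
move/(s _ =P _) => s0; apply/permP => i.
case: (unliftP ord0 i) => [i'|] ->; rewrite ?lift_perm_id //.
by rewrite lift_perm_lift -s0 permE ulsfK.
Qed.

Lemma perm_lengthE t (s : 'S_t) :
  perm_length s = (\sum_(a < t) \sum_(b < t) ((a < b) && (s b < s a)))%N.
Proof.
rewrite /perm_length -sum1_card pair_big /= big_mkcond /=.
by apply: eq_bigr => -[a b] _; rewrite inE /=; case: ifP.
Qed.

Lemma sum_lt_ord t (j : 'I_t.+1) : (\sum_(b < t) (b < j) = j)%N.
Proof.
rewrite -(big_mkord xpredT (fun b => (b < j : nat)%N)).
rewrite (big_cat_nat (n := j)) //=; last by rewrite -ltnS.
rewrite (eq_big_nat _ _ (F2 := fun=> 1%N)) => [|b /andP[_ ->] //].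
rewrite sum_nat_const_nat subn0 muln1 (eq_big_nat _ _ (F2 := fun=> 0%N)).
  by rewrite big1_eq addn0.
by move=> b /andP[h _]; rewrite ltnNge h.
Qed.

(** Position 0 has value [j], hence is inverted with exactly the [j] positions that carry smaller
    values. *)
Lemma perm_length_lift t j (s : 'S_t) :
  perm_length (lift_perm ord0 j s) = (j + perm_length s)%N.
Proof.
rewrite !perm_lengthE big_ord_recl /=; congr (_ + _)%N.
  rewrite big_ord_recl /= add0n -[RHS]sum_lt_ord [RHS](reindex_inj (@perm_inj _ s)).
  apply: eq_bigr => b _; rewrite lift_perm_lift lift_perm_id /= /bump.
  by case: leqP => h; case: ltnP => h'; lia.
apply: eq_bigr => a _; rewrite big_ord_recl /= add0n.
apply: eq_bigr => b _; rewrite !lift_perm_lift /= /bump /= !add1n ltnS.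
by congr (_ && _ : nat); case: leqP => h; case: leqP => h'; lia.
Qed.

Lemma perm_length0 (s : 'S_0) : perm_length s = 0.
Proof. by rewrite perm_lengthE big_ord0. Qed.

Variables (k : fieldType) (B : algType k) (Q : k).

Lemma qdet_perm t (Y : nat -> nat -> B) :
  \sum_(s : 'S_t) (- Q) ^+ perm_length s *: \prod_(a < t) Y a (s a) = qdet Q t Y.
Proof.
elim: t Y => [|t IH] Y.
  rewrite (bigD1 1%g) //= [X in _ + X]big1 ?addr0 => [|s].
    by rewrite perm_length0 scale1r big_ord0.
  by case/eqP; apply/permP => -[].
rewrite sum_lift_perm qdetS; apply: eq_bigr => j _.
rewrite -IH mulr_sumr scaler_sumr; apply: eq_bigr => s _.
rewrite perm_length_lift exprD -scalerA -scalerAr; congr (_ *: (_ *: _)).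
rewrite big_ord_recl lift_perm_id; congr (_ * _).
by apply: eq_bigr => a _; rewrite lift_perm_lift.
Qed.

End PermutationSums.

Lemma det_qdet (k : fieldType) (R : comAlgType k) t (Y : nat -> nat -> R) :
  \det (\matrix_(a < t, b < t) Y a b) = qdet 1 t Y.
Proof.
elim: t Y => [|t IH] Y; first by rewrite det_mx00.
rewrite (expand_det_row _ ord0) qdetS; apply: eq_bigr => j _.
have E : (-1) ^+ j *: (1 : R) = (-1) ^+ j.
  by rewrite -[in RHS](scale1r (1 : R)) -scaleNr exprZn expr1n.
rewrite mxE /cofactor add0n mulrCA -[X in X * _]E mulr_algl -IH.
congr (_ *: (_ * \det _)).
by apply/matrixP => a b; rewrite !mxE.
Qed.

Section QuantumMinors.
Variables (k : fieldType) (n : nat) (q : k) (A : algType k) (x : 'I_n -> 'I_n -> A).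

Lemma qminorE (I J : seq nat) :
  qminor q x I J = qdet q (size I) (fun a b => xx x (nth 0%N I a) (nth 0%N J b)).
Proof. by rewrite -qdet_perm. Qed.

Lemma tau_qminorE (I J : seq nat) :
  tau_qminor q x I J = qdet q (size I) (fun a b => xx x (nth 0%N J b) (nth 0%N I a)).
Proof. by rewrite -qdet_perm. Qed.

End QuantumMinors.

(** * The path model of quantum matrices *)

Section DeletingDerivations.
Variables (k : fieldType) (B : algType k) (Q : k).
Hypothesis Q0 : Q != 0.
Variables (u c : nat -> nat -> B).

(* Rows are counted from the bottom; [model p] is the matrix built from the
   first p columns of [u], the remaining columns being 0. *)
Fixpoint model (p : nat) : nat -> nat -> B :=
  if p is p'.+1 then
    fix row (r : nat) : nat -> B :=
      if r is r'.+1 then fun j => model p' r'.+1 j + c r' p' * row r' j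
      else fun j => if j == p' then u 0 p' else model p' 0 j
  else fun _ _ => 0.

Arguments model : simpl never.

Lemma model_col0 r j : model 0 r j = 0.
Proof. by []. Qed.

Lemma modelS p r j :
  model p.+1 r.+1 j = model p r.+1 j + c r p * model p.+1 r j.
Proof. by []. Qed.

Lemma model_row0 p j :
  model p.+1 0 j = if j == p then u 0 p else model p 0 j.
Proof. by []. Qed.

Lemma model_out p r j : (p <= j)%N -> model p r j = 0.
Proof.
elim: p r => // p IH r pj; elim: r => [|r IHr].
  by rewrite model_row0 IH ?(ltnW pj) // gtn_eqF.
by rewrite modelS IHr mulr0 IH ?addr0 // ltnW.
Qed.

(** The commutation exponents of the torus generators: nontrivial only within a column or a row.
    Since rows are counted from the bottom, the factor Q appears for decreasing row index but
    increasing column index. *)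
Definition beta (r j s l : nat) : int :=
  (j == l)%:Z * ((s < r)%:Z - (r < s)%:Z) + (r == s)%:Z * ((j < l)%:Z - (l < j)%:Z).

Hypothesis Hc : forall r l, c r l * u r l = u r.+1 l.

Lemma model_last_col p r : model p.+1 r p = u r p.
Proof.
elim: r => [|r IH]; first by rewrite model_row0 eqxx.
by rewrite modelS IH Hc model_out // add0r.
Qed.

Hypothesis Huu : forall r j s l, qcomm Q (beta r j s l) (u r j) (u s l).
(** The exponents are those of [u r.+1 p] divided by [u r p]. They are imposed on [c] separately
    because the entries of [u] need not be invertible. *)
Hypothesis Hcu : forall r p s l,
  qcomm Q (beta r.+1 p s l - beta r p s l) (c r p) (u s l).
Hypothesis Hcc : forall r p s l,
  qcomm Q (beta r.+1 p s.+1 l - beta r p s.+1 l - (beta r.+1 p s l - beta r p s l))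
    (c r p) (c s l).

Lemma beta_lt r j s l : (j < l)%N -> beta r j s l = (r == s)%:Z.
Proof. by rewrite /beta => h; case: eqP => [E|_]; case: (r == s); lia. Qed.

(** All columns that enter [model p] precede [l], so only a coincidence of rows contributes, and
    every summand of an entry has the same exponent. *)
Lemma model_u p r j s l : (p <= l)%N -> qcomm Q (r == s)%:Z (model p r j) (u s l).
Proof.
elim: p r => [|p IH] r pl; first exact: qcomm0l.
elim: r => [|r IHr].
  rewrite model_row0; have [_|_] := eqVneq j p; last by apply: IH; exact: ltnW.
  by rewrite -(beta_lt _ _ pl).
rewrite modelS; apply: qcommDl; first by apply: IH; exact: ltnW.
apply: (qcomm_eq (qcommMl Q0 (Hcu r p s l) IHr)).
by rewrite !beta_lt // subrK.
Qed.

Lemma model_c p r j s l : (p <= l)%N ->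
  qcomm Q ((r == s.+1)%:Z - (r == s)%:Z) (model p r j) (c s l).
Proof.
elim: p r => [|p IH] r pl; first exact: qcomm0l.
elim: r => [|r IHr].
  rewrite model_row0; have [_|_] := eqVneq j p; last by apply: IH; exact: ltnW.
  apply: (qcomm_eq (qcomm_sym Q0 (Hcu s l 0 p))).
  by rewrite /beta; case: (l =P p) => [E|_]; lia.
rewrite modelS; apply: qcommDl; first by apply: IH; exact: ltnW.
apply: (qcomm_eq (qcommMl Q0 (Hcc r p s l) IHr)).
by rewrite !beta_lt // addrAC; lia.
Qed.

Definition model_rel (y : nat -> nat -> B) :=
  [/\ forall r j l, (j < l)%N -> y r j * y r l = Q *: (y r l * y r j),
      forall r s j, (s < r)%N -> y r j * y s j = Q *: (y s j * y r j),
      forall r s j l, (s < r)%N -> (l < j)%N -> y r j * y s l = y s l * y r j &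
      forall r s j l, (s < r)%N -> (j < l)%N ->
        y r j * y s l = y s l * y r j + (Q - Q^-1) *: (y r l * y s j)].

Section Step.
Variable p : nat.
Hypothesis IH : model_rel (model p).
Local Notation x := (model p).
Local Notation y := (model p.+1).

Let c_comm r s j : (r.+1 < s)%N -> x s j * c r p = c r p * x s j.
Proof.
move=> h; have := model_c s j r (leqnn p).
by rewrite !gtn_eqF ?(ltnW h) // subrr => /(qcomm0P Q).
Qed.

Lemma model_c_up r j : x r.+1 j * c r p = Q *: (c r p * x r.+1 j).
Proof.
have := model_c r.+1 j r (leqnn p).
by rewrite eqxx gtn_eqF // subr0 /qcomm expr1z.
Qed.

Let x_u0 s j : (0 < s)%N -> x s j * u 0 p = u 0 p * x s j.
Proof.
move=> h; have := model_u s j 0 (leqnn p).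
by rewrite gtn_eqF // => /(qcomm0P Q).
Qed.

Let xp0 r : x r p = 0. Proof. exact: model_out. Qed.

(** First of three mixed relations: an old row above a new row behaves like two rows of one matrix.
    They suffice for the new matrix, since the new row r.+1 is the old one plus [c r p] times the
    new row r. *)
Lemma model_col r s j : (r < s)%N -> x s j * y r j = Q *: (y r j * x s j).
Proof.
case: IH => _ h2 _ _; elim: r => [|r IHr] rs.
  rewrite model_row0; have [->|_] := eqVneq j p; last exact: h2.
  by rewrite xp0 mul0r mulr0 scaler0.
rewrite modelS mulrDr mulrDl scalerDr h2 //; congr (_ + _).
by rewrite mulrA c_comm // -mulrA IHr ?(ltnW rs) // -scalerAr mulrA.
Qed.

Let anti r s j l : (r < s)%N -> (l < j)%N -> x s j * y r l = y r l * x s j.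
Proof.
case: IH => _ _ h3 _ rs lj; elim: r rs => [|r IHr] rs.
  rewrite model_row0; have [E|_] := eqVneq l p; last exact: h3.
  by rewrite x_u0.
rewrite modelS mulrDr mulrDl h3 //; congr (_ + _).
by rewrite mulrA c_comm // -mulrA IHr ?(ltnW rs) // mulrA.
Qed.

Let diag r s j l : (r < s)%N -> (j < l)%N ->
  x s j * y r l = y r l * x s j + (Q - Q^-1) *: (x s l * y r j).
Proof.
case: IH => _ _ _ h4 rs jl; elim: r rs => [|r IHr] rs.
  rewrite model_row0; have [->|_] := eqVneq l p.
    by rewrite xp0 mul0r scaler0 addr0 x_u0.
  rewrite model_row0; have [E|_] := eqVneq j p; last exact: h4.
  by rewrite h4 // !model_out ?mul0r ?mulr0 -?E // ltnW.
rewrite !modelS mulrDr mulrDl h4 // mulrDr scalerDr -!addrA; congr (_ + _).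
rewrite addrCA; congr (_ + _).
rewrite mulrA c_comm // -mulrA IHr ?(ltnW rs) // mulrDr -scalerAr.
by rewrite !mulrA -c_comm.
Qed.

Let c_row r s l : (s <= r)%N -> qcomm Q (r == s)%:Z (c r p) (y s l).
Proof.
have cx r' s' l' : qcomm Q ((s' == r')%:Z - (s' == r'.+1)%:Z) (c r' p) (x s' l').
  by have := qcomm_sym Q0 (model_c s' l' r' (leqnn p)); rewrite opprB.
elim: s => [|s IHs] sr.
  rewrite model_row0; have [_|_] := eqVneq l p.
    by apply: (qcomm_eq (Hcu r p 0 p)); rewrite /beta eqxx; lia.
  by apply: (qcomm_eq (cx r 0 l)); lia.
rewrite modelS; apply: qcommDr; first by apply: (qcomm_eq (cx r s.+1 l)); lia.
apply: (qcomm_eq (qcommMr Q0 (Hcc r p s p) (IHs (ltnW sr)))).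
by rewrite /beta eqxx; lia.
Qed.

Let c_low r s l : (s < r)%N -> c r p * y s l = y s l * c r p.
Proof.
by move=> h; have := c_row l (ltnW h); rewrite gtn_eqF // => /(qcomm0P Q).
Qed.

Lemma model_c_diag r l : c r p * y r l = Q *: (y r l * c r p).
Proof. by have := c_row l (leqnn r); rewrite eqxx /qcomm expr1z. Qed.

Let c_diag' r l : y r l * c r p = Q^-1 *: (c r p * y r l).
Proof. by rewrite model_c_diag scalerA mulVf // scale1r. Qed.

Let rel1 r j l : (j < l)%N -> y r j * y r l = Q *: (y r l * y r j).
Proof.
case: IH => h1 _ _ _ jl; elim: r => [|r IHr].
  rewrite !model_row0; have [E|_] := eqVneq l p.
    rewrite (_ : (j == p) = false); last by rewrite -E ltn_eqF.
    by have := model_u 0 j 0 (leqnn p); rewrite eqxx /qcomm expr1z.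
  have [E|_] := eqVneq j p; last exact: h1.
  by rewrite (@model_out p 0 l) ?mul0r ?mulr0 ?scaler0 // -E ltnW.
rewrite !modelS !(mulrDl, mulrDr) !scalerDr.
have T1 : x r.+1 j * (c r p * y r l) =
   Q *: (c r p * y r l * x r.+1 j) + (Q * (Q - Q^-1)) *: (c r p * (x r.+1 l * y r j)).
  rewrite mulrA model_c_up -scalerAl -(mulrA (c r p) (x _ _)) (diag (ltnSn r) jl).
  by rewrite mulrDr scalerDr -scalerAr scalerA !mulrA.
have T2 : c r p * y r j * x r.+1 l = c r p * (x r.+1 l * y r j).
  by rewrite -mulrA -anti.
have T3 : c r p * y r j * (c r p * y r l) = Q *: (c r p * y r l * (c r p * y r j)).
  rewrite -!mulrA [y r j * (c r p * _)]mulrA [y r l * (c r p * _)]mulrA !c_diag'.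
  rewrite -!scalerAl -!(mulrA (c r p) (y r _) (y r _)) IHr -!scalerAr !scalerA.
  by rewrite mulrC.
have T4 : x r.+1 l * (c r p * y r j) = Q *: (c r p * (x r.+1 l * y r j)).
  by rewrite mulrA model_c_up -scalerAl mulrA.
rewrite T1 T2 T3 T4 h1 // scalerA -!addrA; congr (_ + _).
rewrite [RHS]addrCA; congr (_ + _).
rewrite !addrA; congr (_ + _).
(* The remaining coefficients of the cross term are Q (Q - Q^-1) from the diagonal relation and 1,
   against Q^2 on the right. *)
rewrite -[X in _ + X = _]scale1r -scalerDl; congr (_ *: _).
by rewrite mulrBr divff // subrK.
Qed.

Let rel2 r s j : (s < r)%N -> y r j * y s j = Q *: (y s j * y r j).
Proof.
elim: r => // r IHr; rewrite ltnS leq_eqVlt => /orP[/eqP->|sr].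
  rewrite modelS mulrDl mulrDr scalerDr model_col //; congr (_ + _).
  by rewrite mulrA c_diag' -scalerAl scalerA divff // scale1r.
rewrite modelS mulrDl mulrDr scalerDr model_col ?ltnS ?(ltnW sr) //; congr (_ + _).
by rewrite -mulrA IHr // -scalerAr !mulrA c_low.
Qed.

Let rel3 r s j l : (s < r)%N -> (l < j)%N -> y r j * y s l = y s l * y r j.
Proof.
elim: r => // r IHr; rewrite ltnS leq_eqVlt => /orP[/eqP->|sr] lj.
  rewrite modelS mulrDl mulrDr anti //; congr (_ + _).
  rewrite mulrA c_diag' -scalerAl -!mulrA (rel1 _ lj) -scalerAr scalerA.
  by rewrite mulVf // scale1r.
rewrite modelS mulrDl mulrDr anti ?ltnS ?(ltnW sr) //; congr (_ + _).
by rewrite -mulrA IHr // !mulrA c_low.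
Qed.

Let rel4 r s j l : (s < r)%N -> (j < l)%N ->
  y r j * y s l = y s l * y r j + (Q - Q^-1) *: (y r l * y s j).
Proof.
elim: r => // r IHr; rewrite ltnS leq_eqVlt => /orP[/eqP->|sr] jl.
  rewrite !modelS !mulrDl mulrDr diag // scalerDr -!addrA; congr (_ + _).
  rewrite addrCA; congr (_ + _).
  rewrite mulrA c_diag' -scalerAl -!mulrA (rel1 _ jl) -scalerAr -scalerDl.
  by rewrite addrC subrK.
rewrite !modelS !mulrDl mulrDr diag ?ltnS ?(ltnW sr) // scalerDr -!addrA; congr (_ + _).
rewrite addrCA; congr (_ + _).
by rewrite -mulrA IHr // mulrDr -scalerAr !mulrA c_low.
Qed.

Lemma model_rel_step : model_rel y.
Proof. by split. Qed.
End Step.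

Lemma model_relP p : model_rel (model p).
Proof.
elim: p => [|p IH]; last exact: model_rel_step.
by split=> *; rewrite !model_col0 !(mulr0, scaler0, addr0).
Qed.

(** The exponent of [c r l] is a difference of two row exponents, so multiplying by it moves row r
    to row r.+1 and keeps the shape [al r + be j] through the recursion. *)
Lemma model_normal (d : B) (al be : nat -> int) :
  (forall r l, qcomm Q (al r + be l) (u r l) d) ->
  (forall r l, qcomm Q (al r.+1 - al r) (c r l) d) ->
  forall p r j, qcomm Q (al r + be j) (model p r j) d.
Proof.
move=> hu hc; elim=> [|p IH] r j; first exact: qcomm0l.
elim: r => [|r IHr]; first by rewrite model_row0; have [->|_] := eqVneq j p.
rewrite modelS; apply: qcommDl => //.
by apply: (qcomm_eq (qcommMl Q0 (hc r p) IHr)); rewrite addrA subrK.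
Qed.

End DeletingDerivations.
Arguments model : simpl never.

(** * Row operations and the minors that become monomials *)

Section RowOperations.
Variables (k : fieldType) (B : algType k) (Q : k).

(** Rows are replaced from the top down: when row e is split, the row below it is still the original
    one, whose entries q-commute, so the extra determinant vanishes by [qdet_alternate]. *)
Lemma qdet_row_ops t (Y Y' : nat -> nat -> B) (cc : nat -> B) :
  (forall a b, (a.+1 < t)%N -> (b < t)%N -> Y a b = Y' a b + cc a * Y a.+1 b) ->
  (forall a b, a.+1 = t -> (b < t)%N -> Y a b = Y' a b) ->
  (forall a i j, (a < t)%N -> (i < j < t)%N -> Y a i * Y a j = Q *: (Y a j * Y a i)) ->
  qdet Q t Y = qdet Q t Y'.
Proof.
move=> hop hlast hrow; case: t hop hlast hrow => // t hop hlast hrow.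
pose H e a b := if (a < e)%N then Y' a b else Y a b.
suff E e : (e <= t)%N -> qdet Q t.+1 Y = qdet Q t.+1 (H e).
  rewrite (E t) //; apply: eq_qdet => a b; rewrite /H ltnS leq_eqVlt.
  by case/orP => [/eqP-> hb|->] //; rewrite ltnn hlast.
elim: e => [|e IH] het; first by apply: eq_qdet.
rewrite (IH (ltnW het)).
pose Z a b := if a == e then cc e * Y e.+1 b else H e a b.
rewrite (@qdet_add_row _ _ _ _ e _ (H e.+1) Z) //; first last.
- by move=> a b _ _ ae; rewrite /Z (negPf ae).
- by move=> a b _ _ ae; rewrite /H ltnS [(a <= e)%N]leq_eqVlt (negPf ae).
- by move=> b hb; rewrite /H /Z ltnn ltnSn eqxx hop.
- exact: ltnW.
rewrite (@qdet_alternate _ _ _ _ e (cc e) (Y e.+1) Z) ?addr0 //.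
- by move=> b _; rewrite /Z eqxx.
- by move=> b _; rewrite /Z gtn_eqF // /H ltnNge leqnSn.
- by move=> i j; exact: hrow.
Qed.
End RowOperations.

Section ModelMinors.
Variables (k : fieldType) (B : algType k) (Q : k).
Variables (u c : nat -> nat -> B).
Hypothesis Hc : forall r l, c r l * u r l = u r.+1 l.
Local Notation model := (model u c).
Hypothesis Hrow : forall p r j l, (j < l)%N ->
  model p r j * model p r l = Q *: (model p r l * model p r j).

(** The lowest row of this minor is row 0, which a new column leaves unchanged in the old columns;
    every other row changes by a left multiple of the new row below it. *)
Lemma model_minor_restrict p t c0 : (c0 + t <= p)%N ->
  qdet Q t (fun a b => model p.+1 (t.-1 - a) (c0 + b)) =
  qdet Q t (fun a b => model p (t.-1 - a) (c0 + b)).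
Proof.
case: t => // t h; apply: (qdet_row_ops (cc := fun a => c (t - a.+1) p)) => /=.
- move=> a b ha hb; have -> : (t - a = (t - a.+1).+1)%N by lia.
  by rewrite modelS.
- move=> a b [->] hb; rewrite subnn model_row0.
  by rewrite (_ : (c0 + b == p) = false) //; apply/eqP; lia.
- by move=> a i j _ /andP[ij _]; apply: Hrow; rewrite ltn_add2l.
Qed.

(** Row operations return all rows but the last to their values before the newest column was added.
    There that column is zero, so only its entry in the last row survives. *)
Lemma model_minor_last R c0 t : (t <= R)%N ->
  qdet Q t.+1 (fun a b => model (c0 + t).+1 (R - a) (c0 + b)) =
  qdet Q t (fun a b => model (c0 + t) (R - a) (c0 + b)) * u (R - t) (c0 + t).
Proof.
move=> tR; set p := (c0 + t)%N.
pose Y a b := if (a < t)%N then model p (R - a) (c0 + b)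
              else model p.+1 (R - a) (c0 + b).
transitivity (qdet Q t.+1 Y).
  apply: (qdet_row_ops (cc := fun a => c (R - a.+1) p)).
  - move=> a b ha hb; rewrite /Y -ltnS ha.
    by have -> : (R - a = (R - a.+1).+1)%N by lia.
  - by move=> a b [->] hb; rewrite /Y ltnn.
  - by move=> a i j _ /andP[ij _]; apply: Hrow; rewrite ltn_add2l.
rewrite qdet_last_col; last by move=> a ha; rewrite /Y ha model_out.
rewrite {2}/Y ltnn model_last_col //; congr (_ * _).
by apply: eq_qdet => a b ha _; rewrite /Y ha.
Qed.

(** Two kinds of minors become monomials: those that end at the newest column, and those in the
    bottom rows, which later columns do not affect. D(t) is of the first kind, tau(D(t)) of the
    second. *)
Lemma model_minor p R c0 t : (t <= R.+1)%N -> (c0 + t <= p)%N ->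
  c0 + t = p \/ R.+1 = t ->
  qdet Q t (fun a b => model p (R - a) (c0 + b)) = \prod_(a < t) u (R - a) (c0 + a).
Proof.
have last t' : (t' <= R.+1)%N ->
    qdet Q t' (fun a b => model (c0 + t') (R - a) (c0 + b)) =
    \prod_(a < t') u (R - a) (c0 + a).
  elim: t' => [|t' IH] h; first by rewrite big_ord0.
  by rewrite addnS model_minor_last // IH ?(ltnW h) // big_ord_recr.
move=> tR + [<-|Rt]; first by move=> _; exact: last.
elim: p => [|p IH]; first by rewrite leqn0 => /eqP <-; exact: last.
rewrite leq_eqVlt => /orP[/eqP <-|h]; first exact: last.
have -> : R = t.-1 by rewrite -Rt.
by rewrite model_minor_restrict // -Rt /= Rt IH.
Qed.

Lemma model_minor_bottom n t : (t <= n)%N ->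
  qdet Q t (fun a b => model n (t.-1 - a) b) = \prod_(a < t) u (t.-1 - a)%N a.
Proof.
case: t => [|t] tn; first by rewrite big_ord0.
by apply: (@model_minor n t 0) => //; right.
Qed.
End ModelMinors.

(** * m-th powers of the entries of the model *)

Section ModelFrobenius.
Variables (k : fieldType) (B : algType k) (Q : k) (m : nat).
Hypotheses (Q0 : Q != 0) (Qprim : m.-primitive_root Q) (om : odd m).
Variables (u c : nat -> nat -> B).
Hypothesis Huu : forall r j s l, qcomm Q (beta r j s l) (u r j) (u s l).
Hypothesis Hcu : forall r p s l,
  qcomm Q (beta r.+1 p s l - beta r p s l) (c r p) (u s l).
Hypothesis Hcc : forall r p s l,
  qcomm Q (beta r.+1 p s.+1 l - beta r p s.+1 l - (beta r.+1 p s l - beta r p s l))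
    (c r p) (c s l).

Lemma model_frobenius p r j :
  model u c p r j ^+ m = model (fun r l => u r l ^+ m) (fun r l => c r l ^+ m) p r j.
Proof.
have m0 : (0 < m)%N := prim_order_gt0 Qprim.
have Q2prim : m.-primitive_root (Q ^+ 2).
  have := exp_prim_root Qprim 2; suff -> : gcdn 2 m = 1%N by rewrite divn1.
  by apply/eqP; rewrite -/(coprime 2 m) coprime2n.
elim: p r => [|p IH] r; first by rewrite model_col0 expr0n gtn_eqF.
elim: r => [|r IHr].
  by rewrite !model_row0; have [//|_] := eqVneq j p; rewrite IH.
have rel := model_relP Q0 Huu Hcu Hcc p.
have cy := model_c_diag Q0 Hcu Hcc p r j.
(* Passing the old entry through [c] costs one factor Q, and through the new entry below another,
   hence the root Q^2. *)
rewrite !modelS (frobenius_qcomm Q2prim); last first.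
  rewrite mulrA (model_c_up Q0 Hcu Hcc) -scalerAl -(mulrA _ (model u c p _ _)).
  rewrite (model_col Q0 Hcu Hcc) // -scalerAr scalerA expr2.
  by rewrite mulrA.
rewrite IH; congr (_ + _).
rewrite (@qcomm_root_exprMn _ _ _ Q0 _ _ 1) ?IHr //.
exact: prim_expr_order.
Qed.
End ModelFrobenius.

(** * Quantum tori as polynomials over matrices *)

Section PolynomialAlgebra.
Variables (k : fieldType) (R : algType k).

(** [{poly R}] is scaled by the noncommutative [R]; the alias is scaled by [k], through the scalar
    constants. *)
Definition poly_alg : Type := {poly R}.
HB.instance Definition _ := GRing.NzRing.copy poly_alg {poly R}.

Definition poly_alg_scale (a : k) (p : poly_alg) : poly_alg := (a%:A)%:P * (p : {poly R}).

Fact poly_alg_scaleA a b p :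
  poly_alg_scale a (poly_alg_scale b p) = poly_alg_scale (a * b) p.
Proof. by rewrite /poly_alg_scale mulrA -polyCM -scalerAl mul1r scalerA. Qed.

Fact poly_alg_scale1 : left_id 1 poly_alg_scale.
Proof. by move=> p; rewrite /poly_alg_scale scale1r mul1r. Qed.

Fact poly_alg_scaleDr : right_distributive poly_alg_scale +%R.
Proof. by move=> a p p'; rewrite /poly_alg_scale mulrDr. Qed.

Fact poly_alg_scaleDl p : {morph poly_alg_scale^~ p : a b / a + b}.
Proof. by move=> a b; rewrite /poly_alg_scale scalerDl polyCD mulrDl. Qed.

HB.instance Definition _ := GRing.Zmodule_isLmodule.Build k poly_alg
  poly_alg_scaleA poly_alg_scale1 poly_alg_scaleDr poly_alg_scaleDl.

Fact poly_alg_scaleAl (a : k) (p p' : poly_alg) : a *: (p * p') = a *: p * p'.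
Proof. by rewrite /GRing.scale /= /poly_alg_scale mulrA. Qed.

HB.instance Definition _ := GRing.Lmodule_isLalgebra.Build k poly_alg poly_alg_scaleAl.

Fact poly_alg_scaleAr (a : k) (p p' : poly_alg) : a *: (p * p') = p * (a *: p').
Proof.
rewrite /GRing.scale /= /poly_alg_scale mulrA [RHS]mulrA; congr (_ * _).
by apply/polyP => i; rewrite coefCM coefMC mulr_algl mulr_algr.
Qed.

HB.instance Definition _ := GRing.Lalgebra_isAlgebra.Build k poly_alg poly_alg_scaleAr.

Lemma poly_alg_scaleE (a : k) (p : poly_alg) :
  a *: p = (a%:A)%:P * (p : {poly R}).
Proof. by []. Qed.

End PolynomialAlgebra.

Section TwistedGroupMatrices.
Variables (k : fieldType) (q : k) (m : nat) (V : finType).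
Hypotheses (m1 : (1 < m)%N) (qm : q ^+ m = 1).
Variable L : V -> V -> 'Z_m.
Local Notation G := {ffun V -> 'Z_m}.

Definition chi (a : 'Z_m) : k := q ^+ a.

Lemma chiD a b : chi (a + b) = chi a * chi b.
Proof.
rewrite /chi -exprD [in RHS](divn_eq (a + b) m) exprD mulnC exprM qm expr1n mul1r.
by congr (_ ^+ _); rewrite /=; congr (_ %% _)%N; rewrite Zp_cast.
Qed.

Lemma chi0 : chi 0 = 1. Proof. by []. Qed.

Lemma chi_neq0 a : chi a != 0.
Proof.
apply/eqP => E; have := chiD a (- a).
by rewrite E mul0r subrr chi0; apply/eqP; exact: oner_neq0.
Qed.

Lemma chiN a : chi (- a) = (chi a)^-1.
Proof.
apply: (mulfI (chi_neq0 a)).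
by rewrite -chiD subrr chi0 mulfV // chi_neq0.
Qed.

Lemma chi_nat (a : nat) : chi a%:R = q ^+ a.
Proof.
rewrite /chi [in RHS](divn_eq a m) exprD mulnC exprM qm expr1n mul1r.
by rewrite Zp_nat; congr (_ ^+ _); rewrite /=; congr (_ %% _)%N; rewrite Zp_cast.
Qed.

Lemma chi_int (z : int) : chi z%:~R = q ^ z.
Proof.
case: z => a; first by rewrite -pmulrn chi_nat.
by rewrite NegzE mulrNz chiN -pmulrn chi_nat exprnN.
Qed.

Definition bilin (g g' : G) : 'Z_m := \sum_u \sum_v g u * g' v * L u v.

Lemma bilinDl g1 g2 g' : bilin (g1 + g2) g' = bilin g1 g' + bilin g2 g'.
Proof.
rewrite /bilin -big_split; apply: eq_bigr => u _; rewrite -big_split.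
by apply: eq_bigr => v _; rewrite ffunE !mulrDl.
Qed.

Lemma bilinDr g g1 g2 : bilin g (g1 + g2) = bilin g g1 + bilin g g2.
Proof.
rewrite /bilin -big_split; apply: eq_bigr => u _; rewrite -big_split.
by apply: eq_bigr => v _; rewrite ffunE mulrDr mulrDl.
Qed.

Lemma bilin0l g : bilin 0 g = 0.
Proof. by apply: (addrI (bilin 0 g)); rewrite -bilinDl !addr0. Qed.

Lemma bilin0r g : bilin g 0 = 0.
Proof. by apply: (addrI (bilin g 0)); rewrite -bilinDr !addr0. Qed.

(** The order of the group minus one, so that matrices of size [grp_dim.+1] form a nonzero ring. *)
Definition grp_dim := #|{: G}|.-1.

Fact grp_dimE : grp_dim.+1 = #|{: G}|.
Proof. by rewrite prednK //; apply/card_gt0P; exists 0. Qed.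

Definition grp_val (i : 'I_grp_dim.+1) : G := enum_val (cast_ord grp_dimE i).
Definition grp_rank (g : G) : 'I_grp_dim.+1 := cast_ord (esym grp_dimE) (enum_rank g).

Lemma grp_rankK g : grp_val (grp_rank g) = g.
Proof. by rewrite /grp_val /grp_rank cast_ordKV enum_rankK. Qed.

Lemma grp_valK i : grp_rank (grp_val i) = i.
Proof. by rewrite /grp_val /grp_rank enum_valK cast_ordK. Qed.

(* The projective representation of G on its group algebra with cocycle chi (bilin g' g). *)
Definition Wmx (g : G) : 'M[k]_grp_dim.+1 :=
  \matrix_(i, j) ((grp_val j == grp_val i + g)%:R * chi (bilin g (grp_val i))).

Lemma Wmx_mul g g' : Wmx g * Wmx g' = chi (bilin g' g) *: Wmx (g + g').
Proof.
apply/matrixP => i l; rewrite !mxE.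
rewrite (bigD1 (grp_rank (grp_val i + g))) //= big1 ?addr0 => [|j nj]; last first.
  rewrite !mxE (_ : (grp_val j == _) = false) ?mul0r //.
  by apply/negbTE; apply: contra nj => /eqP <-; rewrite grp_valK.
rewrite !mxE grp_rankK eqxx mul1r addrA mulrCA [RHS]mulrCA; congr (_ * _).
by rewrite -!chiD bilinDl bilinDr addrA addrC.
Qed.

Lemma Wmx0 : Wmx 0 = 1.
Proof.
apply/matrixP => i j; rewrite !mxE addr0 bilin0l chi0 mulr1 eq_sym.
by rewrite (can_eq grp_valK).
Qed.

Lemma Wmx_unit g : Wmx g \is a GRing.unit.
Proof.
have h := Wmx_mul g (- g); rewrite subrr Wmx0 in h.
have c0 := chi_neq0 (bilin (- g) g).
apply/unitrP; exists ((chi (bilin (- g) g))^-1 *: Wmx (- g)); split; last first.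
  by rewrite -scalerAr h scalerA mulVf // scale1r.
have h' := Wmx_mul (- g) g; rewrite addNr Wmx0 in h'.
rewrite -scalerAl h' scalerA (_ : bilin g (- g) = bilin (- g) g) ?mulVf ?scale1r //.
by apply: (addrI (bilin g g)); rewrite -bilinDr -bilinDl subrr bilin0r bilin0l.
Qed.

Lemma Wmx_comm g g' :
  Wmx g * Wmx g' = chi (bilin g' g - bilin g g') *: (Wmx g' * Wmx g).
Proof. by rewrite !Wmx_mul scalerA -chiD subrK addrC. Qed.

Local Notation B := (poly_alg 'M[k]_grp_dim.+1).

Definition monom (a : k) (g : G) (h : nat) : B := (a *: Wmx g)%:P * 'X^h.

Lemma monom_scale a b g h : a *: monom b g h = monom (a * b) g h.
Proof.
by rewrite poly_alg_scaleE mulrA -polyCM -scalerAl mul1r scalerA.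
Qed.

Lemma monom_mul a g h b g' h' :
  monom a g h * monom b g' h' = monom (a * b * chi (bilin g' g)) (g + g') (h + h').
Proof.
have aux (X Y : {poly 'M[k]_grp_dim.+1}) : X * 'X^h * (Y * 'X^h') = X * Y * 'X^(h + h').
  by rewrite exprD !mulrA -(mulrA X) -commr_polyXn !mulrA.
rewrite /monom [LHS]aux -polyCM -scalerAl -scalerAr Wmx_mul !scalerA.
by [].
Qed.

Lemma monom_comm a g h b g' h' (z : int) :
  bilin g' g - bilin g g' = z%:~R -> qcomm q z (monom a g h) (monom b g' h').
Proof.
move=> E; rewrite /qcomm !monom_mul monom_scale -chi_int -E addnC [g' + g]addrC.
congr (monom _ _ _).
rewrite [b * a]mulrC [chi _ * (_ * _)]mulrCA -chiD subrK.
by [].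
Qed.

End TwistedGroupMatrices.

Section CellRank.
Variable n : nat.
Local Notation V := ('I_n * 'I_n)%type.

(** Cells are ordered by rows from the bottom and within a row from right to left. The corrections
    that the recursion adds to an entry involve lower rows or cells further right in the same row,
    so the torus generator of the cell itself dominates. The same order sorts words. *)
Definition cell_rank (r l : nat) : nat := (r * n + (n.-1 - l))%N.

Lemma cell_rank_inj (v w : V) : cell_rank v.1 v.2 = cell_rank w.1 w.2 -> v = w.
Proof.
case: v w => [[r hr] [l hl]] [[r' hr'] [l' hl']]; rewrite /cell_rank /= => E.
have Er : r = r'.
  have := congr1 (fun x => (x %/ n)%N) E; rewrite !divnMDl ?divn_small ?addn0 //; lia.
have El : l = l' by move: E; rewrite Er; lia.
by congr (_, _); apply: val_inj.
Qed.

Lemma cell_rank_lt r l : (r < n)%N -> (l < n)%N -> (cell_rank r l < n * n)%N.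
Proof. rewrite /cell_rank; nia. Qed.

Lemma betaC r j s l : beta r j s l = - beta s l r j.
Proof. by rewrite /beta [l == j]eq_sym [s == r]eq_sym; lia. Qed.

End CellRank.

(** * A quantum torus inside polynomials over matrices, and leading terms *)

Section ConcreteTorus.
Variables (k : fieldType) (q : k) (m n M : nat).
Hypotheses (m1 : (1 < m)%N) (qm : q ^+ m = 1) (M1 : (1 < M)%N).
Local Notation V := ('I_n * 'I_n)%type.
Local Notation G := {ffun V -> 'Z_m}.

(** A bilinear form whose antisymmetrisation is [beta]: each pair of cells is kept in one order
    only, which avoids dividing by 2. *)
Definition half_beta (v w : V) : 'Z_m :=
  if (cell_rank n w.1 w.2 < cell_rank n v.1 v.2)%N then (beta w.1 w.2 v.1 v.2)%:~R else 0.

Definition asym (g g' : G) : 'Z_m :=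
  \sum_u \sum_v g u * g' v * (beta u.1 u.2 v.1 v.2)%:~R.

Lemma asymE g g' : bilin half_beta g' g - bilin half_beta g g' = asym g g'.
Proof.
rewrite /bilin exchange_big -sumrB; apply: eq_bigr => u _.
rewrite -sumrB; apply: eq_bigr => v _; rewrite [g' v * _]mulrC -mulrBr.
congr (_ * _); rewrite /half_beta.
case: ltngtP => [h|h|/(@cell_rank_inj n) ->].
- by rewrite subr0.
- by rewrite sub0r betaC mulrNz opprK.
- by rewrite subrr /beta !ltnn !subrr !mulr0.
Qed.

Lemma asymDl g1 g2 g' : asym (g1 + g2) g' = asym g1 g' + asym g2 g'.
Proof. by rewrite -!asymE bilinDl bilinDr opprD addrACA. Qed.

Lemma asymDr g g1 g2 : asym g (g1 + g2) = asym g g1 + asym g g2.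
Proof. by rewrite -!asymE bilinDl bilinDr opprD addrACA. Qed.

Lemma asymBl g1 g2 g' : asym (g1 - g2) g' = asym g1 g' - asym g2 g'.
Proof. by apply/eqP; rewrite eq_sym subr_eq -asymDl subrK. Qed.

Lemma asymBr g g1 g2 : asym g (g1 - g2) = asym g g1 - asym g g2.
Proof. by apply/eqP; rewrite eq_sym subr_eq -asymDr subrK. Qed.

Definition unitg (r l : nat) : G := [ffun v : V => ((v.1 == r :> nat) && (v.2 == l :> nat))%:R].

Lemma sum_unitg r l (F : V -> 'Z_m) (hr : (r < n)%N) (hl : (l < n)%N) :
  \sum_v unitg r l v * F v = F (Ordinal hr, Ordinal hl).
Proof.
rewrite (bigD1 (Ordinal hr, Ordinal hl)) //= ffunE !eqxx mul1r big1 ?addr0 //.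
case=> a b nab; rewrite ffunE /=; case: eqP => [E1|_]; last by rewrite mul0r.
case: eqP => [E2|_]; last by rewrite mul0r.
by case/eqP: nab; congr (_, _); apply: val_inj.
Qed.

Lemma asym_unitg r j s l : (r < n)%N -> (j < n)%N -> (s < n)%N -> (l < n)%N ->
  asym (unitg r j) (unitg s l) = (beta r j s l)%:~R.
Proof.
move=> hr hj hs hl; rewrite /asym.
under eq_bigr => u _ do under eq_bigr => v _ do rewrite -mulrA.
under eq_bigr => u _ do rewrite -mulr_sumr.
by rewrite (sum_unitg _ hr hj) (sum_unitg _ hs hl).
Qed.

Local Notation Wm := (Wmx q half_beta).
Local Notation Balg := (poly_alg 'M[k]_((grp_dim m V).+1)).
Local Notation mon := (monom q half_beta).

Definition cell_weight (r l : nat) : nat := (M ^ cell_rank n r l)%N.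

Definition torus_u (r l : nat) : Balg :=
  if (r < n)%N && (l < n)%N then mon 1 (unitg r l) (cell_weight r l) else 0.

(** Plays the role of [torus_u r.+1 l] times the inverse of [torus_u r l]. The scalar cancels the
    cocycle in that product, and the natural subtraction of weights is a true one because ranks
    increase with the row. *)
Definition torus_c (r l : nat) : Balg :=
  if (r.+1 < n)%N && (l < n)%N then
    mon (chi q (- bilin half_beta (unitg r l) (unitg r.+1 l - unitg r l)))
        (unitg r.+1 l - unitg r l) (cell_weight r.+1 l - cell_weight r l)
  else 0.

Lemma cell_weight_le r l : (cell_weight r l <= cell_weight r.+1 l)%N.
Proof. by rewrite leq_exp2l // /cell_rank; nia. Qed.

Lemma torus_cu r l : torus_c r l * torus_u r l = torus_u r.+1 l.
Proof.
rewrite /torus_c /torus_u; case: ifP => [/andP[h1 h2]|_]; last first.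
  by rewrite mul0r.
rewrite (ltnW h1) h2 monom_mul // mulr1 -chiD // addNr chi0.
by rewrite !subrK subnK // cell_weight_le.
Qed.

Lemma torus_uu r j s l : qcomm q (beta r j s l) (torus_u r j) (torus_u s l).
Proof.
rewrite /torus_u; case: ifP => [/andP[hr hj]|_]; last exact: qcomm0l.
case: ifP => [/andP[hs hl]|_]; last exact: qcomm0r.
by apply: monom_comm => //; rewrite asymE asym_unitg.
Qed.

Lemma torus_uc r p s l :
  qcomm q (beta r.+1 p s l - beta r p s l) (torus_c r p) (torus_u s l).
Proof.
rewrite /torus_u /torus_c; case: ifP => [/andP[hr hp]|_]; last exact: qcomm0l.
case: ifP => [/andP[hs hl]|_]; last exact: qcomm0r.
apply: monom_comm => //; rewrite asymE asymBl !asym_unitg ?(ltnW hr) //.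
by rewrite rmorphB.
Qed.

Lemma torus_cc r p s l :
  qcomm q (beta r.+1 p s.+1 l - beta r p s.+1 l - (beta r.+1 p s l - beta r p s l))
    (torus_c r p) (torus_c s l).
Proof.
rewrite /torus_c; case: ifP => [/andP[hr hp]|_]; last exact: qcomm0l.
case: ifP => [/andP[hs hl]|_]; last exact: qcomm0r.
apply: monom_comm => //; rewrite asymE asymBl !asymBr !asym_unitg ?(ltnW hr) ?(ltnW hs) //.
by rewrite !rmorphB /= !opprD !opprK addrACA.
Qed.

Definition tmodel : nat -> nat -> nat -> Balg := model torus_u torus_c.

(** Matrices have zero divisors, but leading coefficients of this form are invertible, so degrees
    add in products. *)
Definition has_lead (P : Balg) (g : G) (h : nat) :=
  exists2 a : k, a != 0 & size (P : {poly _}) = h.+1 /\ lead_coef (P : {poly _}) = a *: Wm g.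

Lemma Wmx_scale_unit (a : k) g : a != 0 -> a *: Wm g \is a GRing.unit.
Proof. by move=> a0; rewrite scaler_unit ?Wmx_unit // unitfE. Qed.

Lemma has_leadM P P' g g' h h' : has_lead P g h -> has_lead P' g' h' ->
  has_lead (P * P') (g + g') (h + h').
Proof.
case=> a a0 [sP lP] [b b0 [sP' lP']].
have E : lead_coef (P : {poly _}) * lead_coef (P' : {poly _}) =
    (a * b * chi q (bilin half_beta g' g)) *: Wm (g + g').
  by rewrite lP lP' -scalerAl -scalerAr Wmx_mul // !scalerA.
have c0 : a * b * chi q (bilin half_beta g' g) != 0 by rewrite !mulf_neq0 ?chi_neq0.
have nz : lead_coef (P : {poly _}) * lead_coef (P' : {poly _}) != 0.
  rewrite E; apply: contraTneq (Wmx_scale_unit (g + g') c0) => ->.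
  by rewrite unitr0.
exists (a * b * chi q (bilin half_beta g' g)) => //; split.
  by rewrite [LHS](size_proper_mul nz) sP sP' addSn addnS.
by rewrite [LHS](lead_coef_proper_mul nz).
Qed.

Lemma has_lead1 : has_lead 1 0 0.
Proof.
exists 1; first exact: oner_neq0.
by rewrite [size _]size_poly1 [lead_coef _]lead_coef1 Wmx0 // scale1r.
Qed.

Lemma has_lead_monom a g h : a != 0 -> has_lead (mon a g h) g h.
Proof.
move=> a0; exists a => //; have u := Wmx_scale_unit g a0.
have nz : (a *: Wm g)%:P != 0 :> {poly _}.
  by rewrite polyC_eq0; apply: contraTneq u => ->; rewrite unitr0.
split; first by rewrite [LHS]size_Mmonic ?monicXn // size_polyC -polyC_eq0 nz size_polyXn.
by rewrite [LHS]lead_coef_Mmonic ?monicXn // lead_coefC.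
Qed.

Lemma tmodel_lead p r j : (p <= n)%N -> (r < n)%N -> (j < p)%N ->
  size (tmodel p r j : {poly _}) = (cell_weight r j).+1 /\
  lead_coef (tmodel p r j : {poly _}) = Wm (unitg r j).
Proof.
have umon r' j' : (r' < n)%N -> (j' < n)%N ->
    size (torus_u r' j' : {poly _}) = (cell_weight r' j').+1 /\
    lead_coef (torus_u r' j' : {poly _}) = Wm (unitg r' j').
  move=> hr hj; have [a _ [sz _]] := has_lead_monom (unitg r' j') (cell_weight r' j') (oner_neq0 k).
  rewrite /torus_u hr hj; split=> //.
  by rewrite [LHS]lead_coef_Mmonic ?monicXn // lead_coefC scale1r.
elim: p r => // p IH r pn rn; rewrite ltnS leq_eqVlt => /orP[/eqP->|jp].
  by rewrite /tmodel (model_last_col torus_cu); exact: umon.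
elim: r rn => [|r IHr] rn.
  rewrite /tmodel model_row0 (ltn_eqF jp); apply: IH => //; exact: ltnW.
rewrite /tmodel modelS -/tmodel.
have [s1 l1] := IH r.+1 (ltnW pn) rn jp; have [s2 l2] := IHr (ltnW rn).
set Y := _ * _; have sY : (size (Y : {poly _}) <= cell_weight r.+1 j)%N.
  have := size_polyMleq (torus_c r p : {poly _}) (model torus_u torus_c p.+1 r j : {poly _}).
  rewrite s2 addnS /= => /leq_trans; apply.
  have sc : (size (torus_c r p : {poly _}) <=
      (cell_weight r.+1 p - cell_weight r p).+1)%N.
    rewrite /torus_c rn pn /=.
    have [a _ [-> _]] := has_lead_monom (unitg r.+1 p - unitg r p)
      (cell_weight r.+1 p - cell_weight r p)
      (chi_neq0 m1 qm (- bilin half_beta (unitg r p) (unitg r.+1 p - unitg r p))).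
    by [].
  (* As M is at least 2, the weights of (r+1, p) and of (r, j) are each at most half of that of
     (r+1, j); the positive weight subtracted in [torus_c] makes the comparison strict. *)
  have h1 := cell_weight_le r p.
  have h0 : (0 < cell_weight r p)%N by rewrite expn_gt0 (ltnW M1).
  have h2 : (M * cell_weight r.+1 p <= cell_weight r.+1 j)%N.
    by rewrite -expnS leq_exp2l // /cell_rank; lia.
  have h3 : (M * cell_weight r j <= cell_weight r.+1 j)%N.
    by rewrite -expnS leq_exp2l // /cell_rank; nia.
  have h2' := leq_trans (leq_mul M1 (leqnn (cell_weight r.+1 p))) h2.
  have h3' := leq_trans (leq_mul M1 (leqnn (cell_weight r j))) h3.
  by apply: (leq_trans (leq_add sc (leqnn _))); lia.
split; first by rewrite [LHS]size_polyDl ?s1.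
by rewrite [LHS]lead_coefDl ?s1.
Qed.

Lemma tmodel_has_lead r j : (r < n)%N -> (j < n)%N ->
  has_lead (tmodel n r j) (unitg r j) (cell_weight r j).
Proof.
move=> hr hj; have [h1 h2] := tmodel_lead (leqnn n) hr hj.
by exists 1; rewrite ?oner_neq0 // scale1r.
Qed.

End ConcreteTorus.

Section AlgHom.
Variables (k : fieldType) (A B : algType k) (f : A -> B).
Hypothesis hf : alg_hom f.

Lemma alg_homD a b : f (a + b) = f a + f b. Proof. by case: hf. Qed.
Lemma alg_homM a b : f (a * b) = f a * f b. Proof. by case: hf. Qed.
Lemma alg_hom1 : f 1 = 1. Proof. by case: hf. Qed.
Lemma alg_homZ c a : f (c *: a) = c *: f a. Proof. by case: hf. Qed.
Lemma alg_hom0 : f 0 = 0. Proof. by rewrite -(scale0r 0) alg_homZ scale0r. Qed.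
Lemma alg_homN a : f (- a) = - f a. Proof. by rewrite -scaleN1r alg_homZ scaleN1r. Qed.
Lemma alg_homB a b : f (a - b) = f a - f b. Proof. by rewrite alg_homD alg_homN. Qed.
Lemma alg_homX a n : f (a ^+ n) = f a ^+ n.
Proof. by elim: n => [|n IH]; rewrite ?expr0 ?alg_hom1 // !exprS alg_homM IH. Qed.
Lemma alg_hom_sum (I : Type) (s : seq I) P (F : I -> A) :
  f (\sum_(i <- s | P i) F i) = \sum_(i <- s | P i) f (F i).
Proof. exact: (big_morph f alg_homD alg_hom0). Qed.
Lemma alg_hom_prod (I : Type) (s : seq I) P (F : I -> A) :
  f (\prod_(i <- s | P i) F i) = \prod_(i <- s | P i) f (F i).
Proof. exact: (big_morph f alg_homM alg_hom1). Qed.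

Lemma alg_hom_qdet Q t Y : f (qdet Q t Y) = qdet Q t (fun a b => f (Y a b)).
Proof.
elim: t Y => [|t IH] Y; first exact: alg_hom1.
rewrite !qdetS alg_hom_sum; apply: eq_bigr => j _.
by rewrite alg_homZ alg_homM IH.
Qed.
End AlgHom.

Lemma prod_expr_comm (R : nzRingType) t (F : nat -> R) m :
  (forall a b, (a < t)%N -> (b < t)%N -> F a * F b = F b * F a) ->
  (\prod_(a < t) F a) ^+ m = \prod_(a < t) F a ^+ m.
Proof.
elim: t => [|t IH] h; first by rewrite !big_ord0 expr1n.
have hc : GRing.comm (\prod_(a < t) F a) (F t).
  by apply/commr_sym/commr_prod => i _; apply: h => //; apply: leqW.
rewrite !big_ord_recr /= exprMn_comm // IH // => a b ha hb.
by apply: h; apply: leqW.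
Qed.

Lemma sum_select_col (l R c t : nat) (g : nat -> int) :
  \sum_(a < t) (l == c + a)%N%:Z * g (R - a)%N =
  (c <= l < c + t)%N%:Z * g (R - (l - c))%N.
Proof.
elim: t => [|t IH].
  by rewrite big_ord0 addn0; case: (leqP c l) => [_|//]; rewrite /= mul0r.
rewrite big_ord_recr /= IH; have [->|nl] := eqVneq l (c + t)%N.
  rewrite ltnn andbF mul0r add0r addKn leq_addr addnS ltnSn /=.
  by rewrite mul1r.
rewrite mul0r addr0; congr (_%:Z * _); congr (nat_of_bool _).
by move/eqP: nl; lia.
Qed.

Lemma sum_select_row (r R c t : nat) (g : nat -> int) : (t <= R.+1)%N ->
  \sum_(a < t) (r == R - a)%N%:Z * g (c + a)%N =
  ((R < r + t) && (r <= R))%N%:Z * g (c + (R - r))%N.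
Proof.
elim: t => [|t IH] h.
  by rewrite big_ord0 addn0; case: ltnP => [|_]; rewrite ?andbF ?mul0r //; case: ltngtP => //; rewrite mul0r.
rewrite big_ord_recr /= IH ?(ltnW h) //; have [->|nr] := eqVneq r (R - t)%N.
  have e1 : (R < R - t + t)%N = false by lia.
  have e2 : (R < R - t + t.+1)%N by lia.
  by rewrite e1 e2 leq_subr subKn // mul0r add0r mul1r.
rewrite mul0r addr0; congr (_%:Z * _); congr (nat_of_bool _).
by move/eqP: nr; case: (leqP r R); lia.
Qed.

Lemma sum_beta_diag r l R c t : (t <= R.+1)%N ->
  \sum_(a < t) beta r l (R - a) (c + a) =
  (c <= l < c + t)%N%:Z * ((R - (l - c) < r)%N%:Z - (r < R - (l - c))%N%:Z) +
  ((R < r + t) && (r <= R))%N%:Z * ((l < c + (R - r))%N%:Z - (c + (R - r) < l)%N%:Z).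
Proof.
move=> h; rewrite /beta big_split /=; congr (_ + _).
  exact: (sum_select_col l R c t (fun s => (s < r)%N%:Z - (r < s)%N%:Z)).
exact: (sum_select_row r c (fun j => (l < j)%N%:Z - (j < l)%N%:Z) h).
Qed.

(** At most one cell of the diagonal shares the column [l] and at most one the row [r]. Their
    contributions combine to a term in the row plus a term in the column, the form required by
    [model_normal]. *)
Lemma sum_beta_top_right n t r l : (0 < n)%N -> (t <= n)%N -> (r < n)%N -> (l < n)%N ->
  \sum_(a < t) beta r l (n.-1 - a) (n - t + a) = (n - t <= r)%N%:Z - (n - t <= l)%N%:Z.
Proof.
move=> n0 tn rn ln; rewrite sum_beta_diag; last by rewrite prednK.
have -> : (n - t + t = n)%N by lia.
rewrite ln andbT.
have -> : (n.-1 < r + t)%N && (r <= n.-1)%N = (n - t <= r)%N by lia.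
case: (leqP (n - t)%N l) => hl; case: (leqP (n - t)%N r) => hr /=; lia.
Qed.

Lemma sum_beta_bottom_left n t r l : (t <= n)%N -> (r < n)%N -> (l < n)%N ->
  \sum_(a < t) beta r l (t.-1 - a) a = (t <= r)%N%:Z - (t <= l)%N%:Z.
Proof.
move=> tn rn ln; case: t tn => [|t] tn; first by rewrite big_ord0 !leq0n subrr.
rewrite -[LHS]/(\sum_(a < t.+1) beta r l (t - a) (0 + a)) sum_beta_diag //.
rewrite /= add0n subn0 [(l < t.+1)%N]ltnNge.
have -> : (t < r + t.+1)%N && (r <= t)%N = ~~ (t.+1 <= r)%N by lia.
case: (leqP t.+1 l) => hl; case: (leqP t.+1 r) => hr /=; lia.
Qed.

(** * Corner minors and central elements in the torus *)

Section TorusMinors.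
Variables (k : fieldType) (q : k) (m n M : nat).
Hypotheses (m1 : (1 < m)%N) (om : odd m) (qprim : m.-primitive_root q).
Hypotheses (n0 : (0 < n)%N) (M1 : (1 < M)%N).
Let qm : q ^+ m = 1 := prim_expr_order qprim.
Local Notation V := ('I_n * 'I_n)%type.
Local Notation u := (torus_u q m n M).
Local Notation c := (torus_c q m n M).
Local Notation tm := (tmodel q m n M).

Lemma prim_root_neq0 : q != 0.
Proof.
apply/eqP => E; have := qm; rewrite E expr0n gtn_eqF ?(ltnW m1) //.
by move/eqP; rewrite eq_sym oner_eq0.
Qed.
Let q0 := prim_root_neq0.

Lemma tmodel_relP p : model_rel q (tm p).
Proof.
apply: (model_relP q0); [exact: torus_uu|exact: torus_uc|exact: torus_cc].
Qed.

Definition torus_mx (i j : 'I_n) := tm n (n.-1 - i) j.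

Lemma torus_qrel : qrel q torus_mx.
Proof.
have [h1 h2 h3 h4] := tmodel_relP n.
have lt (i i' : 'I_n) : (i < i')%N -> (n.-1 - i' < n.-1 - i)%N.
  by have := ltn_ord i'; lia.
move=> i j i' l; split; rewrite /torus_mx.
- by move=> /lt hi hj; exact: h4.
- by move=> /lt hi; exact: h2.
- by move=> hj; exact: h1.
- by move=> /lt hi hj; exact: h3.
Qed.

Definition diag_top t := \prod_(a < t) u (n.-1 - a) (n - t + a).
Definition diag_bot t := \prod_(a < t) u (t.-1 - a) a.

Lemma tmodel_row p r j l : (j < l)%N -> tm p r j * tm p r l = q *: (tm p r l * tm p r j).
Proof. by case: (tmodel_relP p) => h _ _ _; exact: h. Qed.

Lemma minor_top t : (t <= n)%N ->
  qdet q t (fun a b => tm n (n.-1 - a) (n - t + b)) = diag_top t.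
Proof.
move=> tn; have h : (n - t + t = n)%N \/ n.-1.+1 = t by left; lia.
apply: (model_minor (torus_cu n m1 qm M1) tmodel_row (p := n) (R:=n.-1) (c0 := (n-t)%N)).
- by rewrite prednK.
- lia.
- by left; lia.
Qed.

(** In tau(D(t)) the factors come in column order, so [qdet_tr] restores row order before the row
    operations apply. *)
Lemma minor_bot t : (t <= n)%N ->
  qdet q t (fun a b => tm n (n.-1 - (n - t + b)) a) = diag_bot t.
Proof.
move=> tn; rewrite /diag_bot -(model_minor_bottom (torus_cu n m1 qm M1) tmodel_row tn).
have [_ _ h3 _] := tmodel_relP n.
rewrite -(@qdet_tr _ _ q t (fun a b => tm n (t.-1 - a) b)).
  apply: eq_qdet => a b ha hb; congr (tm n _ _); lia.
move=> a a' b b' ha hb; apply: h3; lia.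
Qed.

Let um r l := u r l ^+ m.
Let cm r l := c r l ^+ m.

Let frob p r j : tm p r j ^+ m = model um cm p r j.
Proof.
exact: (model_frobenius q0 qprim om (torus_uu n M m1 qm) (torus_uc n M m1 qm)
  (torus_cc n M m1 qm)).
Qed.

Let cum r l : cm r l * um r l = um r.+1 l.
Proof.
rewrite /cm /um -(torus_cu n m1 qm M1).
rewrite (qcomm_root_exprMn q0 qm om (z := beta r.+1 l r l - beta r l r l)) //.
exact: torus_uc.
Qed.

Let rowm p r j l : (j < l)%N ->
  model um cm p r j * model um cm p r l = 1 *: (model um cm p r l * model um cm p r j).
Proof.
move=> jl; rewrite -!frob scale1r; apply/commrX.
by apply: (qcomm_root_central q0 qm (z := 1)); rewrite /qcomm expr1z; exact: tmodel_row.
Qed.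

Let u_diag_comm R c' a b : u (R - a) (c' + a) * u (R - b) (c' + b) =
  u (R - b) (c' + b) * u (R - a) (c' + a) \/ (R < a)%N \/ (R < b)%N.
Proof.
case: (leqP a R) => ha; last by right; left.
case: (leqP b R) => hb; last by right; right.
left; apply/(qcomm0P q); apply: (qcomm_eq (torus_uu n M m1 qm _ _ _ _)).
rewrite /beta eqn_add2l; have [->|ab] := eqVneq a b.
  by rewrite !ltnn !subrr !mulr0.
have e : (R - a == R - b)%N = false by apply/eqP; move/eqP: ab; lia.
by rewrite e !mul0r.
Qed.

Lemma minor_top_exp t : (t <= n)%N ->
  qdet 1 t (fun a b => tm n (n.-1 - a) (n - t + b) ^+ m) = diag_top t ^+ m.
Proof.
move=> tn; rewrite /diag_top (prod_expr_comm _ (F := fun a => u (n.-1 - a) (n - t + a))).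
  have h1 : (t <= n.-1.+1)%N by rewrite prednK.
  have h2 : (n - t + t <= n)%N by lia.
  have h3 : (n - t + t = n)%N \/ n.-1.+1 = t by left; lia.
  rewrite -(model_minor cum rowm h1 h2 h3).
  by apply: eq_qdet => a b _ _; rewrite frob.
by move=> a b ha hb; case: (u_diag_comm n.-1 (n - t) a b) => // -[]; lia.
Qed.

Lemma minor_bot_exp t : (t <= n)%N ->
  qdet 1 t (fun a b => tm n (n.-1 - (n - t + a)) b ^+ m) = diag_bot t ^+ m.
Proof.
move=> tn; rewrite /diag_bot (prod_expr_comm _ (F := fun a => u (t.-1 - a) a)).
  rewrite -(model_minor_bottom cum rowm tn).
  apply: eq_qdet => a b ha _; rewrite frob; congr (model _ _ _ _ _); lia.
by move=> a b ha hb; case: (u_diag_comm t.-1 0 a b) => // -[]; lia.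
Qed.

Lemma u_diag_top t r l : (t <= n)%N ->
  qcomm q ((n - t <= r)%N%:Z - (n - t <= l)%N%:Z) (u r l) (diag_top t).
Proof.
move=> tn; case: (boolP ((r < n) && (l < n))%N) => [/andP[hr hl]|h].
  rewrite -sum_beta_top_right //; apply: (qcomm_prodr q0) => a.
  exact: torus_uu.
by rewrite {1}/torus_u (negPf h); exact: qcomm0l.
Qed.

Lemma u_diag_bot t r l : (t <= n)%N ->
  qcomm q ((t <= r)%N%:Z - (t <= l)%N%:Z) (u r l) (diag_bot t).
Proof.
move=> tn; case: (boolP ((r < n) && (l < n))%N) => [/andP[hr hl]|h].
  rewrite -(sum_beta_bottom_left tn hr hl); apply: (qcomm_prodr q0) => a.
  exact: torus_uu.
by rewrite {1}/torus_u (negPf h); exact: qcomm0l.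
Qed.

Lemma c_diag_top t r l : (t <= n)%N ->
  qcomm q ((n - t <= r.+1)%N%:Z - (n - t <= r)%N%:Z) (c r l) (diag_top t).
Proof.
move=> tn; case: (boolP ((r.+1 < n) && (l < n))%N) => [/andP[hr hl]|h].
  suff : qcomm q (\sum_(a < t) (beta r.+1 l (n.-1 - a) (n - t + a) -
      beta r l (n.-1 - a) (n - t + a))) (c r l) (diag_top t).
    rewrite sumrB !sum_beta_top_right ?(ltnW hr) // => /qcomm_eq; apply; lia.
  by apply: (qcomm_prodr q0) => a; exact: torus_uc.
by rewrite {1}/torus_c (negPf h); exact: qcomm0l.
Qed.

Lemma c_diag_bot t r l : (t <= n)%N ->
  qcomm q ((t <= r.+1)%N%:Z - (t <= r)%N%:Z) (c r l) (diag_bot t).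
Proof.
move=> tn; case: (boolP ((r.+1 < n) && (l < n))%N) => [/andP[hr hl]|h].
  suff : qcomm q (\sum_(a < t) (beta r.+1 l (t.-1 - a) a -
      beta r l (t.-1 - a) a)) (c r l) (diag_bot t).
    rewrite sumrB !(sum_beta_bottom_left tn) ?(ltnW hr) // => /qcomm_eq; apply; lia.
  by apply: (qcomm_prodr q0) => a; exact: torus_uc.
by rewrite {1}/torus_c (negPf h); exact: qcomm0l.
Qed.

Lemma tmodel_diag_top t p r j : (t <= n)%N ->
  qcomm q ((n - t <= r)%N%:Z - (n - t <= j)%N%:Z) (tm p r j) (diag_top t).
Proof.
move=> tn; apply: (model_normal q0 (al := fun r => (n - t <= r)%N%:Z)
  (be := fun j => - (n - t <= j)%N%:Z)) => r' l'.
  exact: u_diag_top.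
exact: c_diag_top.
Qed.

Lemma tmodel_diag_bot t p r j : (t <= n)%N ->
  qcomm q ((t <= r)%N%:Z - (t <= j)%N%:Z) (tm p r j) (diag_bot t).
Proof.
move=> tn; apply: (model_normal q0 (al := fun r => (t <= r)%N%:Z)
  (be := fun j => - (t <= j)%N%:Z)) => r' l'.
  exact: u_diag_bot.
exact: c_diag_bot.
Qed.

(** [diag_top t] and [diag_bot (n - t)] have the same commutation exponent with each entry. The
    product has s + (m - s) = m such factors, so the total exponent is a multiple of m. *)
Lemma tmodel_top_bot_central t s p r j : (t <= n)%N -> (s <= m)%N ->
  tm p r j * (diag_top t ^+ s * diag_bot (n - t) ^+ (m - s)) =
  (diag_top t ^+ s * diag_bot (n - t) ^+ (m - s)) * tm p r j.
Proof.
move=> tn sm; set z : int := (n - t <= r)%N%:Z - (n - t <= j)%N%:Z.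
have h1 := qcommXr q0 s (tmodel_diag_top p r j tn).
have h2 := qcommXr q0 (m - s) (tmodel_diag_bot p r j (leq_subr t n)).
have := qcommMr q0 h1 h2; rewrite -/z -mulrDr -PoszD subnKC // /qcomm.
by rewrite (exprz_root_mulr qm) scale1r.
Qed.

Lemma tmodel_top_n_central p r j : (r < n)%N -> (j < n)%N ->
  tm p r j * diag_top n = diag_top n * tm p r j.
Proof.
move=> _ _; have := tmodel_diag_top p r j (leqnn n).
by rewrite subnn !leq0n subrr => /(qcomm0P q).
Qed.

Lemma diag_top_bot_comm t : (t <= n)%N ->
  diag_top t * diag_bot (n - t) = diag_bot (n - t) * diag_top t.
Proof.
move=> tn; apply: commr_prod => -[a ha] _.
apply/esym/(qcomm0P q); apply: (qcomm_eq (u_diag_top _ _ tn)) => /=.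
have -> : (n - t <= (n - t).-1 - a)%N = false by lia.
by rewrite leqNgt ha.
Qed.

Lemma tmodel_exp_central r j s l : (r < n)%N -> (s < n)%N -> (j < n)%N -> (l < n)%N ->
  tm n r j ^+ m * tm n s l = tm n s l * tm n r j ^+ m.
Proof.
have [h1 h2 h3 h4] := tmodel_relP n => hr hs hj hl.
pose xx := tm n r j; pose yy := tm n s l.
have qcase (z : int) : qcomm q z xx yy -> xx ^+ m * yy = yy * xx ^+ m.
  exact: (qcomm_root_central q0 qm).
have q2m : q ^+ 2 ^+ m = 1 by rewrite -exprM mulnC exprM qm expr1n.
have q2n1 : q ^+ 2 != 1.
  rewrite -(prim_order_dvd qprim); apply/negP => /dvdn_leq => /(_ isT) m2.
  by have E : m = 2; [apply/eqP; rewrite eqn_leq m2 | move: om; rewrite E].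
(* x y - y x = mu w z with w, z both q-commuting with x, so x^e y - y x^e = (1 + q^2 + ... ) x^(e-1) w z *)
have gen (w z : poly_alg 'M[k]_((grp_dim m V).+1)) (d mu : k) : d ^+ m = 1 -> d != 1 ->
    xx * yy = yy * xx + mu *: (w * z) -> (w * z) * xx = d *: (xx * (w * z)) ->
    xx ^+ m * yy = yy * xx ^+ m.
  move=> dm d1 hxy hwz.
  have E e : xx ^+ e * yy = yy * xx ^+ e +
      (mu * \sum_(i < e) d ^+ i) *: (xx ^+ e.-1 * (w * z)).
    elim: e => [|e IH]; first by rewrite big_ord0 mulr0 scale0r addr0 !expr0 mul1r mulr1.
    rewrite exprSr -mulrA hxy mulrDr mulrA IH mulrDl -mulrA -exprSr -addrA.
    congr (_ + _); rewrite -scalerAl -mulrA hwz -!scalerAr scalerA.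
    case: e {IH} => [|e].
      by rewrite big_ord0 mulr0 mul0r scale0r add0r big_ord1 expr0 mulr1 mul1r.
    rewrite [X in _ *: X + _]mulrA -exprSr /= -scalerDl; congr (_ *: _).
    rewrite -mulrA -[X in _ + X]mulr1 -mulrDr; congr (_ * _).
    rewrite [RHS]big_ord_recl expr0 addrC; congr (_ + _).
    by rewrite mulr_suml; apply: eq_bigr => i _; rewrite -exprSr.
  rewrite E (_ : \sum_(i < m) d ^+ i = 0) ?mulr0 ?scale0r ?addr0 //.
  apply/eqP; have := subrX1 d m; rewrite dm subrr => /esym/eqP.
  by rewrite mulf_eq0 subr_eq0 (negPf d1).
case: (ltngtP s r) => sr; last 1 first.
- subst s; case: (ltngtP j l) => jl.
  + by apply: (qcase 1); rewrite /qcomm expr1z; exact: h1.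
  + by apply: (qcase (- 1)); apply: (qcomm_sym q0); rewrite /qcomm expr1z; exact: h1.
  + by rewrite jl -exprSr exprS.
- case: (ltngtP j l) => jl.
  + apply: (gen (tm n r l) (tm n s j) (q ^- 2) (q - q^-1)).
    * by rewrite exprVn q2m invr1.
    * by rewrite invr_eq1.
    * exact: h4.
    * rewrite -/xx -mulrA [tm n s j * xx](_ : _ = q^-1 *: (xx * tm n s j)); last first.
        by rewrite [xx * _]h2 // scalerA mulVf // scale1r.
      rewrite -scalerAr (mulrA (tm n r l)) [tm n r l * xx](_ : _ = q^-1 *: (xx * tm n r l)); last first.
        by rewrite [xx * _]h1 // scalerA mulVf // scale1r.
      by rewrite -scalerAl scalerA -invfM mulrA.
  + by apply: (qcase 0); apply/qcomm0P; exact: h3.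
  + by apply: (qcase 1); rewrite /qcomm expr1z /xx /yy jl; exact: h2.
- case: (ltngtP l j) => jl.
  + apply: (gen (tm n s j) (tm n r l) (q ^+ 2) (- (q - q^-1))) => //.
      by rewrite /xx /yy (h4 _ _ _ _ sr jl) scaleNr addrK.
    rewrite -/xx -mulrA [tm n r l * xx]h1 // -scalerAr (mulrA (tm n s j)) [tm n s j * xx]h2 //.
    by rewrite -scalerAl scalerA -expr2 mulrA.
  + by apply: (qcase 0); apply/qcomm0P/esym; exact: h3.
  + apply: (qcase (- 1)); apply: (qcomm_sym q0); rewrite /qcomm expr1z /xx /yy jl.
    exact: h2.
Qed.

End TorusMinors.

(** * Exponent vectors, their degrees and leading exponents *)

Section ExponentVectors.
Variables (n M : nat).
Local Notation V := ('I_n * 'I_n)%type.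
Local Notation W := {ffun V -> nat}.

Definition wdeg (w : W) : nat := (\sum_v w v * cell_weight n M v.1 v.2)%N.
Definition wsize (w : W) : nat := (\sum_v w v)%N.
Definition wunit (r l : nat) : W := [ffun v : V => (v.1 == r :> nat) && (v.2 == l :> nat) : nat].

Lemma wdegD w w' : wdeg (w + w') = (wdeg w + wdeg w')%N.
Proof. by rewrite /wdeg -big_split; apply: eq_bigr => v _; rewrite ffunE mulnDl. Qed.

Lemma wdeg0 : wdeg 0 = 0%N.
Proof. by rewrite /wdeg big1 // => v _; rewrite ffunE mul0n. Qed.

Lemma wsizeD w w' : wsize (w + w') = (wsize w + wsize w')%N.
Proof. by rewrite /wsize -big_split; apply: eq_bigr => v _; rewrite ffunE. Qed.

Lemma wsize0 : wsize 0 = 0%N.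
Proof. by rewrite /wsize big1 // => v _; rewrite ffunE. Qed.

Lemma wsize_ge (w : W) (v : V) : (w v <= wsize w)%N.
Proof. by rewrite /wsize (bigD1 v) //= leq_addr. Qed.

Lemma sum_wunit r l (F : V -> nat) (hr : (r < n)%N) (hl : (l < n)%N) :
  (\sum_v wunit r l v * F v = F (Ordinal hr, Ordinal hl))%N.
Proof.
rewrite (bigD1 (Ordinal hr, Ordinal hl)) //= ffunE !eqxx mul1n big1 ?addn0 //.
case=> a b nab; rewrite ffunE /=; case: eqP => [E1|_]; last by rewrite mul0n.
case: eqP => [E2|_]; last by rewrite mul0n.
by case/eqP: nab; congr (_, _); apply: val_inj.
Qed.

Lemma wdeg_unit r l : (r < n)%N -> (l < n)%N -> wdeg (wunit r l) = cell_weight n M r l.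
Proof. by move=> hr hl; rewrite /wdeg (sum_wunit _ hr hl). Qed.

Lemma wsize_unit r l : (r < n)%N -> (l < n)%N -> wsize (wunit r l) = 1%N.
Proof.
move=> hr hl; rewrite -(sum_wunit (fun=> 1%N) hr hl).
by apply: eq_bigr => v _; rewrite muln1.
Qed.

Hypotheses (n0 : (0 < n)%N) (M1 : (1 < M)%N).

Lemma sum_digits N (d : nat -> nat) e : (forall i, (d i < M)%N) ->
  (\sum_(i < N) d i * M ^ i < M ^ N)%N /\
  ((e < N)%N -> ((\sum_(i < N) d i * M ^ i) %/ M ^ e) %% M = d e)%N.
Proof.
move=> hd; elim: N => [|N [IH1 IH2]]; first by rewrite big_ord0 expn0.
rewrite big_ord_recr /=; split.
  apply: (@leq_trans (M ^ N + d N * M ^ N)); first by rewrite ltn_add2r.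
  by rewrite -mulSn expnS leq_mul2r hd orbT.
rewrite ltnS leq_eqVlt => /orP[/eqP->|eN].
  by rewrite addnC divnMDl ?expn_gt0 ?(ltnW M1) // divn_small // addn0 modn_small.
have -> : (M ^ N = M ^ (N - e.+1) * M * M ^ e)%N.
  by rewrite -expnSr -expnD; congr (_ ^ _)%N; lia.
rewrite addnC mulnA divnMDl ?expn_gt0 ?(ltnW M1) //.
by rewrite mulnA -modnDml modnMl add0n IH2.
Qed.

(** The weights are the powers of M indexed by cell ranks, so the exponents are the base-M digits of
    the degree. *)
Lemma wdeg_inj (w w' : W) : (forall v, (w v < M)%N) -> (forall v, (w' v < M)%N) ->
  wdeg w = wdeg w' -> w = w'.
Proof.
pose D (x : W) (i : nat) := (\sum_(v : V | cell_rank n v.1 v.2 == i) x v)%N.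
have DE (x : W) (v : V) : D x (cell_rank n v.1 v.2) = x v.
  rewrite /D (bigD1 v) //= big1 ?addn0 // => v' /andP[/eqP E nv].
  by case/eqP: nv; exact: (cell_rank_inj E).
have Dlt (x : W) (i : nat) : (forall v, (x v < M)%N) -> (D x i < M)%N.
  move=> hx; case: (pickP (fun v : V => cell_rank n v.1 v.2 == i)) => [v /eqP <-|no].
    by rewrite DE.
  by rewrite /D big_pred0 // ltnW.
have degE (x : W) : wdeg x = (\sum_(i < n * n) D x i * M ^ i)%N.
  rewrite /wdeg (partition_big (fun v : V => inord (cell_rank n v.1 v.2) : 'I_(n * n).-1.+1) predT) //=.
  have nn : (n * n).-1.+1 = (n * n)%N by rewrite prednK // muln_gt0 n0.
  rewrite -[RHS](big_mkord xpredT (fun i => D x i * M ^ i)%N) -[X in index_iota 0 X]nn.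
  rewrite big_mkord; apply: eq_bigr => i _; rewrite /D big_distrl /=.
  apply: eq_big => [v|v].
    by rewrite -val_eqE /= inordK // nn cell_rank_lt.
  move=> /eqP <-; rewrite inordK // nn; exact: cell_rank_lt.
move=> hw hw' E; apply/ffunP => v.
have rk : (cell_rank n v.1 v.2 < n * n)%N by exact: cell_rank_lt.
have [_ /(_ rk) h] := sum_digits (n * n) (cell_rank n v.1 v.2) (fun i => Dlt w i hw).
have [_ /(_ rk) h'] := sum_digits (n * n) (cell_rank n v.1 v.2) (fun i => Dlt w' i hw').
by rewrite -!DE -h -h' -!degE E.
Qed.

End ExponentVectors.

Section Leads.
Variables (k : fieldType) (q : k) (m n M : nat).
Hypotheses (m1 : (1 < m)%N) (om : odd m) (qprim : m.-primitive_root q).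
Hypotheses (n0 : (0 < n)%N) (M1 : (1 < M)%N).
Let qm : q ^+ m = 1 := prim_expr_order qprim.
Local Notation V := ('I_n * 'I_n)%type.
Local Notation W := {ffun V -> nat}.
Local Notation Balg := (poly_alg 'M[k]_((grp_dim m V).+1)).
Local Notation tm := (tmodel q m n M).

Definition wred (w : W) : {ffun V -> 'Z_m} := [ffun v => (w v)%:R].
Lemma wredD w w' : wred (w + w') = wred w + wred w'.
Proof. by apply/ffunP => v; rewrite !ffunE natrD. Qed.

Lemma wred0 : wred 0 = 0. Proof. by apply/ffunP => v; rewrite !ffunE. Qed.

Lemma wred_unit r l : wred (wunit n r l) = unitg m n r l.
Proof. by apply/ffunP => v; rewrite !ffunE. Qed.

(** The matrix sees [w] only modulo m; the degree determines [w] once all its entries are below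
    M. *)
Definition Lead (P : Balg) (w : W) := has_lead q P (wred w) (wdeg M w).

Lemma LeadM P P' w w' : Lead P w -> Lead P' w' -> Lead (P * P') (w + w').
Proof. by rewrite /Lead wredD wdegD; exact: has_leadM. Qed.

Lemma Lead1 : Lead 1 0.
Proof. by rewrite /Lead wred0 wdeg0; exact: has_lead1. Qed.

Lemma Lead_prod (I : Type) (s : seq I) (F : I -> Balg) (w : I -> W) :
  (forall i, Lead (F i) (w i)) -> Lead (\prod_(i <- s) F i) (\sum_(i <- s) w i).
Proof.
move=> h; elim: s => [|i s IH]; first by rewrite !big_nil; exact: Lead1.
by rewrite !big_cons; exact: LeadM.
Qed.

Lemma LeadX P w e : Lead P w -> Lead (P ^+ e) (w *+ e).
Proof.
move=> h; elim: e => [|e IH]; first by rewrite expr0 mulr0n; exact: Lead1.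
by rewrite exprS mulrS; exact: LeadM.
Qed.

Lemma Lead_tmodel r j : (r < n)%N -> (j < n)%N -> Lead (tm n r j) (wunit n r j).
Proof. by move=> hr hj; rewrite /Lead wred_unit wdeg_unit //; exact: tmodel_has_lead. Qed.

Lemma Lead_torus_u r j : (r < n)%N -> (j < n)%N -> Lead (torus_u q m n M r j) (wunit n r j).
Proof.
move=> hr hj; rewrite /Lead wred_unit wdeg_unit // /torus_u hr hj /=.
by apply: has_lead_monom => //; exact: oner_neq0.
Qed.

Lemma Lead_neq0 P w : Lead P w -> P != 0.
Proof.
case=> a _ [sz _]; apply/eqP => E; move: sz; rewrite E.
by rewrite [LHS]size_poly0.
Qed.

Lemma LeadZ P w (a : k) : a != 0 -> Lead P w -> Lead (a *: P) w.
Proof.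
move=> a0 h; have := has_lead_monom m1 qm (0 : {ffun V -> 'Z_m}) 0%N a0.
move=> /(has_leadM m1 qm)/(_ h); rewrite add0r add0n /monom Wmx0 expr0 mulr1.
by [].
Qed.

Lemma LeadD_lower P w (P' : Balg) : Lead P w ->
  (size (P' : {poly _}) <= wdeg M w)%N -> Lead (P + P') w.
Proof.
case=> a a0 [sz lc] h; exists a => //.
by rewrite [size _]size_polyDl ?[lead_coef _]lead_coefDl ?sz.
Qed.

(** Both leading coefficients are multiples of one and the same [Wmx]; the bound on the size says
    that the degree drops. *)
Lemma Lead_cancel P P' w : Lead P w -> Lead P' w ->
  exists a : k, (size ((P - a *: P')%R : {poly _}) <= wdeg M w)%N.
Proof.
case=> a a0 [sz lc] [b b0 [sz' lc']]; exists (a / b).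
have [a' [sz2 lc2]] : exists P2 : {poly _}, P2 = (a / b) *: P' /\
   (size P2 = (wdeg M w).+1 /\ lead_coef P2 = a *: Wmx q (half_beta m (n:=n)) (wred w)).
  exists ((a / b) *: P'); split=> //.
  have ab0 : a / b != 0 by rewrite mulf_neq0 ?invr_eq0.
  have u : (a / b)%:A \is a @GRing.unit 'M[k]_((grp_dim m V).+1).
    by rewrite scaler_unit ?unitr1 ?unitfE.
  have nz : lead_coef ((a / b)%:A%:P : {poly 'M[k]_((grp_dim m V).+1)}) *
      lead_coef (P' : {poly _}) != 0.
    rewrite lead_coefC lc' mulr_algl scalerA -mulrA mulVf // mulr1.
    apply: contraTneq (Wmx_scale_unit m1 qm (wred w) a0) => ->.
    by rewrite unitr0.
  rewrite poly_alg_scaleE; split.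
    rewrite [LHS](size_proper_mul nz) sz' size_polyC.
    by case: eqP u => [->|]; rewrite ?unitr0.
  rewrite [LHS](lead_coef_proper_mul nz) lead_coefC lc' mulr_algl scalerA.
  by rewrite -mulrA mulVf // mulr1.
case: lc2 => sz2' lc2; rewrite -sz2.
have hs : (size ((P : {poly _}) - a')%R <= (wdeg M w).+1)%N.
  by rewrite (leq_trans (size_polyD _ _)) // size_polyN sz sz2' maxnn.
have hc : ((P : {poly _}) - a')`_(wdeg M w) = 0.
  have e1 : (P : {poly _})`_(wdeg M w) = lead_coef (P : {poly _}).
    by rewrite lead_coefE sz.
  have e2 : a'`_(wdeg M w) = lead_coef a' by rewrite lead_coefE sz2'.
  by rewrite coefB e1 e2 lc lc2 subrr.
apply/leq_sizeP => i; rewrite leq_eqVlt => /orP[/eqP <-|hi]; first exact: hc.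
by move/leq_sizeP: hs; exact.
Qed.

(** The leading coefficients commute too, while two matrices [Wmx] commute up to [chi] of the form;
    as [q] is primitive, [chi] is 1 only at 0. *)
Lemma Lead_commute P P' w w' : Lead P w -> Lead P' w' -> P * P' = P' * P ->
  asym (wred w) (wred w') = 0.
Proof.
case=> a a0 [_ lc] [b b0 [_ lc']] E.
set g := wred w; set g' := wred w'.
have u1 := Wmx_scale_unit (n := n) m1 qm g a0.
have u2 := Wmx_scale_unit (n := n) m1 qm g' b0.
have nzu (x y : 'M[k]_((grp_dim m V).+1)) : x \is a GRing.unit -> y \is a GRing.unit -> x * y != 0.
  move=> hx hy; have hxy : x * y \is a GRing.unit by rewrite unitrMr.
  by apply: contraTneq hxy => ->; rewrite unitr0.
have nz1 : lead_coef (P : {poly _}) * lead_coef (P' : {poly _}) != 0.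
  by rewrite lc lc'; exact: nzu.
have nz2 : lead_coef (P' : {poly _}) * lead_coef (P : {poly _}) != 0.
  by rewrite lc lc'; exact: nzu.
have E2 : lead_coef (P : {poly _}) * lead_coef (P' : {poly _}) =
          lead_coef (P' : {poly _}) * lead_coef (P : {poly _}).
  by rewrite -(lead_coef_proper_mul nz1) -(lead_coef_proper_mul nz2); congr lead_coef.
move: E2 nz2; rewrite lc lc' -!scalerAl -!scalerAr !scalerA mulrC Wmx_comm // => E2 nz2.
have {nz2} nz3 : Wmx q (half_beta m (n:=n)) g' * Wmx q (half_beta m (n:=n)) g != 0.
  by apply: contraNneq nz2 => ->; rewrite scaler0.
move: E2; rewrite scalerA => /eqP; rewrite -subr_eq0 -scalerBl scaler_eq0 (negPf nz3) orbF.
rewrite -[X in _ - X]mulr1 -mulrBr mulf_eq0 mulf_eq0 (negPf a0) (negPf b0) /= subr_eq0.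
rewrite asymE /chi -(prim_order_dvd qprim) => hd.
apply: val_inj => /=; apply/eqP; move: hd; rewrite /dvdn modn_small //.
by have := ltn_ord (asym g g'); rewrite [X in (_ < X)%N]Zp_cast.
Qed.

End Leads.

(** * Straightening *)

Section Regroup.
Variables (k : fieldType) (T : eqType).

(** Brings a sum into the shape in which leading terms can be compared: distinct labels and nonzero
    coefficients. *)
Lemma regroup_sum (l : seq (k * T)) : exists l' : seq (k * T),
  [/\ uniq (map snd l'), (forall p, p \in l' -> p.1 != 0),
      {subset map snd l' <= map snd l} &
      forall (U : lmodType k) (F : T -> U),
        \sum_(p <- l) p.1 *: F p.2 = \sum_(p <- l') p.1 *: F p.2].
Proof.
elim: l => [|[c t] l [l' [h1 h2 h3 h4]]].
  by exists [::]; split=> // U F; rewrite !big_nil.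
have sub (s : seq (k * T)) : {subset s <= l'} -> {subset map snd s <= t :: map snd l}.
  by move=> hs _ /mapP[p /hs hp ->]; rewrite inE h3 ?orbT //; apply: map_f.
pose l1 := [seq p <- l' | p.2 != t].
pose c' := c + \sum_(p <- l' | p.2 == t) p.1.
have E (U : lmodType k) (F : T -> U) :
    c *: F t + \sum_(p <- l) p.1 *: F p.2 = c' *: F t + \sum_(p <- l1) p.1 *: F p.2.
  rewrite h4 big_filter (bigID (fun p : k * T => p.2 == t)) /= addrA scalerDl.
  congr (_ + _ + _); rewrite scaler_suml; apply: eq_bigr => p /eqP ->.
  by [].
have u1 : uniq (map snd l1).
  have -> : map snd l1 = [seq y <- map snd l' | y != t] by rewrite filter_map.
  exact: filter_uniq.
have n1 p : p \in l1 -> p.1 != 0 by rewrite mem_filter => /andP[_ /h2].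
have s1 : {subset map snd l1 <= t :: map snd l}.
  by apply: sub => p; rewrite mem_filter => /andP[].
have [c0|c0] := eqVneq c' 0.
  by exists l1; split=> // U F; rewrite big_cons /= E c0 scale0r add0r.
exists ((c', t) :: l1); split=> /=.
- rewrite u1 andbT; apply/mapP => -[p]; rewrite mem_filter => /andP[/eqP ne _] e.
  by apply: ne.
- by move=> p; rewrite inE => /orP[/eqP->|/n1].
- by move=> y; rewrite inE => /orP[/eqP->|/s1 //]; rewrite inE eqxx.
- by move=> U F; rewrite !big_cons /= E.
Qed.
End Regroup.

Section Span.
Variables (k : fieldType) (T : eqType) (U : lmodType k).
Implicit Types (P : T -> Prop) (G : T -> U).

Definition in_span P G (z : U) := exists l : seq (k * T),
  (forall p, p \in l -> P p.2) /\ z = \sum_(p <- l) p.1 *: G p.2.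

Lemma in_span_gen P G t : P t -> in_span P G (G t).
Proof.
by exists [:: (1, t)]; rewrite big_seq1 scale1r; split=> // p; rewrite inE => /eqP->.
Qed.

Lemma in_span0 P G : in_span P G 0.
Proof. by exists [::]; rewrite big_nil. Qed.

Lemma in_spanD P G z z' : in_span P G z -> in_span P G z' -> in_span P G (z + z').
Proof.
case=> l [h ->] [l' [h' ->]]; exists (l ++ l'); rewrite big_cat; split=> // p.
by rewrite mem_cat => /orP[/h|/h'].
Qed.

Lemma in_spanZ P G c z : in_span P G z -> in_span P G (c *: z).
Proof.
case=> l [h ->]; exists [seq (c * p.1, p.2) | p <- l]; split.
  by move=> _ /mapP[p /h hp ->].
by rewrite big_map scaler_sumr; apply: eq_bigr => p _; rewrite scalerA.
Qed.

Lemma in_span_sum P G (I : eqType) (s : seq I) (F : I -> U) :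
  (forall i, i \in s -> in_span P G (F i)) -> in_span P G (\sum_(i <- s) F i).
Proof.
elim: s => [|i s IH] h; first by rewrite big_nil; exact: in_span0.
rewrite big_cons; apply: in_spanD; first by apply: h; rewrite inE eqxx.
by apply: IH => j hj; apply: h; rewrite inE hj orbT.
Qed.

Lemma in_span_sub P P' G z : (forall t, P t -> P' t) -> in_span P G z -> in_span P' G z.
Proof. by move=> h [l [hl E]]; exists l; split=> // p /hl/h. Qed.
End Span.

Section Words.
Variables (k : fieldType) (n : nat) (q : k).
Variables (A : algType k) (x : 'I_n -> 'I_n -> A).
Hypothesis q0 : q != 0.
Hypothesis xrel : qrel q x.
Local Notation V := ('I_n * 'I_n)%type.
Local Notation W := {ffun V -> nat}.

(* Letters carry bottom-indexed rows, as in [model]. *)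
Definition letter (v : V) : A := x (rev_ord v.1) v.2.
Definition word (s : seq V) : A := \prod_(v <- s) letter v.
Definition vrank (v : V) : nat := cell_rank n v.1 v.2.
Definition vge : rel V := fun v w => (vrank w <= vrank v)%N.

Lemma vrank_lt v : (vrank v < n * n)%N.
Proof. by apply: cell_rank_lt. Qed.

Lemma vge_trans : transitive vge.
Proof. by move=> a b c; rewrite /vge => h1 h2; exact: leq_trans h2 h1. Qed.

Lemma vge_total : total vge. Proof. by move=> a b; exact: leq_total. Qed.

Lemma vge_anti : antisymmetric vge.
Proof.
by move=> a b; rewrite /vge -eqn_leq => /eqP E; exact: (cell_rank_inj (esym E)).
Qed.

Lemma word_cat s1 s2 : word (s1 ++ s2) = word s1 * word s2.
Proof. by rewrite /word big_cat. Qed.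

Lemma letter_swap (a b : V) : (vrank a < vrank b)%N ->
  exists l : seq (k * (V * V)), (forall p, p \in l -> (vrank a < vrank p.2.1)%N) /\
    letter a * letter b = \sum_(p <- l) p.1 *: (letter p.2.1 * letter p.2.2).
Proof.
case: a b => [s l] [r j]; rewrite /letter /vrank /cell_rank /= => lt.
have rs : (s <= r)%N by move: lt; have := ltn_ord l; nia.
have [E|srn] := eqVneq s r.
  subst s; have jl : (j < l)%N by move: lt; have := ltn_ord l; have := ltn_ord j; lia.
  exists [:: (q^-1, ((r, j), (r, l)))]; split=> [p|]; first by rewrite inE => /eqP->.
  have [_ _ h _] := xrel (rev_ord r) j (rev_ord r) l.
  by rewrite big_seq1 /= h // scalerA mulVf // scale1r.
have sr : (s < r)%N by rewrite ltn_neqAle srn.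
have rev : (rev_ord r < rev_ord s)%N by rewrite /=; have := ltn_ord r; lia.
have [h1 h2 h3 h4] := xrel (rev_ord r) j (rev_ord s) l.
case: (ltngtP j l) => jl.
- exists [:: (1, ((r, j), (s, l))); (- (q - q^-1), ((r, l), (s, j)))]; split=> [p|].
    rewrite !inE => /orP[/eqP->|/eqP->] //=.
    by have := ltn_ord l; nia.
  by rewrite big_cons big_seq1 /= scale1r h1 // scaleNr addrK.
- exists [:: (1, ((r, j), (s, l)))]; split=> [p|]; first by rewrite inE => /eqP->.
  by rewrite big_seq1 /= scale1r h4.
- have {}jl : j = l by apply: val_inj.
  subst j; exists [:: (q^-1, ((r, l), (s, l)))]; split=> [p|]; first by rewrite inE => /eqP->.
  by rewrite big_seq1 /= h2 // scalerA mulVf // scale1r.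
Qed.

Lemma not_sorted (s : seq V) : ~~ sorted vge s ->
  exists s1 a b s2, s = s1 ++ a :: b :: s2 /\ ~~ vge a b.
Proof.
elim: s => // a [|b s] IH //=; rewrite negb_and => /orP[h|/IH].
  by exists [::], a, b, s.
by case=> s1 [c [d [s2 [-> h]]]]; exists (a :: s1), c, d, s2.
Qed.

(* Lexicographic position; the straightening rules increase the rank of the first
   letter of the rewritten pair, hence decrease the code. *)
Definition word_code (s : seq V) (e : nat) : nat :=
  foldl (fun e v => e * (n * n) + ((n * n).-1 - vrank v))%N e s.

Lemma word_code_lt s e e' : (e < e')%N -> (word_code s e < word_code s e')%N.
Proof.
rewrite /word_code; elim: s e e' => //= v s IH e e' h; apply: IH.
by rewrite ltn_add2r ltn_mul2r h (leq_ltn_trans _ (vrank_lt v)).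
Qed.

Lemma word_code_swap s1 s2 (a b c d : V) : (vrank a < vrank c)%N ->
  (word_code (s1 ++ c :: d :: s2) 0 < word_code (s1 ++ a :: b :: s2) 0)%N.
Proof.
move=> h; rewrite /word_code !foldl_cat /=; apply: word_code_lt.
set e := foldl _ _ _; have ha := vrank_lt a; have hc := vrank_lt c.
set N := (n * n)%N in ha hc *.
have h1 : ((N.-1 - vrank c).+1 <= N.-1 - vrank a)%N by lia.
have h2 : ((N.-1 - vrank c).+1 * N <= (N.-1 - vrank a) * N)%N by rewrite leq_mul2r h1 orbT.
have h3 : (N.-1 - vrank d < N)%N by lia.
rewrite !mulnDl -!addnA ltn_add2l mulSn in h2 *.
by apply: leq_trans (leq_trans _ h2) (leq_addr _ _); rewrite addnC ltn_add2r.
Qed.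

Definition word_exp (s : seq V) : W := [ffun v => count_mem v s].
Definition std_word (w : W) : seq V :=
  sort vge (flatten [seq nseq (w v) v | v <- enum {: V}]).

Lemma count_std_word w v : count_mem v (std_word w) = w v.
Proof.
have /seq.permP -> : perm_eq (std_word w) (flatten [seq nseq (w v) v | v <- enum {: V}]).
  by rewrite /std_word perm_sort.
rewrite count_flatten -map_comp.
rewrite sumnE big_map big_enum (bigD1 v) //= count_nseq /= eqxx mul1n big1 ?addn0 //.
by move=> v' nv; rewrite /= count_nseq /= (negPf nv) mul0n.
Qed.

Lemma sorted_std_word s : sorted vge s -> s = std_word (word_exp s).
Proof.
move=> hs; apply: (sorted_eq vge_trans vge_anti hs (sort_sorted vge_total _)).
by apply/allP => v _ /=; rewrite count_std_word ffunE.
Qed.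

Lemma wsize_word_exp s : wsize (word_exp s) = size s.
Proof.
rewrite /wsize; under eq_bigr => v _ do rewrite ffunE -sum1_count big_mkcond.
rewrite exchange_big /= -sum1_size big_seq [RHS]big_seq; apply: eq_bigr => v _.
rewrite (bigD1 v) //= eqxx big1 ?addn0 // => v' nv.
by rewrite eq_sym (negPf nv).
Qed.

Lemma straighten (s : seq V) :
  in_span (fun w => wsize w = size s) (fun w => word (std_word w)) (word s).
Proof.
have [N] := ubnP (word_code s 0); elim: N s => // N IH s; rewrite ltnS => hN.
case: (boolP (sorted vge s)) => [hs|/not_sorted[s1 [a [b [s2 [E nab]]]]]].
  rewrite {2}[s](sorted_std_word hs).
  by apply: (in_span_gen (fun w => word (std_word w))); exact: wsize_word_exp.
rewrite /vge -ltnNge in nab; have [l [hl El]] := letter_swap nab.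
have -> : word s = \sum_(p <- l) p.1 *: word (s1 ++ p.2.1 :: p.2.2 :: s2).
  rewrite E word_cat /word !big_cons (mulrA (letter a)) El mulr_suml mulr_sumr.
  apply: eq_bigr => p _.
  by rewrite big_cat !big_cons /= -scalerAl -scalerAr !mulrA.
apply: in_span_sum => p hp; apply: in_spanZ.
have -> : size s = size (s1 ++ p.2.1 :: p.2.2 :: s2) by rewrite E !size_cat.
apply: IH; apply: leq_trans hN; rewrite E; apply: word_code_swap; exact: hl.
Qed.

Definition Fil (d : nat) := in_span (fun s => (size s <= d)%N) word.

Lemma Fil_le d e z : (d <= e)%N -> Fil d z -> Fil e z.
Proof. by move=> de; apply: in_span_sub => s hs; exact: leq_trans de. Qed.

Lemma Fil1 : Fil 0 1.
Proof. have -> : 1 = word [::] by rewrite /word big_nil.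
exact: (in_span_gen word (P := fun s => (size s <= 0)%N)). Qed.

Lemma Fil_letter v : Fil 1 (letter v).
Proof.
have -> : letter v = word [:: v] by rewrite /word big_seq1.
exact: (in_span_gen word (P := fun s => (size s <= 1)%N)).
Qed.

Lemma Fil_gen i j : Fil 1 (x i j).
Proof. by have := Fil_letter (rev_ord i, j); rewrite /letter /= rev_ordK. Qed.

Lemma FilM d e z z' : Fil d z -> Fil e z' -> Fil (d + e) (z * z').
Proof.
case=> l [h ->] [l' [h' ->]]; rewrite mulr_suml; apply: in_span_sum => p /h hp.
rewrite mulr_sumr; apply: in_span_sum => p' /h' hp'.
rewrite -scalerAl -scalerAr; do 2!apply: in_spanZ.
by rewrite -word_cat; apply: in_span_gen; rewrite size_cat leq_add.
Qed.

Lemma FilX d e z : Fil d z -> Fil (e * d) (z ^+ e).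
Proof.
move=> h; elim: e => [|e IH]; first by rewrite expr0; exact: Fil1.
by rewrite exprS mulSn; exact: FilM.
Qed.

Lemma Fil_prod (I : Type) (s : seq I) (F : I -> A) (d : I -> nat) :
  (forall i, Fil (d i) (F i)) -> Fil (\sum_(i <- s) d i)%N (\prod_(i <- s) F i).
Proof.
move=> h; elim: s => [|i s IH]; first by rewrite !big_nil; exact: Fil1.
by rewrite !big_cons; exact: FilM.
Qed.

Lemma Fil_std d z : Fil d z ->
  in_span (fun w => (wsize w <= d)%N) (fun w => word (std_word w)) z.
Proof.
case=> l [h ->]; apply: in_span_sum => p hp; apply: in_spanZ.
by apply: in_span_sub (straighten p.2) => w ->; exact: h.
Qed.

(** Made boolean by excluded middle, so that the elements of finite degree form a subalgebra that is
    itself an [algType], a legitimate target for the universal property. *)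
Definition filtered : {pred A} :=
  fun z => if excluded_middle_informative (exists d, Fil d z) then true else false.

Lemma filteredP z : z \in filtered <-> exists d, Fil d z.
Proof. by rewrite unfold_in /filtered; case: excluded_middle_informative. Qed.

Fact filtered_subalg : subalg_closed filtered.
Proof.
split.
- by apply/filteredP; exists 0%N; exact: Fil1.
- move=> c a b /filteredP[d hd] /filteredP[e he]; apply/filteredP; exists (maxn d e).
  apply: in_spanD; first by apply: in_spanZ; apply: Fil_le hd; exact: leq_maxl.
  by apply: Fil_le he; exact: leq_maxr.
- move=> a b /filteredP[d hd] /filteredP[e he]; apply/filteredP; exists (d + e)%N.
  exact: FilM.
Qed.

HB.instance Definition _ := GRing.isSubalgClosed.Build k A filtered filtered_subalg.

Record filtered_alg := FilteredAlg { filtered_val : A; _ : filtered_val \in filtered }.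
HB.instance Definition _ := [isSub for filtered_val].
HB.instance Definition _ := [Choice of filtered_alg by <:].
HB.instance Definition _ := [SubChoice_isSubAlgebra of filtered_alg by <:].

Lemma filtered_val_hom : alg_hom filtered_val.
Proof.
split; [exact: (rmorphD (val : filtered_alg -> A))|exact: (rmorphM (val : filtered_alg -> A))
  |exact: (rmorph1 (val : filtered_alg -> A))|exact: (linearZ_LR (val : filtered_alg -> A))].
Qed.

(** The universal property implies generation: the map to the subalgebra of filtered elements
    followed by the inclusion agrees with the identity on the generators, hence everywhere by
    uniqueness. *)
Lemma filtered_all : is_Oq q x -> forall z, exists d, Fil d z.
Proof.
case=> _ univ z.
have mem i j : x i j \in filtered by apply/filteredP; exists 1%N; exact: Fil_gen.
pose y i j : filtered_alg := FilteredAlg (mem i j).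
have hv := filtered_val_hom.
have yrel : qrel q y.
  move=> i j i' l; have [h1 h2 h3 h4] := xrel i j i' l.
  split=> [hi hj|hi|hj|hi hj]; apply: val_inj => /=.
  - exact: h1.
  - exact: h2.
  - exact: h3.
  - exact: h4.
have [[f [fh fx]] _] := univ _ y yrel.
have [_ unicity] := univ _ x xrel.
have idh : alg_hom (fun a : A => a) by split.
have vfh : alg_hom (fun a => filtered_val (f a)).
  split=> [a b|a b||c a].
  - by rewrite (alg_homD fh) (alg_homD hv).
  - by rewrite (alg_homM fh) (alg_homM hv).
  - by rewrite (alg_hom1 fh) (alg_hom1 hv).
  - by rewrite (alg_homZ fh) (alg_homZ hv).
have -> : z = filtered_val (f z).
  apply: (unicity (fun a => a) (fun a => filtered_val (f a)) idh vfh) => // i j.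
  by rewrite fx.
by apply/filteredP; case: (f z).
Qed.

Lemma letters_central (a : A) : is_Oq q x ->
  (forall i j, a * x i j = x i j * a) -> center a.
Proof.
move=> hA ha z; have [d [l [_ ->]]] := filtered_all hA z.
rewrite mulr_sumr mulr_suml; apply: eq_bigr => p _.
rewrite -scalerAr -scalerAl; congr (_ *: _).
rewrite /word; elim: p.2 => [|v s IH]; first by rewrite big_nil mulr1 mul1r.
by rewrite big_cons mulrA ha -mulrA IH mulrA.
Qed.
End Words.

Section LeadSums.
Variables (k : fieldType) (q : k) (m n M : nat).
Hypotheses (m1 : (1 < m)%N) (qprim : m.-primitive_root q).
Hypotheses (n0 : (0 < n)%N) (M1 : (1 < M)%N).
Let qm : q ^+ m = 1 := prim_expr_order qprim.
Local Notation V := ('I_n * 'I_n)%type.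
Local Notation W := {ffun V -> nat}.
Local Notation Balg := (poly_alg 'M[k]_((grp_dim m V).+1)).

(** Distinct exponents with entries below M have distinct degrees, so the term of largest degree
    cannot be cancelled. *)
Lemma Lead_sum (T : eqType) (l : seq (k * T)) (F : T -> Balg) (w : T -> W) :
  uniq (map snd l) -> (forall p, p \in l -> p.1 != 0) ->
  {in map snd l &, injective w} ->
  (forall t v, t \in map snd l -> (w t v < M)%N) ->
  (forall t, t \in map snd l -> Lead q M (F t) (w t)) -> l != [::] ->
  exists2 t, t \in map snd l & Lead q M (\sum_(p <- l) p.1 *: F p.2) (w t).
Proof.
elim: l => // -[c t] l IH /= /andP[nt un] hc wi hM hL _.
have c0 : c != 0 by apply: (hc (c, t)); rewrite inE eqxx.
have Lt : Lead q M (c *: F t) (w t).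
  by apply: LeadZ => //; apply: hL; rewrite inE eqxx.
have [E|l0] := eqVneq l [::].
  by exists t; rewrite ?inE ?eqxx // E big_seq1.
have [] := IH un _ _ _ _ l0.
- by move=> p hp; apply: hc; rewrite inE hp orbT.
- by move=> a b ha hb; apply: wi; rewrite inE ?ha ?hb orbT.
- by move=> a v ha; apply: hM; rewrite inE ha orbT.
- by move=> a ha; apply: hL; rewrite inE ha orbT.
move=> t' ht' Lt'; rewrite big_cons.
case: (ltngtP (wdeg M (w t)) (wdeg M (w t'))) => h.
- exists t'; first by rewrite inE ht' orbT.
  rewrite addrC; apply: LeadD_lower => //.
  by case: Lt => a _ [-> _].
- exists t; first by rewrite inE eqxx.
  apply: LeadD_lower => //.
  by case: Lt' => a _ [-> _].
- case/negP: nt; suff -> : t = t' by [].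
  have mt : t \in t :: map snd l by rewrite inE eqxx.
  have mt' : t' \in t :: map snd l by rewrite inE ht' orbT.
  apply: wi => //; apply: (wdeg_inj n0 M1) h => v; exact: hM.
Qed.
End LeadSums.

(** * Quantum matrices through their torus homomorphisms *)

Section QuantumMatrices.
Variables (k : fieldType) (q : k) (m n : nat).
Hypotheses (m1 : (1 < m)%N) (om : odd m) (qprim : m.-primitive_root q) (n0 : (0 < n)%N).
Variables (A : algType k) (x : 'I_n -> 'I_n -> A).
Hypothesis hA : is_Oq q x.
Let qm : q ^+ m = 1 := prim_expr_order qprim.
Let q0 : q != 0 := prim_root_neq0 m1 qprim.
Let xrel : qrel q x := hA.1.
Local Notation V := ('I_n * 'I_n)%type.
Local Notation W := {ffun V -> nat}.

Definition is_torus_hom M (f : A -> poly_alg 'M[k]_((grp_dim m V).+1)) :=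
  alg_hom f /\ forall i j, f (x i j) = torus_mx q m M i j.

Lemma torus_hom M : (1 < M)%N -> exists f, is_torus_hom M f.
Proof.
move=> M1; have [_ /(_ _ _ (torus_qrel m1 om qprim n0 M1))[[f [h1 h2]] _]] := hA.
by exists f.
Qed.

Section Hom.
Variables (M : nat) (M1 : (1 < M)%N) (f : A -> poly_alg 'M[k]_((grp_dim m V).+1)).
Hypothesis hf : is_torus_hom M f.
Local Notation tm := (tmodel q m n M).

Lemma torus_hom_letter (v : V) : f (letter x v) = tm n v.1 v.2.
Proof.
rewrite hf.2 /torus_mx; congr (tm _ _ _) => /=; have := ltn_ord v.1; lia.
Qed.

Lemma torus_hom_xx a b : (a < n)%N -> (b < n)%N -> f (xx x a.+1 b.+1) = tm n (n.-1 - a) b.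
Proof. by move=> ha hb; rewrite /xx !insubT /= hf.2. Qed.

Lemma Lead_word (s : seq V) : Lead q M (f (word x s)) (word_exp s).
Proof.
have -> : word_exp s = \sum_(v <- s) wunit n v.1 v.2.
  elim: s => [|v s IH]; first by rewrite big_nil; apply/ffunP => v; rewrite !ffunE.
  rewrite big_cons -IH; apply/ffunP => -[a b]; rewrite !ffunE /=.
  by rewrite -pair_eqE /= eq_sym [v.2 == b]eq_sym.
rewrite (alg_hom_prod hf.1); apply: Lead_prod => // v.
by rewrite torus_hom_letter; apply: Lead_tmodel.
Qed.

Lemma word_exp_std (w : W) : word_exp (std_word w) = w.
Proof. by apply/ffunP => v; rewrite ffunE count_std_word. Qed.

Lemma Lead_std (w : W) : Lead q M (f (word x (std_word w))) w.
Proof. by have := Lead_word (std_word w); rewrite word_exp_std. Qed.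

Lemma Fil_Lead d z : Fil x d z -> (d < M)%N -> z != 0 ->
  exists2 w, (wsize w <= d)%N & Lead q M (f z) w.
Proof.
move=> /(Fil_std q0 xrel)[l [hl ->]] dM.
have [l' [u' nz' sub' hs]] := regroup_sum l.
rewrite (hs _ (fun w => word x (std_word w))).
move=> z0; have l0 : l' != [::].
  by apply: contraNneq z0 => ->; rewrite big_nil.
have hw t : t \in map snd l' -> (wsize t <= d)%N.
  by move/sub'/mapP => [p /hl hp ->].
have := Lead_sum m1 qprim n0 M1 (F := fun w => f (word x (std_word w))) (w := id) u' nz'.
case=> // [t v /hw ht|t _|w /hw hwd L].
- by apply: leq_ltn_trans dM; apply: leq_trans ht; exact: wsize_ge.
- exact: Lead_std.
exists w => //; rewrite (alg_hom_sum hf.1).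
by under eq_bigr => p _ do rewrite (alg_homZ hf.1).
Qed.

Lemma Fil_inj d z : Fil x d z -> (d < M)%N -> f z = 0 -> z = 0.
Proof.
move=> hz dM fz; apply/eqP; apply/negPn/negP => z0.
have [w _ /Lead_neq0] := Fil_Lead hz dM z0.
by rewrite fz eqxx.
Qed.

Lemma torus_hom_top t : (t <= n)%N -> f (Dt q x t) = diag_top q m n M t.
Proof.
move=> tn; rewrite /Dt qminorE size_iota (alg_hom_qdet hf.1).
rewrite -(minor_top m1 om qprim n0 M1 tn); apply: eq_qdet => a b ha hb.
rewrite !nth_iota // add1n addSn torus_hom_xx //; lia.
Qed.

Lemma torus_hom_bot t : (t <= n)%N -> f (tau_Dt q x t) = diag_bot q m n M t.
Proof.
move=> tn; rewrite /tau_Dt tau_qminorE size_iota (alg_hom_qdet hf.1).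
rewrite -(minor_bot m1 om qprim n0 M1 tn); apply: eq_qdet => a b ha hb.
rewrite !nth_iota // add1n addSn torus_hom_xx //; lia.
Qed.
End Hom.

(** M is taken above the filtration degree of a - b, where the homomorphism is injective. The
    hypothesis ranges over all M because this degree is not known in advance. *)
Lemma torus_hom_eq (a b : A) :
  (forall M f, (1 < M)%N -> is_torus_hom M f -> f a = f b) -> a = b.
Proof.
move=> h; have [d hd] := filtered_all xrel hA (a - b).
have M1 : (1 < d.+2)%N by [].
have [f hf] := torus_hom M1.
apply/eqP; rewrite -subr_eq0; apply/eqP; apply: (Fil_inj M1 hf hd) => //.
by rewrite (alg_homB hf.1) (h _ _ M1 hf) subrr.
Qed.

Lemma Oq_domain (a b : A) : a * b = 0 -> a = 0 \/ b = 0.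
Proof.
move=> ab; have [d hd] := filtered_all xrel hA a; have [e he] := filtered_all xrel hA b.
have [->|a0] := eqVneq a 0; first by left.
have [->|b0] := eqVneq b 0; first by right.
have M1 : (1 < (d + e).+2)%N by [].
have [f hf] := torus_hom M1.
have [w _ L] := Fil_Lead M1 hf hd (leqW (leq_addr e d)) a0.
have [w' _ L'] := Fil_Lead M1 hf he (leqW (leq_addl d e)) b0.
have := Lead_neq0 (LeadM m1 qprim L L').
by rewrite -(alg_homM hf.1) ab (alg_hom0 hf.1) eqxx.
Qed.

Lemma center_letters (a : A) :
  (forall M f, (1 < M)%N -> is_torus_hom M f -> forall r j, (r < n)%N -> (j < n)%N ->
     f a * tmodel q m n M n r j = tmodel q m n M n r j * f a) -> center a.
Proof.
move=> h; apply: (letters_central xrel hA) => i j.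
apply: torus_hom_eq => M f M1 hf; rewrite !(alg_homM hf.1) hf.2 /torus_mx.
apply: (h M) => //; have := ltn_ord i; lia.
Qed.

Lemma x_exp_central i j : center (x i j ^+ m).
Proof.
apply: center_letters => M f M1 hf r l hr hl.
rewrite (alg_homX hf.1) hf.2 /torus_mx; apply: tmodel_exp_central => //.
by have := ltn_ord i; lia.
Qed.

Lemma DqE : Dq q x = Dt q x n.
Proof. by rewrite /Dq /Dt subnn. Qed.

Lemma Dq_central : center (Dq q x).
Proof.
apply: center_letters => M f M1 hf r l hr hl.
rewrite DqE (torus_hom_top M1 hf) //; apply/esym.
exact: tmodel_top_n_central.
Qed.

Lemma Dt_tau_central t s : (t <= n)%N -> (s <= m)%N ->
  center (Dt q x t ^+ s * tau_Dt q x (n - t) ^+ (m - s)).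
Proof.
move=> tn sm; apply: center_letters => M f M1 hf r l hr hl.
rewrite (alg_homM hf.1) !(alg_homX hf.1) (torus_hom_top M1 hf) //.
rewrite (torus_hom_bot M1 hf) ?leq_subr //; apply/esym.
exact: tmodel_top_bot_central.
Qed.

Lemma Dt_tauC t : (t <= n)%N ->
  Dt q x t * tau_Dt q x (n - t) = tau_Dt q x (n - t) * Dt q x t.
Proof.
move=> tn; apply: torus_hom_eq => M f M1 hf; rewrite !(alg_homM hf.1).
rewrite (torus_hom_top M1 hf) // (torus_hom_bot M1 hf) ?leq_subr //.
exact: diag_top_bot_comm.
Qed.

Lemma Dt_exp t : (t <= n)%N ->
  qdet 1 t (fun a b => xx x a.+1 (n - t + b.+1) ^+ m) = Dt q x t ^+ m.
Proof.
move=> tn; apply: torus_hom_eq => M f M1 hf.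
rewrite (alg_hom_qdet hf.1) (alg_homX hf.1) (torus_hom_top M1 hf) //.
rewrite -(minor_top_exp m1 om qprim n0 M1 tn); apply: eq_qdet => a b ha hb.
rewrite (alg_homX hf.1) addnS (torus_hom_xx hf) //; lia.
Qed.

Lemma tau_Dt_exp t : (t <= n)%N ->
  qdet 1 t (fun a b => xx x (n - t + a.+1) b.+1 ^+ m) = tau_Dt q x t ^+ m.
Proof.
move=> tn; apply: torus_hom_eq => M f M1 hf.
rewrite (alg_hom_qdet hf.1) (alg_homX hf.1) (torus_hom_bot M1 hf) //.
rewrite -(minor_bot_exp m1 om qprim n0 M1 tn); apply: eq_qdet => a b ha hb.
rewrite (alg_homX hf.1) addnS (torus_hom_xx hf) //; lia.
Qed.

End QuantumMatrices.

(** * The presentation T/I *)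

Section Presentation.
Variables (k : fieldType) (n m : nat).
Local Notation T := (Tring k n m).

Lemma ZvE a b (ha : (a < n)%N) (hb : (b < n)%N) :
  Zv k n m a.+1 b.+1 = Tx k (inl (inl (Ordinal ha, Ordinal hb))).
Proof. by rewrite /Zv !insubT. Qed.

Lemma YvE a b (ha : (a < n.-1)%N) (hb : (b < m.-1)%N) :
  Yv k n m a.+1 b.+1 = Tx k (inl (inr (Ordinal ha, Ordinal hb))).
Proof. by rewrite /Yv !insubT. Qed.

Lemma detA_qdet t :
  detA k n m t = qdet 1 t (fun a b => Zv k n m a.+1 (n - t + b.+1)).
Proof. by rewrite -det_qdet. Qed.

Lemma detB_qdet t :
  detB k n m t = qdet 1 t (fun a b => Zv k n m (n - t + a.+1) b.+1).
Proof. by rewrite -det_qdet. Qed.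

Lemma detZ_detA : Defs.detZ k n m = detA k n m n.
Proof. by rewrite /Defs.detZ /detA subnn. Qed.

Lemma ideal_gen_sub (R : comRingType) (S P : R -> Prop) :
  is_ideal P -> (forall p, S p -> P p) -> forall p, ideal_gen S p -> P p.
Proof.
move=> [P0 PD PM] SP p [s [hs ->]]; elim: s hs => [|u s IH] hs.
  by rewrite big_nil.
rewrite big_cons; apply: PD; first by apply/PM/SP/hs; rewrite inE eqxx.
by apply: IH => v hv; apply: hs; rewrite inE hv orbT.
Qed.

Lemma ideal_gen_ideal (R : comRingType) (S : R -> Prop) : is_ideal (ideal_gen S).
Proof.
split.
- by exists [::]; rewrite big_nil.
- move=> _ _ [s [hs ->]] [s' [hs' ->]]; exists (s ++ s'); rewrite big_cat; split=> //.
  by move=> u; rewrite mem_cat => /orP[/hs|/hs'].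
- move=> a _ [s [hs ->]]; exists [seq (a * u.1, u.2) | u <- s]; split.
    by move=> _ /mapP[u /hs hu ->].
  by rewrite big_map mulr_sumr; apply: eq_bigr => u _; rewrite mulrA.
Qed.

Lemma ideal_gen_mem (R : comRingType) (S : R -> Prop) p : S p -> ideal_gen S p.
Proof.
move=> hp; exists [:: (1, p)]; rewrite big_seq1 mul1r; split=> // u.
by rewrite inE => /eqP->.
Qed.

Section Kill.
Variables (C : algType k) (g : T -> C) (DA DB : nat -> C).
Hypothesis hg : alg_hom g.
Hypothesis DAB : forall t, (t < n)%N -> DA t * DB (n - t)%N = DB (n - t)%N * DA t.
Hypothesis gA : forall t, (t <= n)%N -> g (detA k n m t) = DA t ^+ m.
Hypothesis gB : forall t, (t <= n)%N -> g (detB k n m t) = DB t ^+ m.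
Hypothesis gD : g (Dv k n m) = DA n.
Hypothesis gY : forall t r, (0 < t < n)%N -> (0 < r < m)%N ->
  g (Yv k n m t r) = DA t ^+ r * DB (n - t)%N ^+ (m - r).

(** With commuting a = [DA t] and b = [DB (n - t)], each Y relation splits a full m-th power of b,
    of a, or of both off a^(i+j) b^(2m-i-j). The target is arbitrary since both [phi] and the
    evaluations at points are instances. *)
Lemma Igens_kill p : Igens p -> g p = 0.
Proof.
have homs := (alg_homB hg, alg_homM hg, alg_homX hg).
case=> [->|[t [i [j [ht hi hj ->]]]]].
  by rewrite homs (alg_homX hg) gD detZ_detA gA // subrr.
have {}ht : (0 < t < n)%N by lia.
have {}hi : (0 < i < m)%N by lia.
have {}hj : (0 < j < m)%N by lia.
have tn : (t < n)%N by lia.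
have nt : (n - t <= n)%N by exact: leq_subr.
set a := DA t; set b := DB (n - t)%N.
have ab : GRing.comm a b by exact: DAB.
have prod i' j' i2 j2 : a ^+ i' * b ^+ i2 * (a ^+ j' * b ^+ j2) =
    a ^+ (i' + j') * b ^+ (i2 + j2).
  rewrite !exprD !mulrA; congr (_ * _); rewrite -!mulrA; congr (_ * _).
  by apply: commrX; apply/commr_sym; apply: commrX.
rewrite homs homs !gY // -/a -/b prod.
case: ltngtP => hij.
- rewrite homs gY ?gB -/a -/b //; last by lia.
  by rewrite -mulrA -exprD (_ : (m - i + (m - j) = m - (i + j) + m)%N) ?subrr //; lia.
- rewrite homs gY ?gA -/a -/b //; [|lia|lia].
  have -> : a ^+ (i + j - m) * b ^+ (m - (i + j - m)) * a ^+ m =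
      a ^+ (i + j - m + m) * b ^+ (m - (i + j - m) + 0).
    by rewrite -prod expr0 mulr1.
  rewrite addn0 subnK; last by lia.
  by rewrite (_ : (m - i + (m - j) = m - (i + j - m))%N) ?subrr //; lia.
- rewrite homs gA ?gB -/a -/b //; last by lia.
  by rewrite hij (_ : (m - i + (m - j) = m)%N) ?subrr //; lia.
Qed.

Lemma Iideal_kill p : Iideal p -> g p = 0.
Proof.
apply: (@ideal_gen_sub _ _ (fun p => g p = 0)); last exact: Igens_kill.
split=> [|a b|a b]; first exact: alg_hom0.
  by rewrite (alg_homD hg) => -> ->; rewrite addr0.
by rewrite (alg_homM hg) => ->; rewrite mulr0.
Qed.
End Kill.
End Presentation.

(** * The map from T to the center *)

Section Phi.
Variables (k : fieldType) (q : k) (m n : nat).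
Hypotheses (m1 : (1 < m)%N) (om : odd m) (qprim : m.-primitive_root q) (n0 : (0 < n)%N).
Variables (A : algType k) (x : 'I_n -> 'I_n -> A).
Hypothesis hA : is_Oq q x.
Local Notation T := (Tring k n m).
Local Notation phi := (@phi k n m q A x).

Lemma phi_gen_central v : center (@phi_gen k n m q A x v).
Proof.
case: v => [[[i j]|[t r]]|[]] /=.
- exact: (x_exp_central m1 om qprim n0 hA).
- apply: (Dt_tau_central m1 om qprim n0 hA); have := ltn_ord t; have := ltn_ord r; lia.
- exact: (Dq_central m1 om qprim n0 hA).
Qed.

(** Evaluating commutative polynomials in a noncommutative algebra is multiplicative here because
    the images of the variables are central. *)
Lemma phi_hom : alg_hom phi.
Proof.
pose h (i : 'I_#|{: Tvar n m}|) := @phi_gen k n m q A x (enum_val i).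
have hc i c : GRing.comm c (h i) by exact/esym/phi_gen_central.
have hf (p : T) v v' : GRing.comm (GRing.in_alg A p@_v) (mmap1 h v').
  by rewrite /GRing.comm mulr_algl mulr_algr.
have mult := commr_mmap_is_multiplicative (f := GRing.in_alg A) hc hf.
split=> [a b|a b||c a].
- exact: (mmapD h (GRing.in_alg A)).
- exact: mult.1.
- exact: mult.2.
- by rewrite /Defs.phi (mmapZ h (GRing.in_alg A)) mulr_algl.
Qed.

Lemma phi_Tx v : phi (Tx k v) = @phi_gen k n m q A x v.
Proof.
by rewrite /Defs.phi /Tx (mmapX _ (GRing.in_alg A)) mmap1U enum_rankK.
Qed.

Lemma phi_Zv a b : (a < n)%N -> (b < n)%N -> phi (Zv k n m a.+1 b.+1) = xx x a.+1 b.+1 ^+ m.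
Proof. by move=> ha hb; rewrite ZvE phi_Tx /xx !insubT. Qed.

Lemma phi_Yv t r : (0 < t < n)%N -> (0 < r < m)%N ->
  phi (Yv k n m t r) = Dt q x t ^+ r * tau_Dt q x (n - t) ^+ (m - r).
Proof.
case: t r => [|t] [|r] // ht hr.
have ht' : (t < n.-1)%N by lia.
have hr' : (r < m.-1)%N by lia.
by rewrite YvE phi_Tx.
Qed.

Lemma phi_detA t : (t <= n)%N -> phi (detA k n m t) = Dt q x t ^+ m.
Proof.
move=> tn; rewrite detA_qdet (alg_hom_qdet phi_hom) -(Dt_exp m1 om qprim n0 hA tn).
apply: eq_qdet => a b ha hb; rewrite addnS phi_Zv //; lia.
Qed.

Lemma phi_detB t : (t <= n)%N -> phi (detB k n m t) = tau_Dt q x t ^+ m.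
Proof.
move=> tn; rewrite detB_qdet (alg_hom_qdet phi_hom) -(tau_Dt_exp m1 om qprim n0 hA tn).
apply: eq_qdet => a b ha hb; rewrite addnS phi_Zv //; lia.
Qed.

Lemma phi_kill p : Iideal p -> phi p = 0.
Proof.
apply: (Iideal_kill (DA := Dt q x) (DB := tau_Dt q x) phi_hom) => [t tn|t tn|t tn||t r ht hr].
- exact: (Dt_tauC m1 om qprim n0 hA (ltnW tn)).
- exact: phi_detA.
- exact: phi_detB.
- by rewrite phi_Tx /= DqE.
- exact: phi_Yv.
Qed.

Lemma phi_center p : center (phi p).
Proof.
rewrite /Defs.phi /mmap => b; rewrite mulr_suml mulr_sumr; apply: eq_bigr => v _.
rewrite mulr_algl -scalerAl -scalerAr; congr (_ *: _).
rewrite /mmap1; apply/esym; apply: commr_prod => i _; apply: commrX.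
exact/esym/phi_gen_central.
Qed.
End Phi.

(** * Normal monomials span T modulo I *)

Section NormalMonomials.
Variables (k : fieldType) (n m : nat).
Hypotheses (m1 : (1 < m)%N) (n0 : (0 < n)%N).
Local Notation T := (Tring k n m).
Local Notation V := ('I_n * 'I_n)%type.
Local Notation W := {ffun V -> nat}.
Local Notation Rt := {ffun 'I_n.-1 -> nat}.
Local Notation I := (@Iideal k n m).
Implicit Types (p c : T) (e : W * nat * Rt).

Definition Zb (v : V) : T := Tx k (inl (inl (rev_ord v.1, v.2))).
(** A value r < m selects one variable Y for this t, or none when r = 0. That case must be separate,
    since [Yv] reads the index 0 as 1. *)
Definition Y1 (t r : nat) : T := if r == 0%N then 1 else Yv k n m t r.

Definition nmon e : T :=
  \prod_v Zb v ^+ e.1.1 v * Dv k n m ^+ e.1.2 * \prod_(t : 'I_n.-1) Y1 t.+1 (e.2 t).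
Definition valid e := (e.1.2 < m)%N /\ forall t : 'I_n.-1, (e.2 t < m)%N.

Let Iid : is_ideal I := ideal_gen_ideal (@Igens k n m).
Let I0 : I 0. Proof. by case: Iid. Qed.
Let ID a b : I a -> I b -> I (a + b). Proof. by case: Iid => _ h _; exact: h. Qed.
Let IM a b : I b -> I (a * b). Proof. by case: Iid => _ _ h; exact: h. Qed.

Definition reducible p := exists2 p', in_span valid nmon p' & I (p - p').

Lemma reducible_mod p p1 : I (p - p1) -> reducible p1 -> reducible p.
Proof.
move=> h [p' hs hi]; exists p' => //.
by rewrite -(subrK p1 p) -addrA; exact: ID.
Qed.

Lemma reducible_nmon e : valid e -> reducible (nmon e).
Proof. by move=> ve; exists (nmon e); rewrite ?subrr //; exact: in_span_gen. Qed.

Lemma reducible0 : reducible 0.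
Proof. by exists 0; rewrite ?subrr //; exact: in_span0. Qed.

Lemma reducibleD p p1 : reducible p -> reducible p1 -> reducible (p + p1).
Proof.
case=> a ha ia [b hb ib]; exists (a + b); first exact: in_spanD.
by rewrite opprD addrACA; exact: ID.
Qed.

Lemma reducibleZ (a : k) p : reducible p -> reducible (a *: p).
Proof.
case=> b hb ib; exists (a *: b); first exact: in_spanZ.
by rewrite -scalerBr -mulr_algl; exact: IM.
Qed.

(** These multipliers are closed under sums and products. Hence it is enough to treat the variables,
    and the corner determinants follow from the Z variables before the relations for D and Y are
    used. *)
Definition stabilizes c := forall p, reducible p -> reducible (c * p).

Lemma stabilizes_nmon c :
  (forall e, valid e -> reducible (c * nmon e)) -> stabilizes c.
Proof.
move=> h p [_ [l [hl ->]] hi].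
apply: (@reducible_mod _ (c * \sum_(a <- l) a.1 *: nmon a.2)).
  by rewrite -mulrBr; exact: IM.
rewrite mulr_sumr; elim: l hl {hi} => [|a l IH] hl; first by rewrite big_nil; exact: reducible0.
rewrite big_cons; apply: reducibleD.
  by rewrite -scalerAr; apply/reducibleZ/h/hl; rewrite inE eqxx.
by apply: IH => b hb; apply: hl; rewrite inE hb orbT.
Qed.

Lemma stabilizes1 : stabilizes 1. Proof. by move=> p; rewrite mul1r. Qed.
Lemma stabilizes0 : stabilizes 0.
Proof. by move=> p _; rewrite mul0r; exact: reducible0. Qed.
Lemma stabilizesD c c' : stabilizes c -> stabilizes c' -> stabilizes (c + c').
Proof. by move=> h h' p hp; rewrite mulrDl; apply: reducibleD; [exact: h|exact: h']. Qed.
Lemma stabilizesM c c' : stabilizes c -> stabilizes c' -> stabilizes (c * c').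
Proof. by move=> h h' p hp; rewrite -mulrA; apply/h/h'. Qed.
Lemma stabilizesZ (a : k) c : stabilizes c -> stabilizes (a *: c).
Proof. by move=> h p hp; rewrite -scalerAl; apply/reducibleZ/h. Qed.
Lemma stabilizesX c d : stabilizes c -> stabilizes (c ^+ d).
Proof.
by move=> h; elim: d => [|d IH]; rewrite ?expr0 ?exprS; [exact: stabilizes1|exact: stabilizesM].
Qed.

Lemma stabilizes_qdet Q t (Y : nat -> nat -> T) :
  (forall a b, stabilizes (Y a b)) -> stabilizes (qdet Q t Y).
Proof.
elim: t Y => [|t IH] Y h; first exact: stabilizes1.
rewrite qdetS; apply: (big_ind stabilizes); [exact: stabilizes0|exact: stabilizesD|].
by move=> j _; apply/stabilizesZ/stabilizesM => //; apply: IH.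
Qed.

Lemma stabilizes_Zb v : stabilizes (Zb v).
Proof.
apply: stabilizes_nmon => -[[z a] r] [ha hr] /=.
pose z' : W := [ffun w => ((w == v) + z w)%N].
suff -> : Zb v * nmon (z, a, r) = nmon (z', a, r) by apply: reducible_nmon; split.
rewrite /nmon /= !mulrA; congr (_ * _ * _).
rewrite (bigD1 v) //= [RHS](bigD1 v) //= !ffunE eqxx exprS -!mulrA; congr (_ * (_ * _)).
by apply: eq_bigr => w wv; rewrite ffunE (negPf wv).
Qed.

Lemma stabilizes_Zv i j : stabilizes (Zv k n m i j).
Proof.
rewrite /Zv; case: insubP => [a _ _|_]; last exact: stabilizes0.
case: insubP => [b _ _|_]; last exact: stabilizes0.
by have := @stabilizes_Zb (rev_ord a, b); rewrite /Zb /= rev_ordK.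
Qed.

Lemma stabilizes_detA t : stabilizes (detA k n m t).
Proof. by rewrite detA_qdet; apply: stabilizes_qdet => a b; exact: stabilizes_Zv. Qed.

Lemma stabilizes_detB t : stabilizes (detB k n m t).
Proof. by rewrite detB_qdet; apply: stabilizes_qdet => a b; exact: stabilizes_Zv. Qed.

Lemma stabilizes_Dv : stabilizes (Dv k n m).
Proof.
apply: stabilizes_nmon => -[[z a] r] [/= ha hr].
have E b a' : Dv k n m ^+ b * nmon (z, a', r) = nmon (z, (b + a')%N, r).
  by rewrite /nmon /= exprD !mulrA; congr (_ * _ * _); rewrite mulrC.
have [am|am] := ltnP a.+1 m.
  by rewrite -[Dv _ _ _]expr1 E; apply: reducible_nmon; split.
have {}am : a.+1 = m by apply/eqP; rewrite eqn_leq ha.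
have -> : Dv k n m * nmon (z, a, r) = Dv k n m ^+ m * nmon (z, 0%N, r).
  by rewrite -[X in X * _]expr1 !E addn0 add1n am.
apply: (@reducible_mod _ (Defs.detZ k n m * nmon (z, 0%N, r))).
  rewrite -mulrBl mulrC; apply/IM/ideal_gen_mem; left.
  by [].
rewrite detZ_detA; apply: stabilizes_detA; apply: reducible_nmon.
by split=> //; exact: ltnW.
Qed.

(** Modulo I, two variables Y with the same t become at most one such variable times corner
    determinants, which stabilize already. *)
Lemma stabilizes_Y1 (t : 'I_n.-1) i : (i < m)%N -> stabilizes (Y1 t.+1 i).
Proof.
move=> im; have [->|i0] := eqVneq i 0%N; first exact: stabilizes1.
apply: stabilizes_nmon => -[[z a] r] [/= ha hr].
pose rs (s : nat) : Rt := [ffun t' => if t' == t then s else r t'].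
have vrs s : (s < m)%N -> valid (z, a, rs s).
  by split=> //= t'; rewrite ffunE; case: ifP.
pose rest := \prod_v Zb v ^+ z v * Dv k n m ^+ a * \prod_(t' | t' != t) Y1 t'.+1 (r t').
have E s : nmon (z, a, rs s) = Y1 t.+1 s * rest.
  rewrite /nmon /rest /= (bigD1 t) //= ffunE eqxx mulrCA !mulrA; congr (_ * _).
  by apply: eq_bigr => t' tt; rewrite ffunE (negPf tt).
have E0 : nmon (z, a, r) = Y1 t.+1 (r t) * rest.
  rewrite -E; congr (nmon (_, _, _)); apply/ffunP => t'; rewrite ffunE.
  by case: eqP => // ->.
rewrite E0; have [rt0|rt0] := eqVneq (r t) 0%N.
  by rewrite rt0 {2}/Y1 /= mul1r -E; apply/reducible_nmon/vrs.
rewrite mulrA /Y1 (negPf i0) (negPf rt0).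
set R := (if (i + r t < m)%N then Yv k n m t.+1 (i + r t) * detB k n m (n - t.+1)
  else if (i + r t == m)%N then detA k n m t.+1 * detB k n m (n - t.+1)
  else Yv k n m t.+1 (i + r t - m) * detA k n m t.+1).
apply: (@reducible_mod _ (R * rest)).
  rewrite -mulrBl mulrC; apply/IM/ideal_gen_mem; right.
  exists t.+1, i, (r t); split=> //.
  - by have := ltn_ord t; lia.
  - by move: im i0; lia.
  - by have := hr t; move: rt0; lia.
rewrite {}/R; case: ltngtP => h.
- have := E (i + r t)%N; rewrite /Y1 (negPf (_ : (i + r t)%N != 0%N)); last by lia.
  move=> E'; rewrite mulrAC -E' mulrC; apply: stabilizes_detB.
  exact/reducible_nmon/vrs.
- have := E (i + r t - m)%N; rewrite /Y1 (negPf (_ : (i + r t - m)%N != 0%N)); last by lia.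
  move=> E'; rewrite mulrAC -E' mulrC; apply: stabilizes_detA.
  by apply/reducible_nmon/vrs; have := hr t; lia.
- have := E 0%N; rewrite /Y1 /= mul1r => <-.
  apply: stabilizesM; [exact: stabilizes_detA|exact: stabilizes_detB|].
  by apply/reducible_nmon/vrs; lia.
Qed.

Lemma reducible_all p : reducible p.
Proof.
have st v : stabilizes (Tx k v).
  case: v => [[[i j]|[t r]]|[]]; last exact: stabilizes_Dv.
    by have := @stabilizes_Zb (rev_ord i, j); rewrite /Zb /= rev_ordK.
  have hr : (r.+1 < m)%N by have := ltn_ord r; lia.
  have := @stabilizes_Y1 t r.+1 hr; rewrite /Y1 /= (YvE _ (ltn_ord t) (ltn_ord r)).
  by congr (stabilizes (Tx k (inl (inr (_, _))))); apply: val_inj.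
have sX (mm : 'X_{1..#|{: Tvar n m}|}) : stabilizes 'X_[mm].
  rewrite mpolyXE_id; apply: (big_ind stabilizes); [exact: stabilizes1|exact: stabilizesM|].
  move=> i _; apply: stabilizesX; have := st (enum_val i).
  by rewrite /Tx enum_valK.
rewrite [p]mpolyE; apply: (big_ind reducible); [exact: reducible0|exact: reducibleD|].
move=> mm _; apply: reducibleZ; rewrite -[X in reducible X]mulr1; apply: sX.
have -> : 1 = nmon ((0 : W), 0%N, (0 : Rt)).
  rewrite /nmon /= expr0 mulr1 !big1 ?mulr1 // => [t _|v _].
    by rewrite ffunE /Y1.
  by rewrite ffunE expr0.
apply: reducible_nmon; split=> [|t] /=; first exact: ltnW.
by rewrite ffunE ltnW.
Qed.
End NormalMonomials.

(** * Exponents of central leading terms *)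

Section SkewToeplitz.
Variables (R : comNzRingType) (n : nat) (F : nat -> nat -> R).
Hypothesis two_inj : forall a : R, a + a = 0 -> a = 0.
Let sg (a b : nat) : R := (a < b)%N%:R - (b < a)%N%:R.
Let C s l := \sum_(r < n) F r l * sg s r.
Let Rw s l := \sum_(j < n) F s j * sg j l.
(** Reversing the rows changes the sign of the sign matrix, so with rows counted from the bottom
    commutation becomes anticommutation. The solutions are constant on antidiagonals and change sign
    when r + j increases by n. *)
Hypothesis HF : forall s l, (s < n)%N -> (l < n)%N -> C s l + Rw s l = 0.

Let sum_at (f : nat -> R) s : (s < n)%N -> \sum_(r < n) f r * ((r : nat) == s)%:R = f s.
Proof.
move=> hs; rewrite (bigD1 (Ordinal hs)) //= eqxx mulr1 big1 ?addr0 // => r.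
by rewrite -val_eqE /= => /negPf->; rewrite mulr0.
Qed.

Let sgS s r : sg s r - sg s.+1 r = (r == s)%:R + (r == s.+1)%:R.
Proof.
have e1 : (s < r)%N = ((r == s.+1) + (s.+1 < r))%N :> nat.
  by rewrite leq_eqVlt eq_sym; case: eqP => [->|_]; rewrite ?ltnn.
have e2 : (r < s.+1)%N = ((r == s) + (r < s))%N :> nat.
  by rewrite ltnS leq_eqVlt; case: eqP => [->|_]; rewrite ?ltnn.
by rewrite /sg e1 e2 !natrD; ring.
Qed.

Let CS s l : (s.+1 < n)%N -> C s l - C s.+1 l = F s l + F s.+1 l.
Proof.
move=> hs; rewrite /C -sumrB.
under eq_bigr => r _ do rewrite -mulrBr sgS mulrDr.
by rewrite big_split /= (sum_at (F^~ l)) ?(sum_at (F^~ l)) // ltnW.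
Qed.

Let sgN a b : sg a b = - sg b a. Proof. by rewrite /sg opprB. Qed.

Let RS s l : (l.+1 < n)%N -> Rw s l.+1 - Rw s l = F s l + F s l.+1.
Proof.
move=> hl; rewrite /Rw -sumrB.
under eq_bigr => j _ do rewrite -mulrBr sgN [sg j l]sgN opprK addrC sgS mulrDr.
by rewrite big_split /= !sum_at // ltnW.
Qed.

(** Neighbouring rows of the sign matrix differ in two entries only, so the four equations around a
    cell combine to twice the claimed difference. *)
Lemma skew_shift s l : (s.+1 < n)%N -> (l.+1 < n)%N -> F s.+1 l = F s l.+1.
Proof.
move=> hs hl; apply/eqP; rewrite -subr_eq0; apply/eqP/two_inj.
have H1 := HF (ltnW hs) (ltnW hl); have H2 := HF hs (ltnW hl).
have H3 := HF (ltnW hs) hl; have H4 := HF hs hl.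
have c1 := CS l hs; have c2 := CS l.+1 hs; have r1 := RS s hl; have r2 := RS s.+1 hl.
have -> : F s.+1 l - F s l.+1 + (F s.+1 l - F s l.+1) =
    (F s l + F s.+1 l) - (F s l.+1 + F s.+1 l.+1) + (F s.+1 l + F s.+1 l.+1)
    - (F s l + F s l.+1) by ring.
rewrite -c1 -c2 -r1 -r2.
transitivity ((C s l + Rw s l) - (C s.+1 l + Rw s.+1 l) - (C s l.+1 + Rw s l.+1)
   + (C s.+1 l.+1 + Rw s.+1 l.+1)); first by ring.
by rewrite H1 H2 H3 H4 !subrr addr0.
Qed.

(** The first and last columns of the sign matrix add up to a vector supported at the two ends, so
    the sum of the two equations is local in [F]; comparing rows s and s.+1 gives twice the
    claim. *)
Lemma skew_wrap s : (s.+1 < n)%N -> F s.+1 n.-1 = - F s 0.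
Proof.
move=> hs; apply/eqP; rewrite -subr_eq0 opprK; apply/eqP/two_inj.
have n1 : n.-1.+1 = n by rewrite prednK //; exact: leq_ltn_trans hs.
have hn : (n.-1 < n)%N by rewrite n1.
have h0 : (0 < n)%N by rewrite -n1.
have RE t : (t < n)%N -> Rw t 0 + Rw t n.-1 = F t 0 - F t n.-1.
  move=> ht; rewrite -(sum_at (F t) h0) -(sum_at (F t) hn) /Rw -big_split -sumrB /=.
  apply: eq_bigr => j _; rewrite -mulrDr -mulrBr; congr (_ * _).
  rewrite /sg ltn0 lt0n sub0r; have -> : (n.-1 < j)%N = false.
    by apply/negbTE; rewrite -leqNgt -ltnS n1.
  have -> : (j < n.-1)%N = (j != n.-1 :> nat).
    by rewrite ltn_neqAle -[(j <= n.-1)%N]ltnS n1 ltn_ord andbT.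
  by case: eqP; case: eqP => _ _ /=; ring.
have H (t : nat) (ht : (t < n)%N) : C t 0 + C t n.-1 + (F t 0 - F t n.-1) = 0.
  by rewrite -RE // addrACA !HF // addr0.
have H1 := H s (ltnW hs); have H2 := H s.+1 hs.
have c1 := CS 0%N hs; have c2 := CS n.-1 hs.
transitivity ((F s 0%N + F s.+1 0%N) + (F s n.-1 + F s.+1 n.-1) +
   (F s 0%N - F s n.-1) - (F s.+1 0%N - F s.+1 n.-1)); first by ring.
rewrite -c1 -c2.
transitivity ((C s 0%N + C s n.-1 + (F s 0%N - F s n.-1)) -
   (C s.+1 0%N + C s.+1 n.-1 + (F s.+1 0%N - F s.+1 n.-1))); first by ring.
by rewrite H1 H2 subrr.
Qed.

Lemma skew_low r j : (r + j < n)%N -> F r j = F 0%N (r + j)%N.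
Proof.
elim: r j => // r IH j h; rewrite skew_shift; last by lia.
  by rewrite IH ?addnS -?addSnnS // -addSn.
by lia.
Qed.

Lemma skew_high r j : (r < n)%N -> (j < n)%N -> (n.-1 <= r + j)%N ->
  F r j = F (r + j - n.-1)%N n.-1.
Proof.
move=> hr hj h.
have [d] := ubnP (n.-1 - j)%N; elim: d r j hr hj h => // d IH r j hr hj h hd.
have [E|ne] := eqVneq j n.-1; first by rewrite E addnK.
case: r hr h => [|r] hr h; first by exfalso; move/eqP: ne; lia.
have hj1 : (j.+1 < n)%N by move/eqP: ne; lia.
rewrite skew_shift // IH //; last 3 first.
- exact: ltnW.
- by lia.
- by lia.
by congr (F _ _); lia.
Qed.

Lemma skew_periodic r j r' j' : (r < n)%N -> (j < n)%N -> (r' + j' < n)%N ->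
  (r + j = r' + j' + n)%N -> F r j = - F r' j'.
Proof.
move=> hr hj h E; rewrite skew_high //; last by lia.
have -> : (r + j - n.-1 = (r' + j').+1)%N by lia.
rewrite skew_wrap; last by lia.
by congr (- _); rewrite (skew_low h) skew_low addn0.
Qed.

Lemma skew_eq r j r' j' : (r < n)%N -> (j < n)%N -> (r' < n)%N -> (j' < n)%N ->
  (r + j = r' + j')%N -> F r j = F r' j'.
Proof.
move=> hr hj hr' hj' E; case: (ltnP (r + j) n) => h.
  by rewrite skew_low // [RHS]skew_low -E.
have h1 : (n.-1 <= r + j)%N by lia.
have h2 : (n.-1 <= r' + j')%N by lia.
by rewrite (skew_high hr hj h1) (skew_high hr' hj' h2) E.
Qed.
End SkewToeplitz.

Section NormalExponents.
Variables (n m : nat).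
Hypotheses (m1 : (1 < m)%N) (n0 : (0 < n)%N).
Local Notation V := ('I_n * 'I_n)%type.
Local Notation W := {ffun V -> nat}.
Local Notation Rt := {ffun 'I_n.-1 -> nat}.
Implicit Types (e : W * nat * Rt) (v : V).

Definition wtop (t : nat) : W := \sum_(a < t) wunit n (n.-1 - a) (n - t + a).
Definition wbot (t : nat) : W := \sum_(a < t) wunit n (t.-1 - a) a.

Definition nexp e : W :=
  \sum_(v : V) wunit n v.1 v.2 *+ (m * e.1.1 v) + wtop n *+ e.1.2 +
  \sum_(t : 'I_n.-1) (if e.2 t == 0%N then 0
                      else wtop t.+1 *+ e.2 t + wbot (n - t.+1) *+ (m - e.2 t)).

Lemma mulrnn (a b : nat) : a *+ b = (a * b)%N.
Proof. by elim: b => [|b IH]; rewrite ?mulr0n ?muln0 // mulrS IH mulnS. Qed.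

(** With rows counted from the bottom, the main diagonal of a corner minor is a complete
    antidiagonal of the square, so only the sum of the indices matters. *)
Lemma wtopE t v : (t <= n)%N -> wtop t v = ((v.1 + v.2 + t).+1 == n + n)%N :> nat.
Proof.
move=> tn; rewrite /wtop sum_ffunE; have h1 := ltn_ord v.1; have h2 := ltn_ord v.2.
case: (altP ((v.1 + v.2 + t).+1 =P (n + n)%N)) => [E|NE].
  have ht : (n.-1 - v.1 < t)%N by lia.
  rewrite (bigD1 (Ordinal ht)) //= big1 => [|a]; rewrite ffunE /=.
    by rewrite (_ : (v.1 == _ :> nat) && _) //; apply/andP; split; apply/eqP; lia.
  rewrite -val_eqE /= => na; rewrite (_ : _ && _ = false) //.
  by apply/negbTE/negP => /andP[/eqP e1 _]; move/eqP: na; have := ltn_ord a; lia.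
rewrite big1 // => a _; rewrite ffunE (_ : _ && _ = false) //.
apply/negbTE/negP => /andP[/eqP e1 /eqP e2]; move/eqP: NE; have := ltn_ord a; lia.
Qed.

Lemma wbotE t v : (t <= n)%N -> wbot t v = ((v.1 + v.2).+1 == t)%N :> nat.
Proof.
move=> tn; rewrite /wbot sum_ffunE; have h1 := ltn_ord v.1; have h2 := ltn_ord v.2.
case: (altP ((v.1 + v.2).+1 =P t)) => [E|NE].
  have ht : (v.2 < t)%N by lia.
  rewrite (bigD1 (Ordinal ht)) //= big1 => [|a]; rewrite ffunE /=.
    by rewrite (_ : (v.1 == _ :> nat) && _) //; apply/andP; split; apply/eqP; lia.
  rewrite -val_eqE /= => na; rewrite (_ : _ && _ = false) //.
  by apply/negbTE/negP => /andP[_ /eqP e1]; move/eqP: na; lia.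
rewrite big1 // => a _; rewrite ffunE (_ : _ && _ = false) //.
apply/negbTE/negP => /andP[/eqP e1 /eqP e2]; move/eqP: NE; have := ltn_ord a; lia.
Qed.

Definition rat_ext (r : Rt) (t : nat) : nat := if insub t is Some t' then r t' else 0%N.

(* Residue modulo m of the exponent of a cell on the antidiagonal r + j + 1 = s:
   D lives on s = n, and Y_{t+1,r} on s = 2n - t - 1 and s = n - t - 1. *)
Definition residue e (s : nat) : nat :=
  if s == n then e.1.2
  else if (n < s)%N then rat_ext e.2 (n + n - s.+1)
  else if rat_ext e.2 (n - s.+1) == 0%N then 0%N else (m - rat_ext e.2 (n - s.+1))%N.

Lemma rat_extE (r : Rt) (t : 'I_n.-1) : rat_ext r t = r t.
Proof. by rewrite /rat_ext valK. Qed.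

Lemma nexpE e v : nexp e v = (m * e.1.1 v + residue e (v.1 + v.2).+1)%N.
Proof.
case: e => [[z a] r]; rewrite /nexp !ffunE /= !sum_ffunE.
rewrite (bigD1 v) //= big1 => [|v' nv]; last first.
  rewrite ffunMnE ffunE /= (_ : _ && _ = false) ?mul0rn //.
  by apply/negbTE/negP => /andP[/eqP e1 /eqP e2]; case/eqP: nv; case: v' v e1 e2 => [a' b'] [c d] /= /ord_inj -> /ord_inj ->.
rewrite ffunMnE ffunE !eqxx /= addr0 mulrnn mul1n -[RHS]/(m * z v + _) -addrA; congr (_ + _).
rewrite ffunMnE wtopE // mulrnn.
have h1 := ltn_ord v.1; have h2 := ltn_ord v.2.
have Lt (t : 'I_n.-1) : (if r t == 0%N then 0 else wtop t.+1 *+ r t + wbot (n - t.+1) *+ (m - r t)) v =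
   (if r t == 0%N then 0 else ((v.1 + v.2 + t.+1).+1 == n + n) * r t +
     ((v.1 + v.2).+1 == n - t.+1) * (m - r t))%N :> nat.
  have ht := ltn_ord t; case: ifP => _; rewrite !ffunE //.
  by rewrite !ffunMnE wtopE ?wbotE ?mulrnn ?leq_subr //; lia.
under eq_bigr => t _ do rewrite Lt.
rewrite /residue /=; case: (ltngtP n (v.1 + v.2).+1) => h.
- rewrite (_ : (_ == n + n)%N = false) /=; last by apply/eqP; lia.
  rewrite mul0n add0r.
  have ht : (n + n - (v.1 + v.2).+2 < n.-1)%N by lia.
  have rE : rat_ext r (n + n - (v.1 + v.2).+2) = r (Ordinal ht) := rat_extE r (Ordinal ht).
  rewrite rE (bigD1 (Ordinal ht)) //= big1 => [|t].
    rewrite (_ : (_ == n + n)%N) /=; last by apply/eqP; lia.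
    rewrite (_ : (_ == n - _)%N = false) /=; last by apply/eqP; lia.
    by rewrite mul1n mul0n addn0 addr0; case: eqP => // ->.
  rewrite -val_eqE /= => nt; rewrite (_ : (_ == n + n)%N = false); last by apply/eqP; move/eqP: nt; lia.
  rewrite (_ : (_ == n - _)%N = false); last by apply/eqP; lia.
  by rewrite !mul0n if_same.
- rewrite (_ : (_ == n + n)%N = false) /=; last by apply/eqP; lia.
  rewrite mul0n add0r.
  have ht : (n - (v.1 + v.2).+2 < n.-1)%N by lia.
  have rE : rat_ext r (n - (v.1 + v.2).+2) = r (Ordinal ht) := rat_extE r (Ordinal ht).
  rewrite rE (bigD1 (Ordinal ht)) //= big1 => [|t].
    rewrite (_ : (_ == n + n)%N = false) /=; last by apply/eqP; lia.
    rewrite (_ : (_ == n - _)%N) /=; last by apply/eqP; lia.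
    by rewrite mul1n mul0n add0n addr0.
  rewrite -val_eqE /= => nt.
  rewrite (_ : (_ == n + n)%N = false); last by apply/eqP; have := ltn_ord t; lia.
  rewrite (_ : (_ == n - _)%N = false); last by apply/eqP; move/eqP: nt; have := ltn_ord t; lia.
  by rewrite !mul0n if_same.
- rewrite (_ : (_ == n + n)%N) /=; last by apply/eqP; lia.
  rewrite mul1n big1 ?addr0 // => t _; have ht := ltn_ord t.
  rewrite (_ : (_ == n + n)%N = false) /=; last by apply/eqP; lia.
  rewrite (_ : (_ == n - _)%N = false) /=; last by apply/eqP; lia.
  by rewrite !mul0n if_same.
Qed.

Lemma residue_lt e s : valid m e -> (residue e s < m)%N.
Proof.
case=> ha hr; have hx t : (rat_ext e.2 t < m)%N.
  by rewrite /rat_ext; case: insubP => [t' _ _|_]; [exact: hr|exact: ltnW].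
rewrite /residue; case: ifP => // _; case: ifP => // _; case: eqP => [_|]; first exact: ltnW.
by have := hx (n - s.+1)%N; lia.
Qed.

(** Division by m separates the Z exponents from the residues; the residues on antidiagonal n and
    beyond already give the exponent of D and the indices of the Y. *)
Lemma nexp_inj e e' : valid m e -> valid m e' -> nexp e = nexp e' -> e = e'.
Proof.
move=> he he' E.
have Ev v : (e.1.1 v = e'.1.1 v) /\ residue e (v.1 + v.2).+1 = residue e' (v.1 + v.2).+1.
  have := congr1 (fun w : W => w v) E; rewrite !nexpE => Ev.
  have m0 : (0 < m)%N by exact: ltnW.
  have l1 := residue_lt (v.1 + v.2).+1 he; have l2 := residue_lt (v.1 + v.2).+1 he'.
  have := congr1 (fun a => (a %/ m)%N) Ev; have := congr1 (fun a => (a %% m)%N) Ev.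
  by rewrite /= !(mulnC m) !modnMDl !divnMDl // !modn_small // !divn_small // !addn0.
case: e e' he he' E Ev => [[z a] r] [[z' a'] r'] _ _ _ Ev; congr (_, _, _).
- by apply/ffunP => v; case: (Ev v).
- have h : (n.-1 < n)%N by rewrite prednK.
  have [_] := Ev (Ordinal n0, Ordinal h); rewrite /= add0n prednK // /residue eqxx.
  by [].
- apply/ffunP => t; have ht := ltn_ord t.
  have h : (n.-1 < n)%N by rewrite prednK.
  have hb : (n.-1 - t < n)%N by lia.
  have [_] := Ev (Ordinal h, Ordinal hb); rewrite /= /residue.
  rewrite (_ : (_ == n)%N = false); last by apply/eqP; lia.
  rewrite (_ : (n < _)%N); last by lia.
  rewrite (_ : (n + n - (n.-1 + (n.-1 - t)).+2)%N = t :> nat); last by lia.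
  by rewrite !rat_extE.
Qed.

Lemma Zp_nat_eqE (a b : nat) : (a%:R == b%:R :> 'Z_m) = (a == b %[mod m]).
Proof. by rewrite -val_eqE /= !val_Zp_nat. Qed.

Hypothesis om : odd m.

Lemma Zp_two_inj (a : 'Z_m) : a + a = 0 -> a = 0.
Proof.
move=> h; have u : (2%:R : 'Z_m) \is a GRing.unit by rewrite unitZpE // coprimen2.
by apply: (mulrI u); rewrite mulr0 mulr_natl mulr2n.
Qed.

Lemma nexp_surj (w : W) :
  (forall s l, (s < n)%N -> (l < n)%N -> asym (wred m w) (unitg m n s l) = 0) ->
  exists2 e, valid m e & w = nexp e.
Proof.
move=> hw.
pose F (r j : nat) : 'Z_m := if insub r is Some r' then
   if insub j is Some j' then (w (r', j'))%:R else 0 else 0.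
have FE v : F v.1 v.2 = (w v)%:R by rewrite /F !valK; case: v.
have HF s l : (s < n)%N -> (l < n)%N ->
   \sum_(r < n) F r l * ((s < r)%N%:R - (r < s)%N%:R) +
   \sum_(j < n) F s j * ((j < l)%N%:R - (l < j)%N%:R) = 0.
  move=> hs hl; rewrite -[RHS](hw s l hs hl) /asym.
  transitivity (\sum_(u : V) wred m w u * (beta u.1 u.2 s l)%:~R); last first.
    apply: eq_bigr => u _; under eq_bigr => v _ do rewrite -mulrA.
    by rewrite -mulr_sumr (sum_unitg _ hs hl).
  have sp (u : V) : (beta u.1 u.2 s l)%:~R =
      (u.2 == l :> nat)%:R * ((s < u.1)%N%:R - (u.1 < s)%N%:R) +
      (u.1 == s :> nat)%:R * ((u.2 < l)%N%:R - (l < u.2)%N%:R) :> 'Z_m.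
    by rewrite /beta rmorphD /= !rmorphM !rmorphB /=.
  under [RHS]eq_bigr => u _ do rewrite sp mulrDr ffunE.
  rewrite big_split /=; congr (_ + _).
    transitivity (\sum_(a < n) \sum_(b < n) (w (a, b))%:R *
        ((b == l :> nat)%:R * ((s < a)%N%:R - (a < s)%N%:R)) : 'Z_m).
      apply: eq_bigr => a _; rewrite (bigD1 (Ordinal hl)) //= eqxx mul1r big1 ?addr0.
        by rewrite -(FE (a, Ordinal hl)).
      by move=> b; rewrite -val_eqE /= => /negPf->; rewrite mul0r mulr0.
    rewrite pair_bigA /=; apply: eq_bigr => -[a b] _ /=.
    by [].
  transitivity (\sum_(b < n) \sum_(a < n) (w (a, b))%:R *
      ((a == s :> nat)%:R * ((b < l)%N%:R - (l < b)%N%:R)) : 'Z_m).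
    apply: eq_bigr => b _; rewrite (bigD1 (Ordinal hs)) //= eqxx mul1r big1 ?addr0.
      by rewrite -(FE (Ordinal hs, b)).
    by move=> a; rewrite -val_eqE /= => /negPf->; rewrite mul0r mulr0.
  rewrite exchange_big pair_bigA /=; apply: eq_bigr => -[a b] _ /=.
  by [].
have hn : (n.-1 < n)%N by rewrite prednK.
have hb (t : 'I_n.-1) : (n.-1 - t < n)%N by have := ltn_ord t; lia.
have m0 : (0 < m)%N by exact: ltnW.
(* One representative cell per antidiagonal: (0, n-1) lies on number n, which belongs to D, and
   (n-1, n-1-t) on number 2n-t-1, where the Y of index t+1 has residue r. The antidiagonals below n
   are then forced. *)
pose e : W * nat * Rt := ([ffun v => (w v %/ m)%N], (w (Ordinal n0, Ordinal hn) %% m)%N,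
   [ffun t : 'I_n.-1 => (w (Ordinal hn, Ordinal (hb t)) %% m)%N]).
have ve : valid m e by split=> [|t] /=; rewrite ?ffunE ltn_pmod.
exists e => //; apply/ffunP => -[r0 j0]; rewrite nexpE /= ffunE.
have h1 := ltn_ord r0; have h2 := ltn_ord j0.
suff -> : residue e (r0 + j0).+1 = (w (r0, j0) %% m)%N by rewrite mulnC -divn_eq.
have eqF v' (h : F r0 j0 = F v'.1 v'.2) : (w v' %% m = w (r0, j0) %% m)%N.
  by move: h; rewrite (FE v') (FE (r0, j0)) => /eqP; rewrite Zp_nat_eqE => /eqP.
rewrite /residue; case: ifP => [/eqP hs|ns].
  by apply: (eqF (Ordinal n0, Ordinal hn)); apply: (skew_eq Zp_two_inj HF) => //=; lia.
case: ifP => [hs|hs].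
  have ht : (n + n - (r0 + j0).+2 < n.-1)%N by lia.
  have -> : rat_ext e.2 (n + n - (r0 + j0).+2) = e.2 (Ordinal ht) := rat_extE e.2 (Ordinal ht).
  rewrite ffunE; apply: (eqF (Ordinal hn, Ordinal (hb (Ordinal ht)))).
  by apply: (skew_eq Zp_two_inj HF) => //=; lia.
have ht : (n - (r0 + j0).+2 < n.-1)%N by lia.
have -> : rat_ext e.2 (n - (r0 + j0).+2) = e.2 (Ordinal ht) := rat_extE e.2 (Ordinal ht).
rewrite ffunE; set v' := (Ordinal hn, Ordinal (hb (Ordinal ht))).
have hF : F v'.1 v'.2 = - F r0 j0.
  by apply: (skew_periodic Zp_two_inj HF) => //=; lia.
(* Residues opposite modulo m are both 0 or add up to m, which is the case distinction in
   [residue]. *)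
have : (w v' + w (r0, j0))%:R == 0%:R :> 'Z_m by rewrite natrD -(FE v') -(FE (r0, j0)) hF addNr.
rewrite Zp_nat_eqE mod0n -modnDm.
have := ltn_pmod (w v') m0; have := ltn_pmod (w (r0, j0)) m0.
set a := (w (r0, j0) %% m)%N; set b := (w v' %% m)%N => ha hb' /eqP hab.
case: (ltnP (b + a) m) => hm; first by rewrite modn_small // in hab; case: eqP; lia.
have : ((b + a - m) %% m = 0)%N.
  by rewrite -[RHS]hab -[in RHS](subnK hm) modnDr.
rewrite modn_small; last by lia.
by case: eqP; lia.
Qed.
End NormalExponents.

(** * Kernel and image of the map to the center *)

Section CenterIso.
Variables (k : fieldType) (q : k) (m n : nat).
Hypotheses (m1 : (1 < m)%N) (om : odd m) (qprim : m.-primitive_root q) (n0 : (0 < n)%N).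
Variables (A : algType k) (x : 'I_n -> 'I_n -> A).
Hypothesis hA : is_Oq q x.
Let q0 : q != 0 := prim_root_neq0 m1 qprim.
Let xrel : qrel q x := hA.1.
Local Notation T := (Tring k n m).
Local Notation V := ('I_n * 'I_n)%type.
Local Notation W := {ffun V -> nat}.
Local Notation Rt := {ffun 'I_n.-1 -> nat}.
Local Notation phi := (@phi k n m q A x).
Let ph := phi_hom m1 om qprim n0 hA.

Lemma phi_Zb (v : V) : phi (Zb k m v) = letter x v ^+ m.
Proof. by rewrite /Zb phi_Tx. Qed.

Lemma phi_Dv : phi (Dv k n m) = Dt q x n.
Proof. by rewrite phi_Tx /= DqE. Qed.

Lemma phi_Y1 (t : 'I_n.-1) r : (r < m)%N -> phi (Y1 k n m t.+1 r) =
  if r == 0%N then 1 else Dt q x t.+1 ^+ r * tau_Dt q x (n - t.+1) ^+ (m - r).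
Proof.
move=> rm; rewrite /Y1; case: eqP => [_|r0]; first exact: alg_hom1.
rewrite phi_Yv //; have := ltn_ord t; lia.
Qed.

Lemma phi_nmon (e : W * nat * Rt) : valid m e -> phi (nmon k m e) =
  \prod_v (letter x v ^+ m) ^+ e.1.1 v * Dt q x n ^+ e.1.2 *
  \prod_(t : 'I_n.-1) (if e.2 t == 0%N then 1
    else Dt q x t.+1 ^+ e.2 t * tau_Dt q x (n - t.+1) ^+ (m - e.2 t)).
Proof.
case=> _ hr; rewrite /nmon !(alg_homM ph) !(alg_hom_prod ph) (alg_homX ph) phi_Dv.
congr (_ * _ * _); first by apply: eq_bigr => v _; rewrite (alg_homX ph) phi_Zb.
by apply: eq_bigr => t _; exact: phi_Y1.
Qed.

Lemma Lead_nmon M f (e : W * nat * Rt) : (1 < M)%N -> is_torus_hom (m := m) q x M f -> valid m e ->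
  Lead q M (f (phi (nmon k m e))) (nexp m e).
Proof.
move=> M1 hf ve; rewrite phi_nmon // !(alg_homM hf.1) !(alg_hom_prod hf.1) (alg_homX hf.1).
have qm := prim_expr_order qprim.
have Ltop t : (t <= n)%N -> Lead q M (f (Dt q x t)) (wtop n t).
  move=> tn; rewrite (torus_hom_top m1 om qprim n0 M1 hf tn); apply: Lead_prod => // a.
  by have := ltn_ord a => ha; apply: Lead_torus_u => //; lia.
have Lbot t : (t <= n)%N -> Lead q M (f (tau_Dt q x t)) (wbot n t).
  move=> tn; rewrite (torus_hom_bot m1 om qprim n0 M1 hf tn); apply: Lead_prod => // a.
  by have := ltn_ord a => ha; apply: Lead_torus_u => //; lia.
apply: LeadM => //; first apply: LeadM => //.
- apply: Lead_prod => // v; rewrite -exprM (alg_homX hf.1) (torus_hom_letter m1 om qprim n0 M1 hf).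
  by apply: LeadX => //; apply: Lead_tmodel.
- by apply: LeadX => //; exact: Ltop.
apply: Lead_prod => // t; case: ifP => _; first by rewrite (alg_hom1 hf.1); exact: Lead1.
rewrite (alg_homM hf.1) !(alg_homX hf.1); apply: LeadM => //; apply: LeadX => //.
  by apply: Ltop; have := ltn_ord t; lia.
by apply: Lbot; exact: leq_subr.
Qed.

Lemma Fil0 d : Fil x d 0. Proof. exact: in_span0. Qed.

Lemma Fil_xx i j : Fil x 1 (xx x i j).
Proof.
rewrite /xx; case: insubP => [a _ _|_]; last exact: Fil0.
by case: insubP => [b _ _|_]; [exact: Fil_gen|exact: Fil0].
Qed.

Lemma Fil_qdet Q t (Y : nat -> nat -> A) :
  (forall a b, Fil x 1 (Y a b)) -> Fil x t (qdet Q t Y).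
Proof.
elim: t Y => [|t IH] Y h; first exact: Fil1.
rewrite qdetS; apply: (big_ind (Fil x t.+1)); [exact: Fil0|move=> a b; exact: in_spanD|].
by move=> j _; apply: in_spanZ; apply: (FilM (d := 1)) => //; exact: IH.
Qed.

Lemma Fil_Dt t : Fil x t (Dt q x t).
Proof.
rewrite /Dt qminorE size_iota; apply: Fil_qdet => a b; exact: Fil_xx.
Qed.

Lemma Fil_tau_Dt t : Fil x t (tau_Dt q x t).
Proof.
rewrite /tau_Dt tau_qminorE size_iota; apply: Fil_qdet => a b; exact: Fil_xx.
Qed.

Lemma wsize_sum (I : Type) (s : seq I) (F : I -> W) :
  wsize (\sum_(i <- s) F i) = (\sum_(i <- s) wsize (F i))%N.
Proof. exact: (big_morph _ (@wsizeD n) (@wsize0 n)). Qed.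

Lemma wsizeMn (w : W) c : wsize (w *+ c) = (c * wsize w)%N.
Proof. by elim: c => [|c IH]; rewrite ?mulr0n ?wsize0 // mulrS wsizeD IH mulSn. Qed.

Lemma wsize_wtop t : (t <= n)%N -> wsize (wtop n t) = t.
Proof.
move=> tn; rewrite wsize_sum (eq_bigr (fun=> 1%N)); first by rewrite sum_nat_const card_ord muln1.
by move=> a _; have := ltn_ord a => ha; apply: wsize_unit; lia.
Qed.

Lemma wsize_wbot t : (t <= n)%N -> wsize (wbot n t) = t.
Proof.
move=> tn; rewrite wsize_sum (eq_bigr (fun=> 1%N)); first by rewrite sum_nat_const card_ord muln1.
by move=> a _; have := ltn_ord a => ha; apply: wsize_unit; lia.
Qed.

Lemma Fil_nmon (e : W * nat * Rt) : valid m e -> Fil x (wsize (nexp m e)) (phi (nmon k m e)).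
Proof.
move=> ve; rewrite phi_nmon // /nexp !wsizeD !wsize_sum; apply: FilM; first apply: FilM.
- apply: Fil_prod => v; rewrite wsizeMn wsize_unit // -exprM.
  by apply: FilX; exact: Fil_letter.
- by rewrite wsizeMn wsize_wtop //; apply: FilX; exact: Fil_Dt.
apply: Fil_prod => t; case: ifP => _; first by rewrite wsize0; exact: Fil1.
have ht := ltn_ord t; rewrite wsizeD !wsizeMn wsize_wtop ?wsize_wbot ?leq_subr //; last by lia.
by apply: FilM; apply: FilX; [exact: Fil_Dt|exact: Fil_tau_Dt].
Qed.

Theorem phi_ker p : phi p = 0 -> Iideal p.
Proof.
move=> hp; have [_ [l [hl ->]] hi] := reducible_all m1 n0 p.
have [l' [u' nz' sub' hs]] := regroup_sum l.
rewrite (hs _ (@nmon k n m)) in hi.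
have vl e : e \in map snd l' -> valid m e by move/sub'/mapP => [a /hl ha ->].
have E0 : phi (\sum_(a <- l') a.1 *: nmon k m a.2) = 0.
  have := phi_kill m1 om qprim n0 hA hi.
  by rewrite (alg_homB ph) hp sub0r => /eqP; rewrite oppr_eq0 => /eqP.
have [El|nl] := eqVneq l' [::]; first by move: hi; rewrite El big_nil subr0.
(* This M exceeds every entry of every leading exponent in the sum. *)
exfalso; pose M := (\sum_(a <- l') wsize (nexp m a.2)).+2.
have M1 : (1 < M)%N by [].
have [f hf] := torus_hom m1 om qprim n0 hA M1.
have [] := Lead_sum m1 qprim n0 M1 (F := fun e => f (phi (nmon k m e))) (w := @nexp n m) u' nz' _ _ _ nl.
- by move=> e e' /vl he /vl he' E; exact: (nexp_inj m1 n0 he he' E).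
- move=> e v he; rewrite /M ltnS leqW // (leq_trans (wsize_ge _ v)) //.
  case/mapP: he => a ha ->; rewrite (big_rem a) //=; exact: leq_addr.
- by move=> e /vl he; exact: Lead_nmon.
move=> e _ /Lead_neq0; have -> : \sum_(a <- l') a.1 *: f (phi (nmon k m a.2)) =
    f (phi (\sum_(a <- l') a.1 *: nmon k m a.2)).
  rewrite (alg_hom_sum ph) (alg_hom_sum hf.1); apply: eq_bigr => a _.
  by rewrite (alg_homZ ph) (alg_homZ hf.1).
by rewrite E0 (alg_hom0 hf.1) eqxx.
Qed.

(** Induction on the degree of the image under one fixed torus homomorphism: a normal monomial with
    the same leading exponent is subtracted. By [Fil_nmon] its filtration degree is at most the size
    of that exponent, so the difference stays in degree d and the same M remains large enough. *)
Theorem phi_surj a : center a -> exists p, phi p = a.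
Proof.
have [d hd] := filtered_all xrel hA a; have M1 : (1 < d.+2)%N by [].
have [f hf] := torus_hom m1 om qprim n0 hA M1.
have [N] := ubnP (size (f a : {poly _})); elim: N a hd => // N IH a hd hN ca.
have [->|a0] := eqVneq a 0; first by exists 0; exact: alg_hom0.
have [w wd L] := Fil_Lead m1 om qprim n0 hA M1 hf hd (leqnSn d.+1) a0.
have [e ve wE] : exists2 e, valid m e & w = nexp m e.
  apply: (nexp_surj m1 n0 om) => s l hs hl; rewrite -wred_unit.
  apply: (Lead_commute m1 qprim L (Lead_tmodel m1 qprim M1 hs hl)).
  have hs' : (n.-1 - s < n)%N by lia.
  have := ca (x (Ordinal hs') (Ordinal hl)) => /(congr1 f).
  rewrite !(alg_homM hf.1) hf.2 /torus_mx /=.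
  by have -> : (n.-1 - (n.-1 - s) = s)%N by lia.
have L' := Lead_nmon M1 hf (e := e) ve; rewrite -wE in L'.
have [c hc] := Lead_cancel m1 qprim L L'.
case: (IH (a - c *: phi (nmon k m e))).
- apply: in_spanD => //; rewrite -scaleNr; apply: in_spanZ.
  by apply: Fil_le (Fil_nmon ve); rewrite -wE.
- rewrite (alg_homB hf.1) (alg_homZ hf.1); apply: leq_ltn_trans hc _.
  by case: L => b _ [sz _]; move: hN; rewrite sz ltnS.
- move=> b; rewrite mulrBl mulrBr ca -scalerAl -scalerAr; congr (_ - _ *: _).
  exact: phi_center.
move=> p hp; exists (p + c *: nmon k m e).
by rewrite (alg_homD ph) (alg_homZ ph) hp subrK.
Qed.

Lemma Iideal_prime : is_prime_ideal (@Iideal k n m).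
Proof.
split; first exact: ideal_gen_ideal.
- move/(phi_kill m1 om qprim n0 hA); rewrite (alg_hom1 ph); apply/eqP; exact: oner_neq0.
- move=> a b /(phi_kill m1 om qprim n0 hA); rewrite (alg_homM ph).
  by case/(Oq_domain m1 om qprim n0 hA) => /phi_ker; [left|right].
Qed.
End CenterIso.

(** * Krull dimension *)

Section LinearDependence.
Variables (k : fieldType) (U : lmodType k).

Lemma linear_dependence (I J : finType) (b : J -> U) (v : I -> U) :
  (forall i, exists c : J -> k, v i = \sum_j c j *: b j) -> (#|J| < #|I|)%N ->
  exists u : I -> k, (exists i, u i != 0) /\ \sum_i u i *: v i = 0.
Proof.
move=> /fin_all_exists[c hc] IJ.
pose M : 'M[k]_(#|I|, #|J|) := \matrix_(i, j) c (enum_val i) (enum_val j).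
have kn0 : kermx M != 0.
  rewrite kermx_eq0 /row_free; apply: contraTneq IJ => rk.
  by rewrite -leqNgt -rk rank_leq_col.
have [i0 hi0] : exists i, row i (kermx M) != 0.
  apply/existsP; apply: contraR kn0 => /existsPn h; apply/eqP/row_matrixP => i.
  by rewrite row0; apply/eqP; have := h i; rewrite negbK.
have [j0 hj0] : exists j, row i0 (kermx M) 0 j != 0.
  apply/existsP; apply: contraR hi0 => /existsPn h; apply/eqP/rowP => j.
  by rewrite [RHS]mxE; apply/eqP; have := h j; rewrite negbK.
exists (fun i => kermx M i0 (enum_rank i)); split.
  by exists (enum_val j0); rewrite enum_valK; rewrite mxE in hj0.
under eq_bigr => i _ do rewrite hc scaler_sumr.
rewrite exchange_big big1 //= => j _.
under eq_bigr => i _ do rewrite scalerA.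
rewrite -scaler_suml (_ : \sum_i _ = 0) ?scale0r //.
have := congr1 (fun X : 'M_(_, _) => X i0 (enum_rank j)) (mulmx_ker M).
rewrite !mxE (reindex (@enum_rank I)) /=; last exact: onW_bij (enum_rank_bij I).
by move=> E; rewrite -[RHS]E; apply: eq_bigr => i _; rewrite [M _ _]mxE !enum_rankK.
Qed.
End LinearDependence.

Section PrimeChains.
Variables (k : fieldType) (R : comAlgType k).

Fixpoint seq_monom (y : nat -> R) (j : nat) (al : seq nat) : R :=
  if al is a :: al' then y j ^+ a * seq_monom y j.+1 al' else 1.

(* The lexicographically smallest monomial of a relation can be peeled off along
   the chain, one variable per step (Coquand and Lombardi). *)
Lemma chain_independent (c : nat -> R -> Prop) (y : nat -> R) N j (l : seq (k * seq nat)) :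
  (forall i, (i <= N)%N -> is_prime_ideal (c (j + i)%N)) ->
  (forall i p, (i < N)%N -> c (j + i)%N p -> c (j + i).+1 p) ->
  (forall i, (i < N)%N -> c (j + i).+1 (y (j + i)%N) /\ ~ c (j + i)%N (y (j + i)%N)) ->
  uniq (map snd l) -> (forall p, p \in l -> p.1 != 0) ->
  (forall p, p \in l -> size p.2 = N) -> l != [::] ->
  ~ c j (\sum_(p <- l) p.1 *: seq_monom y j p.2).
Proof.
elim: N j l => [|N IH] j l hp hc hy ul nz sz nl hS.
  case: l ul nz sz nl hS => // -[a al] [|[b be] l] ul nz sz _ hS.
    have /size0nil E : size al = 0%N by apply: (sz (a, al)); rewrite inE eqxx.
    have a0 : a != 0 by apply: (nz (a, al)); rewrite inE eqxx.
    have [[_ _ hM] h1 _] := hp 0%N isT; rewrite addn0 in hM h1.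
    apply: h1; move: hS; rewrite big_seq1 E /= => /(hM a^-1%:A).
    by rewrite mulr_algl scalerA mulVf // scale1r.
  have E1 : al = [::].
    by apply/size0nil/(sz (a, al)); rewrite inE eqxx.
  have E2 : be = [::].
    by apply/size0nil/(sz (b, be)); rewrite !inE eqxx orbT.
  by move: ul; rewrite /= E1 E2 inE eqxx.
have cons p : p \in l -> p.2 = head 0%N p.2 :: behead p.2.
  by move/sz; case: p.2.
have [p0 hp0 hmin] : exists2 p0, p0 \in l & forall p, p \in l -> (head 0 p0.2 <= head 0 p.2)%N.
  have ex : exists a, has (fun p : k * seq nat => head 0%N p.2 == a) l.
    case: l nl {ul nz sz hS cons} => // p l _; exists (head 0%N p.2).
    by rewrite /= eqxx.
  have [a /hasP[p0 hp0 /eqP E] amin] := ex_minnP ex.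
  exists p0 => // p hpl; rewrite E; apply: amin; apply/hasP; exists p => //.
set a := head 0%N p0.2 in hmin.
have [[_ hD hM] _ hprime] := hp 0%N isT; rewrite addn0 in hD hM hprime.
have [[H0 HD HM] _ _] := hp 1%N isT; rewrite addn1 in H0 HD HM.
have [yin ynot] := hy 0%N isT; rewrite addn0 in yin ynot.
have ynX e : ~ c j (y j ^+ e).
  elim: e => [|e IHe]; first by rewrite expr0; have [_ h1 _] := hp 0%N isT; rewrite addn0 in h1.
  by rewrite exprS => /hprime[].
pose rest p := p.1 *: (y j ^+ (head 0%N p.2 - a) * seq_monom y j.+1 (behead p.2)).
have E : \sum_(p <- l) p.1 *: seq_monom y j p.2 = y j ^+ a * \sum_(p <- l) rest p.
  rewrite mulr_sumr big_seq [RHS]big_seq; apply: eq_bigr => p hpl.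
  rewrite {1}(cons p hpl) /= /rest -scalerAr mulrA -exprD subnKC //.
  exact: hmin.
(* The prime [c j] contains no power of [y j], so the common factor y_j^a can be cancelled inside
   it. *)
have S1 : c j.+1 (\sum_(p <- l) rest p).
  have := hc 0%N (\sum_(p <- l) rest p) isT; rewrite addn0; apply.
  by move: hS; rewrite E => /hprime[/ynX|].
pose l0 := [seq (p.1, behead p.2) | p <- l & head 0%N p.2 == a].
(* Since [y j] lies in [c j.+1], only the terms of minimal exponent a survive there, a relation in
   the later variables. *)
have S0 : c j.+1 (\sum_(p <- l0) p.1 *: seq_monom y j.+1 p.2).
  have hhigh : c j.+1 (- \sum_(p <- l | head 0%N p.2 != a) rest p).
    rewrite -mulN1r; apply: (HM); rewrite big_seq_cond.
    apply: (big_ind (c j.+1)) => // p /andP[hpl ne]; rewrite /rest.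
    have -> : (head 0 p.2 - a = (head 0 p.2 - a).-1.+1)%N.
      by rewrite prednK // subn_gt0 ltn_neqAle eq_sym ne hmin.
    by rewrite exprS -mulrA mulrC scalerAl; apply: (HM).
  have -> : \sum_(p <- l0) p.1 *: seq_monom y j.+1 p.2 =
      \sum_(p <- l) rest p + - \sum_(p <- l | head 0%N p.2 != a) rest p.
    rewrite [X in _ = X - _](bigID (fun p : k * seq nat => head 0%N p.2 == a)) /= addrK.
    rewrite big_map big_filter; apply: eq_bigr => p /eqP E1.
    by rewrite /rest E1 subnn expr0 mul1r.
  exact: HD.
apply: (IH j.+1 l0) S0.
- by move=> i hi; have := hp i.+1 hi; rewrite addnS.
- by move=> i p hi; have := hc i.+1 p hi; rewrite addnS.
- by move=> i hi; have := hy i.+1 hi; rewrite addnS.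
- rewrite -map_comp (_ : map _ _ = map behead (map snd [seq p <- l | head 0%N p.2 == a])).
    rewrite map_inj_in_uniq; first by apply: subseq_uniq ul; apply/map_subseq/filter_subseq.
    move=> s s' /mapP[p]; rewrite mem_filter => /andP[/eqP e1 m1] -> /mapP[p'].
    rewrite mem_filter => /andP[/eqP e2 m2] -> eb.
    by rewrite (cons p m1) (cons p' m2) e1 e2 eb.
  by rewrite -map_comp.
- by move=> pp /mapP[p]; rewrite mem_filter => /andP[_ /nz h] ->.
- by move=> pp /mapP[p]; rewrite mem_filter => /andP[_ /sz h] -> /=; rewrite size_behead h.
- by rewrite -size_eq0 size_map size_filter -lt0n -has_count; apply/hasP; exists p0; rewrite ?eqxx.
Qed.
End PrimeChains.

(** * Upper bound for the Krull dimension *)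

Section KrullUpper.
Variables (k : fieldType) (q : k) (m n : nat).
Hypotheses (m1 : (1 < m)%N) (om : odd m) (qprim : m.-primitive_root q) (n0 : (0 < n)%N).
Variables (A : algType k) (x : 'I_n -> 'I_n -> A).
Hypothesis hA : is_Oq q x.
Let q0 : q != 0 := prim_root_neq0 m1 qprim.
Let xrel : qrel q x := hA.1.
Local Notation T := (Tring k n m).
Local Notation V := ('I_n * 'I_n)%type.
Local Notation W := {ffun V -> nat}.
Local Notation phi := (@phi k n m q A x).
Let ph := phi_hom m1 om qprim n0 hA.

(** A finite family of (D+1)^(n^2) ordered words whose span contains all elements of degree at most
    D; the box makes counting immediate. *)
Definition box_word D (be : {ffun V -> 'I_D.+1}) : A :=
  word x (std_word [ffun v => be v : nat]).

Lemma Fil_box D z : Fil x D z ->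
  exists c : {ffun V -> 'I_D.+1} -> k, z = \sum_be c be *: box_word be.
Proof.
case/(Fil_std q0 xrel) => l [hl ->]; elim: l hl => [|p l IH] hl.
  by exists (fun=> 0); rewrite big_nil big1 // => be _; rewrite scale0r.
have [c Ec] : exists c : {ffun V -> 'I_D.+1} -> k,
    \sum_(a <- l) a.1 *: word x (std_word a.2) = \sum_be c be *: box_word be.
  by apply: IH => a ha; apply: hl; rewrite inE ha orbT.
have hp : (wsize p.2 <= D)%N by apply: hl; rewrite inE eqxx.
pose be0 : {ffun V -> 'I_D.+1} := [ffun v => inord (p.2 v)].
have Eb : box_word be0 = word x (std_word p.2).
  congr (word x (std_word _)); apply/ffunP => v; rewrite !ffunE inordK // ltnS.
  by apply: leq_trans hp; exact: wsize_ge.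
exists (fun be => (be == be0)%:R * p.1 + c be).
rewrite big_cons Ec -Eb; under [RHS]eq_bigr => be _ do rewrite scalerDl.
rewrite big_split /=; congr (_ + _).
rewrite (bigD1 be0) //= eqxx mul1r big1 ?addr0 // => be /negPf->.
by rewrite mul0r scale0r.
Qed.

Lemma Fil_seq_monom (y : nat -> T) N d s j al :
  (forall i, (i < N)%N -> Fil x d (phi (y i))) -> (j + size al <= N)%N ->
  all (fun a => (a <= s)%N) al ->
  Fil x (size al * (s * d)) (phi (seq_monom y j al)).
Proof.
move=> hy; elim: al j => [|a al IH] j /= hj.
  by move=> _; rewrite (alg_hom1 ph) mul0n; exact: Fil1.
case/andP => as_ hal; rewrite (alg_homM ph) (alg_homX ph) mulSn.
apply: FilM; last by apply: IH => //; rewrite addSn -addnS.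
apply: (@Fil_le _ _ _ _ (a * d)%N); first by rewrite leq_mul2r as_ orbT.
by apply: FilX; apply: hy; lia.
Qed.

Theorem krull_upper : ~ exists c, prime_chain_over (@Iideal k n m) (n * n).+1 c.
Proof.
case=> c [hp hs]; set N := (n * n).+1.
pose y i := epsilon (inhabits (0 : T)) (fun p => c i.+1 p /\ ~ c i p).
have hy i : (i < N)%N -> c i.+1 (y i) /\ ~ c i (y i).
  move=> hi; have [_ ex] := hs i hi.
  exact: (epsilon_spec (inhabits (0 : T)) (fun p => c i.+1 p /\ ~ c i p) ex).
have [d hd] : exists d : 'I_N -> nat, forall i, Fil x (d i) (phi (y i)).
  exact: (fin_all_exists (fun i : 'I_N => filtered_all xrel hA (phi (y i)))).
pose e := (\sum_i d i)%N.
have he i : (i < N)%N -> Fil x e (phi (y i)).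
  move=> hi; apply: (Fil_le _ (hd (Ordinal hi))).
  by rewrite /e (bigD1 (Ordinal hi)) //= leq_addr.
(* There are S^(n^2+1) monomials with exponents below S, and their images have degree at most D = N
   S e. They lie in the span of (D+1)^(n^2) words, at most ((N e + 1) S)^(n^2), which is smaller
   since S > (N e + 1)^(n^2). *)
pose S := ((N * e).+1 ^ (n * n)).+1.
pose D := (N * (S * e))%N.
pose v (al : N.-tuple 'I_S) := seq_monom y 0 (map val al).
have sz (al : N.-tuple 'I_S) : size (map val al) = N by rewrite size_map size_tuple.
have hv al : exists cc : {ffun V -> 'I_D.+1} -> k, phi (v al) = \sum_be cc be *: box_word be.
  apply: Fil_box; rewrite /D -(sz al); apply: (Fil_seq_monom he); first by rewrite sz.
  by apply/allP => _ /mapP[i _ ->]; exact: (ltnW (ltn_ord i)).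
have card : (#|{: {ffun V -> 'I_D.+1}}| < #|{: N.-tuple 'I_S}|)%N.
  rewrite card_tuple card_ffun card_prod !card_ord.
  have S0 : (0 < S)%N by [].
  have h1 : (D.+1 <= (N * e).+1 * S)%N.
    by rewrite /D mulnCA [(_ * S)%N]mulnC mulnS; lia.
  have h2 : (D.+1 ^ (n * n) <= ((N * e).+1 * S) ^ (n * n))%N.
    by have [->|nn] := posnP (n * n); rewrite ?expn0 // leq_exp2r.
  apply: leq_ltn_trans h2 _; rewrite expnMn [(S ^ N)%N]expnS ltn_mul2r.
  by rewrite expn_gt0 S0 /S ltnS leqnn.
have [u [[al0 ual0] hu]] := linear_dependence hv card.
pose l := [seq (u al, map val al) | al <- enum {: N.-tuple 'I_S} & u al != 0].
have El : \sum_(p <- l) p.1 *: seq_monom y 0 p.2 = \sum_al u al *: v al.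
  rewrite big_map big_filter big_enum_cond [RHS](bigID (fun al => u al != 0)) /=.
  rewrite [X in _ + X]big1 ?addr0 // => al; rewrite negbK => /eqP->.
  by rewrite scale0r.
apply: (@chain_independent k _ c y N 0 l).
- by move=> i hi; case: (hp i hi).
- by move=> i p hi; case: (hs i hi) => h _; exact: h.
- exact: hy.
- rewrite -map_comp map_inj_uniq; first by apply: filter_uniq; exact: enum_uniq.
  by move=> a b /= /(inj_map val_inj) E; apply: val_inj.
- by move=> pp /mapP[al]; rewrite mem_filter => /andP[h _] ->.
- by move=> pp /mapP[al _ ->] /=.
- rewrite -size_eq0 size_map size_filter -lt0n -has_count; apply/hasP.
  by exists al0; rewrite ?mem_enum.
rewrite El; have [_ h] := hp 0%N isT; apply: h.
apply: (phi_ker m1 om qprim n0 hA); rewrite (alg_hom_sum ph) -[RHS]hu.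
by apply: eq_bigr => al _; rewrite (alg_homZ ph).
Qed.
End KrullUpper.

(** * Lower bound for the Krull dimension *)

Section KrullLower.
Variables (k : closedFieldType) (m n : nat).
Hypotheses (m1 : (1 < m)%N) (n0 : (0 < n)%N).
Local Notation T := (Tring k n m).
Local Notation V := ('I_n * 'I_n)%type.
Implicit Types (a b : nat -> nat -> k).

Definition pt_good a := forall r l, (r < n)%N -> (l < n)%N -> a r l != 0.
(** Coordinates are m-th powers of [a], so D and the Y take values that are monomials in [a] without
    extracting roots. The value 1 out of range keeps [pt_c] a genuine quotient everywhere; [k^o] is
    [k] as an algebra over itself. *)
Definition pt_u a (r l : nat) : k^o := if (r < n)%N && (l < n)%N then a r l ^+ m else 1.
Definition pt_c a (r l : nat) : k^o := pt_u a r.+1 l / pt_u a r l.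
Definition pt_z a : nat -> nat -> nat -> k^o := model (pt_u a) (pt_c a).
Definition pt_top a t : k^o := \prod_(s < t) a (n.-1 - s)%N (n - t + s)%N.
Definition pt_bot a t : k^o := \prod_(s < t) a (t.-1 - s)%N s.

Definition pt_val a (v : Tvar n m) : k :=
  match v with
  | inl (inl (i, j)) => pt_z a n (n.-1 - i) j
  | inl (inr (t, r)) => pt_top a t.+1 ^+ r.+1 * pt_bot a (n - t.+1) ^+ (m - r.+1)
  | inr _ => pt_top a n
  end.

Definition pt_eval a (p : T) : k^o := p.@[fun i => pt_val a (enum_val i)].

Lemma pt_eval_hom a : alg_hom (pt_eval a).
Proof.
by split=> [p p'|p p'||c p]; rewrite /pt_eval ?mevalD ?mevalM ?meval1 ?mevalZ.
Qed.

Lemma pt_eval_Tx a v : pt_eval a (Tx k v) = pt_val a v.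
Proof. by rewrite /pt_eval /Tx mevalXU enum_rankK. Qed.

Lemma pt_u_neq0 a r l : pt_good a -> pt_u a r l != 0.
Proof.
move=> ga; rewrite /pt_u; case: ifP => [/andP[hr hl]|_]; last exact: oner_neq0.
by rewrite expf_neq0 // ga.
Qed.

Lemma pt_cu a : pt_good a -> forall r l, pt_c a r l * pt_u a r l = pt_u a r.+1 l.
Proof. by move=> ga r l; rewrite /pt_c divfK // pt_u_neq0. Qed.

Lemma pt_row a p r j l : (j < l)%N ->
  pt_z a p r j * pt_z a p r l = 1 *: (pt_z a p r l * pt_z a p r j).
Proof. by move=> _; rewrite scale1r [LHS]mulrC. Qed.

Lemma pt_eval_Zv a i j : (i < n)%N -> (j < n)%N ->
  pt_eval a (Zv k n m i.+1 j.+1) = pt_z a n (n.-1 - i) j.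
Proof. by move=> hi hj; rewrite ZvE pt_eval_Tx. Qed.

Lemma pt_eval_kill a p : pt_good a -> Iideal p -> pt_eval a p = 0.
Proof.
move=> ga; apply: (Iideal_kill (DA := pt_top a) (DB := pt_bot a) (pt_eval_hom a)).
- by move=> t _; exact: mulrC.
- move=> t tn; rewrite detA_qdet (alg_hom_qdet (pt_eval_hom a)).
  transitivity (qdet 1 t (fun s l => pt_z a n (n.-1 - s) (n - t + l))).
    apply: eq_qdet => s b hs hb; rewrite addnS pt_eval_Zv //; lia.
  have h1 : (t <= n.-1.+1)%N by rewrite prednK.
  have h2 : (n - t + t <= n)%N by lia.
  have h3 : (n - t + t = n)%N \/ n.-1.+1 = t by left; lia.
  rewrite [LHS](model_minor (pt_cu ga) (@pt_row a) h1 h2 h3).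
  rewrite /pt_top -prodrXl; apply: eq_bigr => s _; have := ltn_ord s => hs.
  by rewrite /pt_u (_ : (n.-1 - s < n)%N && (n - t + s < n)%N) //; apply/andP; lia.
- move=> t tn; rewrite detB_qdet (alg_hom_qdet (pt_eval_hom a)).
  transitivity (qdet 1 t (fun s l => pt_z a n (t.-1 - s) l)).
    apply: eq_qdet => s b hs hb; rewrite addnS pt_eval_Zv //; try lia.
    by congr (pt_z _ _ _ _); lia.
  rewrite [LHS](model_minor_bottom (pt_cu ga) (@pt_row a) tn).
  rewrite /pt_bot -prodrXl; apply: eq_bigr => s _; have := ltn_ord s => hs.
  by rewrite /pt_u (_ : (t.-1 - s < n)%N && (s < n)%N) //; apply/andP; lia.
- by rewrite pt_eval_Tx.
- move=> [|t] [|r] // ht hr.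
  have ht' : (t < n.-1)%N by lia.
  have hr' : (r < m.-1)%N by lia.
  by rewrite YvE pt_eval_Tx.
Qed.

(** An entry is its own coordinate plus a function of the coordinates of smaller rank, so the
    coordinates can be moved one at a time; this yields strict inclusions in the chain. *)
Lemma pt_z_triangular a b p r j : pt_good a -> pt_good b ->
  (p <= n)%N -> (r < n)%N -> (j < p)%N ->
  (forall r' j', (r' < n)%N -> (j' < n)%N -> (cell_rank n r' j' < cell_rank n r j)%N ->
     a r' j' = b r' j') ->
  pt_z a p r j - pt_u a r j = pt_z b p r j - pt_u b r j.
Proof.
move=> ga gb; elim: p r => // p IH r pn rn; rewrite ltnS leq_eqVlt => /orP[/eqP->|jp] h.
  by rewrite /pt_z (model_last_col (pt_cu ga)) (model_last_col (pt_cu gb)) !subrr.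
elim: r rn h => [|r IHr] rn h.
  by rewrite /pt_z !model_row0 (ltn_eqF jp); apply: IH => //; exact: ltnW.
have eu r' l : (cell_rank n r' l < cell_rank n r.+1 j)%N -> pt_u a r' l = pt_u b r' l.
  by move=> hl; rewrite /pt_u; case: ifP => // /andP[hr hl']; rewrite h.
have e1 : pt_u a r.+1 p = pt_u b r.+1 p by apply: eu; rewrite /cell_rank; lia.
have e2 : pt_u a r p = pt_u b r p by apply: eu; rewrite /cell_rank; nia.
have e3 : pt_u a r j = pt_u b r j by apply: eu; rewrite /cell_rank; nia.
have E : pt_z a p.+1 r j = pt_z b p.+1 r j.
  apply: (addIr (- pt_u a r j)); rewrite {2}e3; apply: IHr; first exact: ltnW.
  move=> r' j' hr hj hl; apply: h => //; apply: ltn_trans hl _.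
  by rewrite /cell_rank; nia.
rewrite /pt_z !modelS -/(pt_z a) -/(pt_z b).
have -> : pt_c a r p = pt_c b r p by rewrite /pt_c e1 e2.
have EE : pt_z a p r.+1 j - pt_u a r.+1 j = pt_z b p r.+1 j - pt_u b r.+1 j.
  by apply: IH => //; exact: ltnW.
by rewrite E addrAC EE addrAC.
Qed.

Section Rational.
Variable g : nat -> nat -> {poly k}.
Definition curve (s : k) (r l : nat) : k := (g r l).[s].

(** Rationality along the curve with denominators invertible at every good parameter, where zeros of
    [f] are zeros of [P]. *)
Definition rat_fun (f : k -> k) := exists P W : {poly k},
  forall s, pt_good (curve s) -> W.[s] != 0 /\ f s * W.[s] = P.[s].

Lemma rat_fun_poly (P : {poly k}) : rat_fun (fun s => P.[s]).
Proof. by exists P, 1 => s _; rewrite hornerC mulr1 oner_neq0. Qed.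

Lemma rat_fun_ext f h : f =1 h -> rat_fun f -> rat_fun h.
Proof. by move=> e [P [W H]]; exists P, W => s /H; rewrite e. Qed.

Lemma rat_funD f h : rat_fun f -> rat_fun h -> rat_fun (fun s => f s + h s).
Proof.
move=> [P [W H]] [P' [W' H']]; exists (P * W' + P' * W), (W * W') => s gs.
have [w e] := H s gs; have [w' e'] := H' s gs.
rewrite hornerD !hornerM mulf_neq0 // -e -e'; split=> //.
by ring.
Qed.

Lemma rat_funM f h : rat_fun f -> rat_fun h -> rat_fun (fun s => f s * h s).
Proof.
move=> [P [W H]] [P' [W' H']]; exists (P * P'), (W * W') => s gs.
have [w e] := H s gs; have [w' e'] := H' s gs.
rewrite !hornerM mulf_neq0 // -e -e'; split=> //.
by rewrite mulrACA.
Qed.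

Lemma rat_fun_const c : rat_fun (fun=> c).
Proof. by apply: rat_fun_ext (rat_fun_poly c%:P) => s; rewrite hornerC. Qed.

Lemma rat_funX f e : rat_fun f -> rat_fun (fun s => f s ^+ e).
Proof.
move=> h; elim: e => [|e IH]; first exact: (rat_fun_const 1).
by apply: rat_fun_ext (rat_funM h IH) => s; rewrite exprS.
Qed.

Lemma rat_fun_sum (I : Type) (l : seq I) (F : I -> k -> k) :
  (forall i, rat_fun (F i)) -> rat_fun (fun s => \sum_(i <- l) F i s).
Proof.
move=> h; elim: l => [|i l IH].
  by apply: rat_fun_ext (rat_fun_const 0) => s; rewrite big_nil.
by apply: rat_fun_ext (rat_funD (h i) IH) => s; rewrite big_cons.
Qed.

Lemma rat_fun_prod (I : Type) (l : seq I) (F : I -> k -> k) :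
  (forall i, rat_fun (F i)) -> rat_fun (fun s => \prod_(i <- l) F i s).
Proof.
move=> h; elim: l => [|i l IH].
  by apply: rat_fun_ext (rat_fun_const 1) => s; rewrite big_nil.
by apply: rat_fun_ext (rat_funM (h i) IH) => s; rewrite big_cons.
Qed.

Let upoly r l : {poly k} := if (r < n)%N && (l < n)%N then g r l ^+ m else 1.
Let upolyE s r l : (upoly r l).[s] = pt_u (curve s) r l.
Proof. by rewrite /upoly /pt_u; case: ifP => _; rewrite ?horner_exp ?hornerC. Qed.

Lemma rat_fun_c r l : rat_fun (fun s => pt_c (curve s) r l).
Proof.
exists (upoly r.+1 l), (upoly r l) => s gs; rewrite !upolyE pt_u_neq0 //; split=> //.
exact: pt_cu.
Qed.

Lemma rat_fun_z p r j : rat_fun (fun s => pt_z (curve s) p r j).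
Proof.
elim: p r => [|p IH] r; first exact: (rat_fun_const 0).
elim: r => [|r IHr].
  have [E|ne] := eqVneq j p.
    apply: rat_fun_ext (rat_fun_poly (upoly 0 p)) => s.
    by rewrite /pt_z model_row0 E eqxx upolyE.
  by apply: rat_fun_ext (IH 0%N) => s; rewrite /pt_z model_row0 (negPf ne).
exact: (rat_funD (IH r.+1) (rat_funM (rat_fun_c r p) IHr)).
Qed.

Lemma rat_fun_eval p : rat_fun (fun s => pt_eval (curve s) p).
Proof.
have hv v : rat_fun (fun s => pt_val (curve s) v).
  case: v => [[[i j]|[t r]]|[]] /=.
  - exact: rat_fun_z.
  - apply: rat_funM; apply: rat_funX; apply: rat_fun_prod => i; exact: rat_fun_poly.
  - apply: rat_fun_prod => i; exact: rat_fun_poly.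
apply: rat_fun_ext (_ : rat_fun (fun s => \sum_(v <- msupp p) (p@_v *
   \prod_i pt_val (curve s) (enum_val i) ^+ v i))).
  by move=> s; rewrite /pt_eval mevalE.
apply: rat_fun_sum => v; apply: rat_funM; first exact: rat_fun_const.
by apply: rat_fun_prod => i; apply: rat_funX.
Qed.
End Rational.

(** The point sets shrink from all good points at i = 0 to the point with all coordinates 1 at i = n
    * n, so their vanishing ideals increase. *)
Definition pt_ideal (i : nat) (p : T) := forall a, pt_good a ->
  (forall r l, (r < n)%N -> (l < n)%N -> (cell_rank n r l < i)%N -> a r l = 1) ->
  pt_eval a p = 0.

(* Two points of the variety are joined by a line, along which both evaluations are
   rational, so that a common non-zero exists. *)
Lemma pt_ideal_prime i : is_prime_ideal (pt_ideal i).
Proof.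
split.
- split=> [a _ _|p p' h h' a ga ha|p p' h a ga ha].
  + exact: (alg_hom0 (pt_eval_hom a)).
  + by rewrite (alg_homD (pt_eval_hom a)) h // h' // addr0.
  + by rewrite (alg_homM (pt_eval_hom a)) h // mulr0.
- move=> /(_ (fun _ _ => 1)) h; have : (1 : k^o) = 0.
    rewrite -(alg_hom1 (pt_eval_hom (fun _ _ => 1))); apply: h => // r l _ _.
    exact: oner_neq0.
  by apply/eqP; exact: oner_neq0.
move=> p p' hpp; case: (excluded_middle_informative (pt_ideal i p)) => [|np]; first by left.
right=> b gb hb; apply/eqP/negPn/negP => nb.
apply: np => a ga ha; apply/eqP/negPn/negP => na.
pose g r l : {poly k} := (a r l)%:P * (1 - 'X) + (b r l)%:P * 'X.
have gE s r l : curve g s r l = a r l * (1 - s) + b r l * s.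
  by rewrite /curve /g !hornerE.
have [P [W H]] := rat_fun_eval g p; have [P' [W' H']] := rat_fun_eval g p'.
pose Gd : {poly k} := \prod_(v : V) g v.1 v.2.
have GdE s : Gd.[s] = \prod_(v : V) curve g s v.1 v.2 by rewrite /Gd horner_prod.
have good_Gd s : Gd.[s] != 0 -> pt_good (curve g s).
  rewrite GdE => /prodf_neq0 h r l hr hl.
  exact: (h (Ordinal hr, Ordinal hl)).
have Gd_good s : pt_good (curve g s) -> Gd.[s] != 0.
  by move=> gs; rewrite GdE; apply/prodf_neq0 => v _; exact: gs.
have c0 r l : curve g 0 r l = a r l by rewrite gE subr0 mulr1 mulr0 addr0.
have c1 r l : curve g 1 r l = b r l by rewrite gE subrr mulr0 add0r mulr1.
have g0 : pt_good (curve g 0) by move=> r l hr hl; rewrite c0 ga.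
have g1 : pt_good (curve g 1) by move=> r l hr hl; rewrite c1 gb.
have ev_ext d d' pp : (forall r l, d r l = d' r l) -> pt_eval d pp = pt_eval d' pp.
  move=> e; suff -> : d = d' by [].
  by apply: functional_extensionality => r; apply: functional_extensionality => l.
have P0 : P.[0] != 0.
  by have [w <-] := H 0 g0; rewrite mulf_neq0 // (ev_ext _ _ _ c0).
have P1 : P'.[1] != 0.
  by have [w <-] := H' 1 g1; rewrite mulf_neq0 // (ev_ext _ _ _ c1).
have nz (R : {poly k}) s : R.[s] != 0 -> R != 0.
  by apply: contraNneq => ->; rewrite horner0.
(* A parameter that is no root of this product gives a good point where neither evaluation vanishes.
   The coordinates equal to 1 at both ends stay 1 along the line. *)
have : Gd * P * P' != 0 by rewrite !mulf_neq0 // (nz _ _ (Gd_good _ g0), nz _ _ P0, nz _ _ P1).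
case/closed_nonrootP => s; rewrite rootE !hornerM !mulf_eq0 !negb_or => /andP[/andP[hG hP] hP'].
have gs := good_Gd s hG.
have [w e] := H s gs; have [w' e'] := H' s gs.
have := hpp (curve g s) gs; rewrite (alg_homM (pt_eval_hom _)) => hz.
have : pt_eval (curve g s) p * pt_eval (curve g s) p' = 0.
  by apply: hz => r l hr hl hrk; rewrite gE ha // hb // !mul1r subrK.
move/eqP; rewrite mulf_eq0 => /orP[/eqP E|/eqP E].
  by move: hP; rewrite -e E mul0r eqxx.
by move: hP'; rewrite -e' E mul0r eqxx.
Qed.

Theorem krull_lower : exists c, prime_chain_over (@Iideal k n m) (n * n) c.
Proof.
exists pt_ideal; split=> [i _|i hi].
  split; first exact: pt_ideal_prime.
  by move=> p hp a ga _; exact: pt_eval_kill.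
split=> [p h a ga ha|].
  by apply: h => // r l hr hl hrk; apply: ha => //; exact: ltnW.
(* The cell of rank [i], whose coordinate is specialised in this step of the chain. *)
pose r := (i %/ n)%N; pose j := (n.-1 - i %% n)%N.
have rn : (r < n)%N by rewrite /r ltn_divLR.
have jn : (j < n)%N by rewrite /j; lia.
have rk : cell_rank n r j = i.
  rewrite /cell_rank /r /j subKn; first by rewrite -divn_eq.
  by rewrite -ltnS prednK // ltn_pmod.
pose one : nat -> nat -> k := fun _ _ => 1.
have g1 : pt_good one by move=> *; exact: oner_neq0.
have [al al0 alm] : exists2 al : k, al != 0 & al ^+ m != 1.
  have : 'X * ('X^m - 1) != 0 :> {poly k}.
    by rewrite mulf_neq0 ?polyX_eq0 // -size_poly_eq0 size_XnsubC // ltnW.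
  case/closed_nonrootP => s; rewrite rootE !hornerE mulf_eq0 negb_or => /andP[h1 h2].
  by exists s => //; move: h2; rewrite subr_eq0.
pose b r' l' := if (r' == r) && (l' == j) then al else one r' l'.
have gb : pt_good b by move=> r' l' _ _; rewrite /b; case: ifP => // _; exact: oner_neq0.
pose v : Tvar n m := inl (inl (rev_ord (Ordinal rn), Ordinal jn)).
have ev a : pt_eval a (Tx k v) = pt_z a n r j.
  by rewrite pt_eval_Tx /=; congr (pt_z _ _ _ _); lia.
(* On points whose coordinates of rank below [i] are 1, triangularity turns this into the m-th power
   of [a r j] minus 1: zero once that coordinate is 1, nonzero at [b]. *)
exists (Tx k v - (pt_z one n r j)%:MP).
have evB a : pt_eval a (Tx k v - (pt_z one n r j)%:MP) = pt_z a n r j - pt_z one n r j.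
  by rewrite (alg_homB (pt_eval_hom a)) ev /pt_eval mevalC.
have tri a : pt_good a -> (forall r' j', (r' < n)%N -> (j' < n)%N ->
    (cell_rank n r' j' < i)%N -> a r' j' = 1) ->
    pt_z a n r j - pt_z one n r j = pt_u a r j - pt_u one r j.
  move=> ga ha; have := @pt_z_triangular a one n r j ga g1 (leqnn n) rn jn.
  rewrite rk => /(_ ha) E; apply/eqP; rewrite subr_eq.
  move/eqP: E; rewrite subr_eq => /eqP ->; apply/eqP.
  by rewrite [RHS]addrC [RHS]addrA addrAC.
split=> [a ga ha|/(_ b gb)].
  rewrite evB tri //; last by move=> r' j' hr hj hrk; apply: ha => //; exact: ltnW.
  by rewrite /pt_u rn jn /= ha ?rk ?subrr.
move=> h; have : pt_eval b (Tx k v - (pt_z one n r j)%:MP) = 0.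
  apply: h => r' l' hr hl hrk; rewrite /b; case: ifP => // /andP[/eqP e1 /eqP e2].
  by move: hrk; rewrite e1 e2 rk ltnn.
rewrite evB tri //; last first.
  move=> r' l' hr hl hrk; rewrite /b; case: ifP => // /andP[/eqP e1 /eqP e2].
  by move: hrk; rewrite e1 e2 rk ltnn.
rewrite /pt_u rn jn /= /b !eqxx /one expr1n => /eqP; rewrite subr_eq0.
by rewrite (negPf alm).
Qed.
End KrullLower.

Theorem mainTheorem8 (k : closedFieldType) (hchar : [pchar k] =i pred0)
  (n m : nat) (q : k) (hn : (2 <= n)%N) (hm : (3 <= m)%N) (hodd : odd m)
  (hq : m.-primitive_root q)
  (A : algType k) (x : 'I_n -> 'I_n -> A) (hA : is_Oq q x) :
  krull_dim_quot_eq (@Iideal k n m) (n * n) /\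
  quot_is_domain (@Iideal k n m) /\
  ((forall p, center (@phi k n m q A x p)) /\
   (forall p p', @phi k n m q A x (p * p') = @phi k n m q A x p * @phi k n m q A x p') /\
   (forall p, @phi k n m q A x p = 0 <-> @Iideal k n m p) /\
   (forall a, center a -> exists p, @phi k n m q A x p = a)).
Proof.
have m1 : (1 < m)%N by exact: leq_trans hm.
have n0 : (0 < n)%N by exact: leq_trans hn.
have ph := phi_hom m1 hodd hq n0 hA.
split; first by split; [exact: krull_lower|exact: (krull_upper m1 hodd hq n0 hA)].
split; first exact: (Iideal_prime m1 hodd hq n0 hA).
split; [exact: phi_center|split; [exact: (alg_homM ph)|split]].
  by move=> p; split; [exact: phi_ker|exact: (phi_kill m1 hodd hq n0 hA)].
exact: phi_surj.
Qed.
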